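(* Let $\mathcal{E}$ be a family degenerating to a rank-two torsion-free sheaf with an isolated point singularity at the origin. Then $\mathcal{E}$ admits no presentation of the form $$0\to\mathcal{O}_X^{\oplus r}\to\mathcal{O}_X^{\oplus r+2}\to\mathcal{E}\to0$$ near the singular point $(o,0)$, for any $r$.
   Context: $B\subset\mathbb{C}^3$ is the unit ball centered at the origin $o$, $\Delta\subset\mathbb{C}$ the unit disk with coordinate $t$, $X=B\times\Delta$. For a coherent sheaf $\mathcal{E}$ on $X$, $\mathcal{E}_t$ is its restriction $\mathcal{E}\otimes\mathcal{O}_{B\times\{t\}}$, and $\mathcal{C}=\mathcal{E}\otimes\mathcal{O}_{B\times\{0\}}$ is the central fiber, a sheaf on $B$. $\mathcal{E}$ is a family degenerating to a rank-two torsion-free sheaf with an isolated point singularity at the origin if $\mathcal{E}_t$ is locally free of rank two for every $t\ne0$ and $\mathcal{C}$ is a rank-two torsion-free sheaf locally free on $B\setminus\{o\}$ but not at $o$. *)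

(* Defs.v *)
From HB Require Import structures.
From mathcomp Require Import all_boot all_order all_algebra.
From mathcomp Require Import boolp classical_sets functions.
From mathcomp Require Import reals topology normedtype landau derive.
From mathcomp Require Import complex generic_quotient.

Set Implicit Arguments.
Unset Strict Implicit.
Unset Printing Implicit Defensive.

Import Order.TTheory GRing.Theory Num.Theory.
Import numFieldNormedType.Exports.

Local Open Scope classical_set_scope.
Local Open Scope ring_scope.
Local Open Scope quotient_scope.

Identity Coercion fun_of_set : set >-> Funclass.

Record opens (T : topologicalType) := Opens {
  opens_set :> set T;
  opensP : open opens_set }.

Record opens_in (T : topologicalType) (X : set T) := OpensIn {
  opens_of :> opens T;
  opens_inP : opens_of `<=` X }.

Lemma opensT_subproof (T : topologicalType) (X : opens T) : X `<=` X.
Proof. by []. Qed.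

Definition opens_inT (T : topologicalType) (X : opens T) : opens_in X :=
  OpensIn (@opensT_subproof T X).

Lemma opens_in_incl_subproof (T : topologicalType) (X : set T)
  (U : opens_in X) (W : opens_in U) : W `<=` X.
Proof. by move=> x /(@opens_inP _ _ W) /(@opens_inP _ _ U). Qed.

Definition opens_in_incl (T : topologicalType) (X : set T) (U : opens_in X)
    (W : opens_in U) : opens_in X := OpensIn (@opens_in_incl_subproof T X U W).

Lemma opensI_subproof (T : topologicalType) (U W : opens T) : open (U `&` W).
Proof. exact: openI (opensP U) (opensP W). Qed.

Definition opensI (T : topologicalType) (U W : opens T) : opens T :=
  Opens (@opensI_subproof T U W).

Lemma opens_inI_subproof (T : topologicalType) (X : set T) (U : opens_in X)
  (W : opens T) : opensI U W `<=` X.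
Proof. by move=> x [/opens_inP]. Qed.

Definition opens_inI (T : topologicalType) (X : set T) (U : opens_in X)
  (W : opens T) : opens_in X := OpensIn (@opens_inI_subproof T X U W).

Definition subset_incl (T : Type) (U W : set T) (h : W `<=` U) (x : W) : U :=
  SigSub (mem_set (h _ (set_mem (valP x)))).

Section Holomorphic.
Variables (K : numFieldType) (V : normedModType K).
Implicit Types (U W : opens V).

Lemma near_differentiable (f g : V -> K) (x : V) :
  (\forall y \near x, f y = g y) -> differentiable f x -> differentiable g x.
Proof.
move=> fg /diff_locallyP [cf /eqaddoP Ef].
have fgx : f x = g x by exact: nbhs_singleton fg.
have Eg : g \o shift x = cst (g x) + 'd f x +o_ 0 id.
  apply/eqaddoP => e e0; move: (Ef e e0).
  have : \forall y \near (0 : V), f (y + x) = g (y + x).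
    by move: fg; rewrite (near_shift 0) subr0.
  move=> fg0 Ef0; apply: filterS2 fg0 Ef0 => y fgy.
  by rewrite !fctE /= fgx fgy.
by apply/diff_locallyP; rewrite (diff_unique cf Eg).
Qed.

(* Instantiated below at K = R[i]: complex Frechet differentiability at every
   point of U. Functions on U are differentiated through their extension by 0
   to V, which is harmless because U is open. *)
Definition holomorphic U : {pred (U -> K)} :=
  fun f => `[< forall x, U x -> differentiable (valL_ 0 f) x >].

Lemma valL_val U (f : U -> K) (u : U) : valL_ 0 f (val u) = f u.
Proof. by rewrite -[RHS](congr1 (@^~ u) (valLK 0 f)). Qed.

Lemma valL_mem U (f : U -> K) x (Ux : x \in (U : set V)) :
  valL_ 0 f x = f (SigSub Ux).
Proof. by rewrite -valL_val. Qed.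

Lemma holomorphic_local U (f : U -> K) :
  (forall x, U x -> exists g : V -> K, differentiable g x /\
     \forall y \near x, forall u : U, val u = y -> f u = g y) ->
  f \in @holomorphic U.
Proof.
move=> H; apply/asboolP => x Ux; have [g [dg fg]] := H x Ux.
apply: near_differentiable dg; near=> y.
have Uy : y \in (U : set V).
  by apply/mem_set; near: y; exact: open_nbhs_nbhs (conj (opensP U) Ux).
by rewrite (valL_mem _ Uy); symmetry; apply: (near fg y _ (SigSub Uy)).
Unshelve. all: by end_near. Qed.

Lemma holomorphic_ext U (f : U -> K) (g : V -> K) :
  (forall u, f u = g (val u)) -> (forall x, U x -> differentiable g x) ->
  f \in @holomorphic U.
Proof.
move=> fg dg; apply: holomorphic_local => x Ux; exists g; split; first exact: dg.
by near=> y => u <-.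
Unshelve. all: by end_near. Qed.

Lemma holomorphic_subring U : subring_closed (@holomorphic U).
Proof.
split.
- by apply: (@holomorphic_ext _ _ (cst 1)).
- move=> f g /asboolP df /asboolP dg.
  apply: (@holomorphic_ext _ _ (valL_ 0 f - valL_ 0 g)) => [u|x Ux].
    by rewrite !fctE !valL_val.
  by apply: differentiableB; [exact: df|exact: dg].
- move=> f g /asboolP df /asboolP dg.
  apply: (@holomorphic_ext _ _ (valL_ 0 f * valL_ 0 g)) => [u|x Ux].
    by rewrite !fctE !valL_val.
  by apply: differentiableM; [exact: df|exact: dg].
Qed.

HB.instance Definition _ U :=
  GRing.isSubringClosed.Build (U -> K) (@holomorphic U) (@holomorphic_subring U).

Record holo U := Holo { holo_fun :> U -> K; holoP : holo_fun \in @holomorphic U }.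

HB.instance Definition _ U := [isSub for @holo_fun U].
HB.instance Definition _ U := [Choice of holo U by <:].
HB.instance Definition _ U := GRing.SubChoice_isSubComPzRing.Build
  (U -> K) (@holomorphic U) (holo U) (@holomorphic_subring U).

Lemma holo_eq U (f g : holo U) : (forall u, f u = g u) -> f = g.
Proof. by move=> fg; apply/val_inj/funext. Qed.

Lemma holo_res_subproof U W (h : W `<=` U) (f : holo U) :
  (f : U -> K) \o subset_incl h \in @holomorphic W.
Proof.
apply: (@holomorphic_ext _ _ (valL_ 0 f)) => [u|x Wx].
  exact: esym (valL_val f (subset_incl h u)).
by have /asboolP := holoP f; apply; exact: h.
Qed.

Definition holo_res U W (h : W `<=` U) (f : holo U) : holo W :=
  Holo (holo_res_subproof h f).

Lemma holo_resE U W (h : W `<=` U) (f : holo U) w :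
  holo_res h f w = f (subset_incl h w).
Proof. by []. Qed.

End Holomorphic.
Arguments holomorphic {K V} U.

Lemma subset_inclE (T : Type) (U W : set T) (h : W `<=` U) (w : W)
  (Uw : val w \in U) : subset_incl h w = SigSub Uw.
Proof. exact: val_inj. Qed.

Section Sheaf.
Variables (K : numFieldType) (V : normedModType K).

(* Sheaves of O_X-modules, X an open subset of V. *)
Record sheaf (X : opens V) := Sheaf {
  sections :> forall U : opens_in X, lmodType (holo U);
  sres : forall U W : opens_in X, W `<=` U -> sections U -> sections W;
  sres_linear : forall (U W : opens_in X) (h : W `<=` U) (a : holo U)
    (s t : sections U),
    sres h (a *: s + t) = holo_res h a *: sres h s + sres h t;
  sres_id : forall (U : opens_in X) (h : U `<=` U) (s : sections U),
    sres h s = s;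
  sres_comp : forall (U W Z : opens_in X) (hW : W `<=` U) (hZ : Z `<=` W)
    (h : Z `<=` U) (s : sections U), sres hZ (sres hW s) = sres h s;
  sheaf_separated : forall (U : opens_in X) (I : Type) (W : I -> opens_in X)
    (h : forall i, W i `<=` U), U `<=` \bigcup_i W i ->
    forall s t : sections U,
    (forall i, sres (h i) s = sres (h i) t) -> s = t;
  sheaf_glue : forall (U : opens_in X) (I : Type) (W : I -> opens_in X)
    (h : forall i, W i `<=` U), U `<=` \bigcup_i W i ->
    forall s : forall i, sections (W i),
    (forall (i j : I) (Z : opens_in X) (hi : Z `<=` W i) (hj : Z `<=` W j),
      sres hi (s i) = sres hj (s j)) ->
    exists t : sections U, forall i, sres (h i) t = s i }.

Lemma sres0 (X : opens V) (F : sheaf X) (U W : opens_in X) (h : W `<=` U) :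
  sres h (0 : F U) = 0.
Proof.
by have := sres_linear h (-1) (0 : F U) 0; rewrite scaler0 addr0 => ->;
   rewrite (_ : holo_res h (-1) = -1) ?scaleN1r ?addNr //; exact: holo_eq.
Qed.

Section Restriction.
Variables (X : opens V) (F : sheaf X) (U : opens_in X).

Program Definition sheaf_restr : sheaf U := {|
  sections := fun W : opens_in U => F (opens_in_incl W);
  sres := fun (W Z : opens_in U) (h : Z `<=` W) =>
    @sres X F (opens_in_incl W) (opens_in_incl Z) h |}.
Next Obligation. by move=> *; apply: sres_linear. Qed.
Next Obligation. by move=> *; apply: sres_id. Qed.
Next Obligation. by move=> *; apply: sres_comp. Qed.
Next Obligation.
move=> W I Z h cov s t.
exact: (@sheaf_separated _ F (opens_in_incl W) I (fun i => opens_in_incl (Z i)) h cov).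
Qed.
Next Obligation.
move=> W I Z h cov s hs.
apply: (@sheaf_glue _ F (opens_in_incl W) I (fun i => opens_in_incl (Z i)) h cov).
move=> i j T hi hj.
have TU : T `<=` U by move=> x /hi /(@opens_inP _ _ (Z i)).
have TT : T `<=` opens_in_incl (OpensIn TU) by [].
by have := congr1 (sres TT) (hs i j (OpensIn TU) hi hj); rewrite !sres_comp.
Qed.

End Restriction.

Section Free.
Variables (X : opens V) (n : nat).

Lemma holo_glue (U : opens_in X) (I : Type) (W : I -> opens_in X)
    (h : forall i, W i `<=` U) : U `<=` \bigcup_i W i ->
    forall s : forall i, holo (W i),
    (forall (i j : I) (Z : opens_in X) (hi : Z `<=` W i) (hj : Z `<=` W j),
      holo_res hi (s i) = holo_res hj (s j)) ->
    exists t : holo U, forall i, holo_res (h i) t = s i.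
Proof.
move=> cov s hs.
have compat i j x (xi : x \in (W i : set V)) (xj : x \in (W j : set V)) :
    s i (SigSub xi) = s j (SigSub xj).
  pose Z := opens_inI (W i) (W j).
  have Zi : Z `<=` W i by move=> y [].
  have Zj : Z `<=` W j by move=> y [].
  have Zx : x \in (Z : set V) by apply/mem_set; split; exact: set_mem.
  have := congr1 (fun f : holo Z => f (SigSub Zx)) (hs i j Z Zi Zj).
  by rewrite !holo_resE (@subset_inclE _ _ _ Zi (SigSub Zx) xi) (@subset_inclE _ _ _ Zj (SigSub Zx) xj).
have /choice[ix ixP] (u : U) : exists i, val u \in (W i : set V).
  have [i _ Wi] := cov _ (set_mem (valP u)); exists i; exact: mem_set.
pose f (u : U) : K := s (ix u) (SigSub (ixP u)).
have fE i x (xi : x \in (W i : set V)) (xU : x \in (U : set V)) :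
  f (SigSub xU) = s i (SigSub xi) by exact: compat.
have fP : f \in holomorphic U.
  apply: holomorphic_local => x Ux; have [i _ Wx] := cov _ Ux.
  exists (valL_ 0 (s i)); split.
    by have /asboolP := holoP (s i); apply.
  near=> y => -[u Uu] /= uy; subst u.
  have Wy : y \in (W i : set V).
    by apply/mem_set; near: y; exact: open_nbhs_nbhs (conj (opensP _) Wx).
  rewrite (fE i _ Wy); exact: esym (valL_mem (s i) Wy).
exists (Holo fP) => i; apply: holo_eq => -[w Ww].
exact: fE.
Unshelve. all: by end_near. Qed.

Program Definition free_sheaf : sheaf X := {|
  sections := fun U : opens_in X => 'rV[holo U]_n;
  sres := fun (U W : opens_in X) (h : W `<=` U) => map_mx (holo_res h) |}.
Next Obligation. by move=> U W h a s t; apply/rowP => i; rewrite !mxE; exact: holo_eq. Qed.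
Next Obligation.
move=> U h s; apply/rowP => i; rewrite !mxE; apply: holo_eq => u.
by rewrite holo_resE; congr (s _ _ _); exact: val_inj.
Qed.
Next Obligation.
move=> U W Z hW hZ h s; apply/rowP => i; rewrite !mxE; apply: holo_eq => u.
by rewrite !holo_resE; congr (s _ _ _); exact: val_inj.
Qed.
Next Obligation.
move=> U I W h cov s t st; apply/rowP => i; apply: holo_eq => -[x Ux].
have [j _ Wx] := cov _ (set_mem Ux).
have := congr1 (fun r : 'rV[holo (W j)]_n => r 0 i (SigSub (mem_set Wx))) (st j).
by rewrite !mxE !holo_resE (@subset_inclE _ _ _ (h j) (SigSub (mem_set Wx)) Ux).
Qed.
Next Obligation.
move=> U I W h cov s hs.
have /choice[t tP] k : exists t : holo U, forall i, holo_res (h i) t = s i 0 k.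
  apply: holo_glue cov _ _ => i j Z hi hj.
  by have := congr1 (fun r : 'rV[holo Z]_n => r 0 k) (hs i j Z hi hj); rewrite !mxE.
exists (\row_k t k) => i; apply/rowP => k.
by rewrite !mxE tP.
Qed.

End Free.

Section Morphism.
Variable (X : opens V).

Record sheaf_hom (F G : sheaf X) := SheafHom {
  shom :> forall U : opens_in X, {linear F U -> G U};
  shom_res : forall (U W : opens_in X) (h : W `<=` U) (s : F U),
    shom W (sres h s) = sres h (shom U s) }.

Definition sheaf_inj F G (f : sheaf_hom F G) :=
  forall U : opens_in X, injective (f U).

(* Surjectivity and exactness are those of the category of sheaves, i.e. images
   are taken locally. *)
Definition sheaf_surj F G (f : sheaf_hom F G) :=
  forall (U : opens_in X) (s : G U) (x : V), U x ->
  exists (W : opens_in X) (h : W `<=` U) (t : F W),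
    W x /\ f W t = sres h s.

Definition sheaf_exact F G H (f : sheaf_hom F G) (g : sheaf_hom G H) :=
  forall (U : opens_in X) (s : G U),
  g U s = 0 <-> forall x, U x ->
    exists (W : opens_in X) (h : W `<=` U) (t : F W), W x /\ f W t = sres h s.

Definition sheaf_iso F G :=
  exists f : sheaf_hom F G, forall U : opens_in X, bijective (f U).

Section Kernel.
Variables (F G : sheaf X) (f : sheaf_hom F G).

Definition ker_pred (U : opens_in X) : {pred F U} := fun s => f U s == 0.

Lemma ker_submod U : submod_closed (@ker_pred U).
Proof.
split; first by rewrite unfold_in linear0.
by move=> a s t /eqP fs /eqP ft; rewrite unfold_in linearP fs ft scaler0 addr0.
Qed.

HB.instance Definition _ (U : opens_in X) :=
  GRing.isSubmodClosed.Build (holo U) (F U) (@ker_pred U) (@ker_submod U).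

Record ker_sections U := KerSection {
  ker_val :> F U; ker_valP : ker_val \in @ker_pred U }.

HB.instance Definition _ (U : opens_in X) := [isSub for @ker_val U].
HB.instance Definition _ (U : opens_in X) := [Choice of ker_sections U by <:].
HB.instance Definition _ (U : opens_in X) := GRing.SubChoice_isSubLmodule.Build
  (holo U) (F U) (@ker_pred U) (ker_sections U) (@ker_submod U).

Lemma ker_res_subproof (U W : opens_in X) (h : W `<=` U) (s : ker_sections U) :
  sres h (s : F U) \in @ker_pred W.
Proof. by have /eqP fs := ker_valP s; rewrite unfold_in shom_res fs sres0. Qed.

Program Definition sheaf_ker : sheaf X := {|
  sections := fun U : opens_in X => ker_sections U;
  sres := fun (U W : opens_in X) (h : W `<=` U) s =>
    KerSection (ker_res_subproof h s) |}.
Next Obligation. by move=> *; apply: val_inj; exact: sres_linear. Qed.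
Next Obligation. by move=> *; apply: val_inj; exact: sres_id. Qed.
Next Obligation. by move=> *; apply: val_inj; exact: sres_comp. Qed.
Next Obligation.
move=> U I W h cov s t st; apply/val_inj/(sheaf_separated cov) => i.
exact: (congr1 (fun r : ker_sections (W i) => ker_val r) (st i)).
Qed.
Next Obligation.
move=> U I W h cov s hs.
have [t tP] : exists t : F U, forall i, sres (h i) t = s i.
  apply: sheaf_glue cov _ _ => i j Z hi hj.
  exact: (congr1 (fun r : ker_sections Z => ker_val r) (hs i j Z hi hj)).
have ft : t \in @ker_pred U.
  apply/eqP/(sheaf_separated cov) => i.
  by rewrite -shom_res tP sres0; have /eqP := ker_valP (s i).
by exists (KerSection ft) => i; apply: val_inj; exact: tP.
Qed.

End Kernel.
End Morphism.

Section Coherent.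
Variable (X : opens V).

Definition finite_type (F : sheaf X) :=
  forall x, X x -> exists (U : opens_in X) (n : nat)
    (f : sheaf_hom (free_sheaf U n) (sheaf_restr F U)), U x /\ sheaf_surj f.

End Coherent.

Definition coherent X (F : sheaf X) :=
  finite_type F /\
  forall (U : opens_in X) (n : nat)
    (f : sheaf_hom (free_sheaf U n) (sheaf_restr F U)), finite_type (sheaf_ker f).

End Sheaf.

Section Fiber.
Variables (K : numFieldType) (V : normedModType K).
Local Notation VK := (V * K)%type.

Lemma opens_prod_subproof (Y : opens V) (D : opens K) : open (Y `*` D).
Proof.
have -> : Y `*` D = (fst @^-1` Y) `&` (snd @^-1` D) by [].
apply: openI; apply: open_comp; [|exact: opensP| |exact: opensP].
  by move=> x _; exact: cvg_fst.
by move=> x _; exact: cvg_snd.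
Qed.

Definition opens_prod (Y : opens V) (D : opens K) : opens VK :=
  Opens (@opens_prod_subproof Y D).

Definition fst_in (U : opens V) (W : opens VK) (h : W `<=` fst @^-1` U)
    (w : W) : U :=
  SigSub (mem_set (h _ (set_mem (valP w))) : (val w).1 \in (U : set V)).

Lemma holo_fst_subproof (U : opens V) (W : opens VK)
    (h : W `<=` fst @^-1` U) (a : holo U) :
  (a : U -> K) \o fst_in h \in holomorphic W.
Proof.
apply: (@holomorphic_ext _ _ _ _ (valL_ 0 a \o fst)) => [w|w Ww].
  exact: esym (valL_val a (fst_in h w)).
apply: differentiable_comp.
  by apply: linear_differentiable => ?; exact: cvg_fst.
by have /asboolP := holoP a; apply; exact: h.
Qed.

Definition holo_fst U W h a : holo W := Holo (@holo_fst_subproof U W h a).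

Lemma holo_snd_sub_subproof (W : opens VK) (t : K) :
  (fun w : W => (val w).2 - t) \in holomorphic W.
Proof.
apply: (@holomorphic_ext _ _ _ _ (snd - cst t)) => [w|w Ww] //.
apply: differentiableB; last exact: differentiable_cst.
by apply: linear_differentiable => ?; exact: cvg_snd.
Qed.

Definition holo_snd_sub W t : holo W := Holo (@holo_snd_sub_subproof W t).

Lemma holo_res_snd_sub (U W : opens VK) (h : W `<=` U) t :
  holo_res h (holo_snd_sub U t) = holo_snd_sub W t.
Proof. exact: holo_eq. Qed.

Lemma holo_res_fst (U : opens V) (W Z : opens VK) (h : W `<=` fst @^-1` U)
  (k : Z `<=` W) (l : Z `<=` fst @^-1` U) (a : holo U) :
  holo_res k (holo_fst h a) = holo_fst l a.
Proof.
apply: holo_eq => z; rewrite !holo_resE; congr (a _); exact: val_inj.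
Qed.

Variables (X : opens VK) (E : sheaf X).

(* For p = (y, t), fiber_stalk p is E_p / (tau - t) E_p, where tau is the last
   coordinate of V * K, i.e. the stalk E_p (x) O_{Y x {t}, y}, as
   O_{Y x {t}} = O_X / (tau - t). It is presented as the set of germs (an open
   neighbourhood W of p together with a section over W) modulo fiber_rel. *)
Record germ (p : X) := Germ {
  germ_dom : opens_in X;
  germ_domP : germ_dom (val p);
  germ_sec : E germ_dom }.

HB.instance Definition _ p := gen_eqMixin (germ p).
HB.instance Definition _ p := gen_choiceMixin (germ p).

Section Stalk.
Variable p : X.

Definition fiber_rel (g g' : germ p) : bool :=
  `[< exists (W : opens_in X) (h : W `<=` germ_dom g) (h' : W `<=` germ_dom g')
        (e : E W), W (val p) /\
      sres h (germ_sec g) = sres h' (germ_sec g') + holo_snd_sub W (val p).2 *: e >].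

Lemma sresD (U W : opens_in X) (h : W `<=` U) (s t : E U) :
  sres h (s + t) = sres h s + sres h t.
Proof.
by have := sres_linear h 1 s t; rewrite !scale1r (_ : holo_res h 1 = 1) ?scale1r //;
  exact: holo_eq.
Qed.

Lemma sresZ (U W : opens_in X) (h : W `<=` U) a (s : E U) :
  sres h (a *: s) = holo_res h a *: sres h s.
Proof. by have := sres_linear h a s 0; rewrite sres0 !addr0. Qed.

Lemma sresN (U W : opens_in X) (h : W `<=` U) (s : E U) :
  sres h (- s) = - sres h s.
Proof. by apply/eqP; rewrite -addr_eq0 -sresD addNr sres0. Qed.

Lemma sres_irr (U W : opens_in X) (h k : W `<=` U) (s : E U) :
  sres h s = sres k s.
Proof. by congr sres. Qed.

Let I (U : opens_in X) (W : opens VK) : opens_in X := opens_inI U W.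
Let Il U W : I U W `<=` U. Proof. by move=> x []. Qed.
Let Ir U W : I U W `<=` W. Proof. by move=> x []. Qed.

Let subset_comp (U W Z : set VK) (h : Z `<=` W) (k : W `<=` U) : Z `<=` U.
Proof. by move=> x /h /k. Qed.

Lemma fiber_rel_refl : reflexive fiber_rel.
Proof.
move=> g; apply/asboolP; exists (germ_dom g), (@subset_refl _ _), (@subset_refl _ _), 0.
by rewrite scaler0 addr0; split=> //; exact: germ_domP.
Qed.

Lemma fiber_rel_sym : symmetric fiber_rel.
Proof.
have H g g' : fiber_rel g g' -> fiber_rel g' g.
  move=> /asboolP[W [h [h' [e [Wp E1]]]]]; apply/asboolP.
  by exists W, h', h, (- e); split => //; rewrite E1 scalerN addrK.
by move=> g g'; apply/idP/idP; exact: H.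
Qed.

Lemma fiber_rel_trans : transitive fiber_rel.
Proof.
move=> g2 g1 g3 /asboolP[W [h [h' [e [Wp E1]]]]] /asboolP[Z [k [k' [f [Zp E2]]]]].
apply/asboolP; exists (I W Z).
have hW : I W Z `<=` germ_dom g1 by move=> x /(@Il W Z) /h.
have hZ : I W Z `<=` germ_dom g3 by move=> x /(@Ir W Z) /k'.
have hg : I W Z `<=` germ_dom g2 by move=> x /(@Il W Z) /h'.
exists hW, hZ, (sres (@Ir W Z) f + sres (@Il W Z) e); split; first by split.
have := congr1 (sres (@Il W Z)) E1; have := congr1 (sres (@Ir W Z)) E2.
rewrite !sresD !sresZ !holo_res_snd_sub !(sres_comp _ _ hW) !(sres_comp _ _ hZ).
rewrite !(sres_comp _ _ hg) => -> ->.
by rewrite scalerDr addrA.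
Qed.

Definition fiber_equiv :=
  EquivRel fiber_rel fiber_rel_refl fiber_rel_sym fiber_rel_trans.

Definition fiber_stalk := {eq_quot fiber_equiv}%qT.

HB.instance Definition _ := Choice.on fiber_stalk.
HB.instance Definition _ := EqQuotient.on fiber_stalk.

Definition fiber_class (W : opens_in X) (Wp : W (val p)) (e : E W) : fiber_stalk :=
  \pi_(fiber_stalk)%qT (Germ Wp e).

Lemma fiber_classE (W W' : opens_in X) (Wp : W (val p)) (W'p : W' (val p)) (e : E W) (e' : E W') :
  fiber_class Wp e = fiber_class W'p e' <->
  exists (Z : opens_in X) (h : Z `<=` W) (h' : Z `<=` W') (f : E Z), Z (val p) /\
    sres h e = sres h' e' + holo_snd_sub Z (val p).2 *: f.
Proof.
split => [/eqmodP /asboolP //|H].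
by apply/eqmodP/asboolP.
Qed.

Lemma fiber_class_res (U W : opens_in X) (h : W `<=` U) (Up : U (val p))
  (Wp : W (val p)) (e : E U) : fiber_class Up e = fiber_class Wp (sres h e).
Proof.
apply/fiber_classE; have hW : W `<=` W by [].
by exists W, h, hW, 0; rewrite sres_comp scaler0 addr0.
Qed.

Lemma fiber_stalkP (x : fiber_stalk) :
  exists (W : opens_in X) (Wp : W (val p)) (e : E W), x = fiber_class Wp e.
Proof.
exists (germ_dom (repr x)), (germ_domP (repr x)), (germ_sec (repr x)).
by rewrite /fiber_class -[LHS]reprK; congr (\pi_fiber_stalk _); case: (repr x).
Qed.

Lemma fiber_stalkP2 (x y : fiber_stalk) :
  exists (W : opens_in X) (Wp : W (val p)) (e f : E W),
    x = fiber_class Wp e /\ y = fiber_class Wp f.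
Proof.
have [U [Up [e ->]]] := fiber_stalkP x; have [W [Wp [f ->]]] := fiber_stalkP y.
have UWp : I U W (val p) by [].
exists (I U W), UWp, (sres (@Il U W) e), (sres (@Ir U W) f).
by rewrite -!fiber_class_res.
Qed.

Lemma fiber_stalkP3 (x y z : fiber_stalk) :
  exists (W : opens_in X) (Wp : W (val p)) (e f g : E W),
    [/\ x = fiber_class Wp e, y = fiber_class Wp f & z = fiber_class Wp g].
Proof.
have [U [Up [e [f [-> ->]]]]] := fiber_stalkP2 x y.
have [W [Wp [g ->]]] := fiber_stalkP z.
have UWp : I U W (val p) by [].
exists (I U W), UWp, (sres (@Il U W) e), (sres (@Il U W) f), (sres (@Ir U W) g).
by rewrite -!fiber_class_res.
Qed.

Lemma repr_fiber_class (W : opens_in X) (Wp : W (val p)) (e : E W) :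
  exists (Z : opens_in X) (h : Z `<=` germ_dom (repr (fiber_class Wp e)))
    (h' : Z `<=` W) (f : E Z), Z (val p) /\
    sres h (germ_sec (repr (fiber_class Wp e))) =
    sres h' e + holo_snd_sub Z (val p).2 *: f.
Proof.
apply/(fiber_classE (germ_domP _)); rewrite -[RHS]reprK /fiber_class.
by congr (\pi_fiber_stalk _); case: (repr _).
Qed.

Definition fiber_zero : fiber_stalk :=
  @fiber_class (opens_inT X) (set_mem (valP p)) 0.

Lemma fiber_zeroE (W : opens_in X) (Wp : W (val p)) :
  fiber_zero = fiber_class Wp (0 : E W).
Proof.
rewrite /fiber_zero (fiber_class_res (@opens_inP _ _ W : W `<=` opens_inT X) _ Wp).
by rewrite sres0.
Qed.

Definition fiber_opp (x : fiber_stalk) : fiber_stalk :=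
  fiber_class (germ_domP (repr x)) (- germ_sec (repr x)).

Lemma fiber_oppE (W : opens_in X) (Wp : W (val p)) (e : E W) :
  fiber_opp (fiber_class Wp e) = fiber_class Wp (- e).
Proof.
have [Z [h [h' [f [Zp E1]]]]] := repr_fiber_class Wp e.
apply/fiber_classE; exists Z, h, h', (- f); split => //.
by rewrite !sresN E1 opprD scalerN.
Qed.

Definition fiber_add (x y : fiber_stalk) : fiber_stalk :=
  fiber_class (conj (germ_domP (repr x)) (germ_domP (repr y)) :
      I (germ_dom (repr x)) (germ_dom (repr y)) (val p))
    (sres (@Il _ _) (germ_sec (repr x)) + sres (@Ir _ _) (germ_sec (repr y))).

Lemma fiber_addE (W : opens_in X) (Wp : W (val p)) (e f : E W) :
  fiber_add (fiber_class Wp e) (fiber_class Wp f) = fiber_class Wp (e + f).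
Proof.
have [Z [h [h' [u [Zp E1]]]]] := repr_fiber_class Wp e.
have [T [k [k' [v [Tp E2]]]]] := repr_fiber_class Wp f.
apply/fiber_classE.
have hI : I Z T `<=` I (germ_dom (repr (fiber_class Wp e)))
    (germ_dom (repr (fiber_class Wp f))) by move=> x [/h ? /k ?].
have hW : I Z T `<=` W by move=> x [/h'].
exists (I Z T), hI, hW, (sres (@Il Z T) u + sres (@Ir Z T) v); split => //.
have := congr1 (sres (@Il Z T)) E1; have := congr1 (sres (@Ir Z T)) E2.
rewrite !sresD !sresZ !holo_res_snd_sub.
rewrite !(sres_comp _ _ hW).
rewrite !(sres_comp _ _ (subset_comp hI (@Il _ _))).
rewrite !(sres_comp _ _ (subset_comp hI (@Ir _ _))) => -> ->.
by rewrite scalerDr addrACA.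
Qed.

Fact fiber_addA : associative fiber_add.
Proof.
move=> x y z; have [W [Wp [e [f [g [-> -> ->]]]]]] := fiber_stalkP3 x y z.
by rewrite !fiber_addE addrA.
Qed.

Fact fiber_addC : commutative fiber_add.
Proof.
move=> x y; have [W [Wp [e [f [-> ->]]]]] := fiber_stalkP2 x y.
by rewrite !fiber_addE addrC.
Qed.

Fact fiber_add0 : left_id fiber_zero fiber_add.
Proof.
move=> x; have [W [Wp [e ->]]] := fiber_stalkP x.
by rewrite (fiber_zeroE Wp) fiber_addE add0r.
Qed.

Fact fiber_addN : left_inverse fiber_zero fiber_opp fiber_add.
Proof.
move=> x; have [W [Wp [e ->]]] := fiber_stalkP x.
by rewrite (fiber_zeroE Wp) fiber_oppE fiber_addE addNr.
Qed.

HB.instance Definition _ := GRing.isZmodule.Build fiber_stalk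
  fiber_addA fiber_addC fiber_add0 fiber_addN.

Lemma fiber_classD (W : opens_in X) (Wp : W (val p)) (e f : E W) :
  fiber_class Wp (e + f) = fiber_class Wp e + fiber_class Wp f.
Proof. exact: esym (fiber_addE Wp e f). Qed.

Definition opens_fst (U : opens V) : opens VK := opens_prod U (Opens openT).

Lemma opens_fst_sub (U : opens V) (W : opens_in X) :
  opens_inI W (opens_fst U) `<=` fst @^-1` U.
Proof. by move=> x [_ []]. Qed.

Section Scale.
Variables (U : opens V) (Up : U (val p).1).

(* O_Y acts through the isomorphism O_Y = O_X / (tau - t), lifting a function of
   y to a function of (y, tau) which does not depend on tau. *)
Definition fiber_scale (a : holo U) (x : fiber_stalk) : fiber_stalk :=
  fiber_class
    (conj (germ_domP (repr x)) (conj Up Logic.I) :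
      opens_inI (germ_dom (repr x)) (opens_fst U) (val p))
    (holo_fst (@opens_fst_sub U _) a *:
      (sres (@Il _ _) (germ_sec (repr x)) :
        E (opens_inI (germ_dom (repr x)) (opens_fst U)))).

Lemma fiber_scaleE (a : holo U) (W : opens_in X) (h : W `<=` fst @^-1` U)
    (Wp : W (val p)) (e : E W) :
  fiber_scale a (fiber_class Wp e) = fiber_class Wp (holo_fst h a *: e).
Proof.
have [Z [k [k' [f [Zp E1]]]]] := repr_fiber_class Wp e.
apply/fiber_classE.
have hI : Z `<=` opens_inI (germ_dom (repr (fiber_class Wp e))) (opens_fst U).
  by move=> x Zx; split; [exact: (k x Zx)|split=> //; exact: (h _ (k' x Zx))].
have hU : Z `<=` fst @^-1` U by move=> x /k' /h.
exists Z, hI, k', (holo_fst hU a *: f); split => //.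
rewrite !sresZ !(holo_res_fst _ _ hU).
rewrite (sres_comp _ _ k) E1 scalerDr !scalerA.
by congr (_ + _ *: _); rewrite mulrC.
Qed.

Lemma fiber_stalk_scaleP2 (x y : fiber_stalk) :
  exists (W : opens_in X) (Wp : W (val p)) (e f : E W),
    [/\ W `<=` fst @^-1` U, x = fiber_class Wp e & y = fiber_class Wp f].
Proof.
have [W [Wp [e [f [-> ->]]]]] := fiber_stalkP2 x y.
have WUp : opens_inI W (opens_fst U) (val p) by [].
exists (opens_inI W (opens_fst U)), WUp, (sres (@Il _ _) e), (sres (@Il _ _) f).
by split; [exact: opens_fst_sub|exact: fiber_class_res|exact: fiber_class_res].
Qed.

Lemma fiber_scaleA a b x :
  fiber_scale a (fiber_scale b x) = fiber_scale (a * b) x.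
Proof.
have [W [Wp [e [f [h -> _]]]]] := fiber_stalk_scaleP2 x x.
rewrite !(fiber_scaleE _ h) scalerA; congr (fiber_class _ (_ *: _)).
exact: holo_eq.
Qed.

Lemma fiber_scale1 x : fiber_scale 1 x = x.
Proof.
have [W [Wp [e [f [h -> _]]]]] := fiber_stalk_scaleP2 x x.
rewrite (fiber_scaleE _ h) (_ : holo_fst h 1 = 1) ?scale1r //; exact: holo_eq.
Qed.

Lemma fiber_scaleDr a x y :
  fiber_scale a (x + y) = fiber_scale a x + fiber_scale a y.
Proof.
have [W [Wp [e [f [h -> ->]]]]] := fiber_stalk_scaleP2 x y.
by rewrite -fiber_classD !(fiber_scaleE _ h) scalerDr fiber_classD.
Qed.

Lemma fiber_scaleDl a b x :
  fiber_scale (a + b) x = fiber_scale a x + fiber_scale b x.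
Proof.
have [W [Wp [e [f [h -> _]]]]] := fiber_stalk_scaleP2 x x.
rewrite !(fiber_scaleE _ h) -fiber_classD -scalerDl.
by congr (fiber_class _ (_ *: _)); exact: holo_eq.
Qed.

End Scale.
End Stalk.
End Fiber.

Lemma fiber_scale_res (K : numFieldType) (V : normedModType K)
    (X : opens (V * K)%type) (E : sheaf X) (p : X) (U W : opens V)
    (h : W `<=` U) (Up : U (val p).1) (Wp : W (val p).1) (a : holo U)
    (x : fiber_stalk E p) :
  fiber_scale Up a x = fiber_scale Wp (holo_res h a) x.
Proof.
have [Z [Zp [e [_ [k -> _]]]]] := fiber_stalk_scaleP2 Wp x x.
have k' : Z `<=` fst @^-1` U by move=> z /k /h.
rewrite (fiber_scaleE _ _ k') (fiber_scaleE _ _ k); congr (fiber_class _ (_ *: _)).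
by apply: holo_eq => z /=; congr (a _); exact: val_inj.
Qed.

Section FiberSheaf.
Variables (K : numFieldType) (V : normedModType K).
Variables (Y : opens V) (D : opens K) (E : sheaf (opens_prod Y D)) (t : D).

Definition slice_point (y : Y) : opens_prod Y D :=
  SigSub (mem_set (conj (set_mem (valP y)) (set_mem (valP t))) :
    (val y, val t) \in (opens_prod Y D : set (V * K))).

(* The restriction E_t = E (x) O_{Y x {t}}, as a sheaf on Y: the sheaf
   associated with the quotient E / (tau - t) E along Y x {t}. A section over U
   is a family of elements of the stalks E_(y,t) / (tau - t) E_(y,t), y in U,
   which near each point of U comes from a section of E. *)
Record fiber_sections (U : opens_in Y) := FiberSections {
  fiber_fun : forall y : Y, U (val y) -> fiber_stalk E (slice_point y);
  fiber_funP : forall y : Y, U (val y) ->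
    exists (W : opens_in (opens_prod Y D)) (e : E W), W (val y, val t) /\
    forall (z : Y) (Uz : U (val z)) (Wz : W (val (slice_point z))),
      fiber_fun Uz = fiber_class Wz e }.

HB.instance Definition _ U := gen_eqMixin (fiber_sections U).
HB.instance Definition _ U := gen_choiceMixin (fiber_sections U).

Section Module.
Variable U : opens_in Y.
Implicit Types r s : fiber_sections U.

Lemma fiber_sections_eq r s :
  (forall (y : Y) (Uy : U (val y)), fiber_fun r Uy = fiber_fun s Uy) -> r = s.
Proof.
case: r => r rP; case: s => s sP /= rs.
have e : r = s by apply: functional_extensionality_dep => y; apply: functional_extensionality_dep => Uy; exact: rs.
by case: s / e sP {rs} => sP; congr FiberSections; exact: Prop_irrelevance.
Qed.

Lemma fiber_fun_local2 r s (y : Y) : U (val y) ->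
  exists (W : opens_in (opens_prod Y D)) (e f : E W), W (val y, val t) /\
    forall (z : Y) (Uz : U (val z)) (Wz : W (val (slice_point z))),
      fiber_fun r Uz = fiber_class Wz e /\ fiber_fun s Uz = fiber_class Wz f.
Proof.
move=> Uy; have [W [e [Wy re]]] := fiber_funP r Uy.
have [Z [f [Zy sf]]] := fiber_funP s Uy.
have IW : opens_inI W Z `<=` W by move=> x [].
have IZ : opens_inI W Z `<=` Z by move=> x [].
exists (opens_inI W Z), (sres IW e), (sres IZ f); split => // z Uz Iz.
by rewrite (re z Uz (IW _ Iz)) (sf z Uz (IZ _ Iz)); split; exact: fiber_class_res.
Qed.

Program Definition fiber_sections0 : fiber_sections U :=
  {| fiber_fun := fun y _ => 0 |}.
Next Obligation.
move=> y Uy; exists (opens_inT _), 0; split; first exact: (set_mem (valP (slice_point y))).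
by move=> z Uz Wz; rewrite -fiber_zeroE.
Qed.

Program Definition fiber_sections_opp s : fiber_sections U :=
  {| fiber_fun := fun y Uy => - fiber_fun s Uy |}.
Next Obligation.
move=> s y Uy; have [W [e [Wy se]]] := fiber_funP s Uy.
by exists W, (- e); split => // z Uz Wz; rewrite (se z Uz Wz); exact: fiber_oppE.
Qed.

Program Definition fiber_sections_add r s : fiber_sections U :=
  {| fiber_fun := fun y Uy => fiber_fun r Uy + fiber_fun s Uy |}.
Next Obligation.
move=> r s y Uy; have [W [e [f [Wy rse]]]] := fiber_fun_local2 r s Uy.
exists W, (e + f); split => // z Uz Wz.
by have [-> ->] := rse z Uz Wz; rewrite fiber_classD.
Qed.

Program Definition fiber_sections_scale (a : holo U) s : fiber_sections U :=
  {| fiber_fun := fun y Uy =>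
       fiber_scale (p := slice_point y) (U := U) Uy a (fiber_fun s Uy) |}.
Next Obligation.
move=> a s y Uy; have [W [e [Wy se]]] := fiber_funP s Uy.
have IW : opens_inI W (opens_fst U) `<=` W by move=> x [].
have h : opens_inI W (opens_fst U) `<=` fst @^-1` U by exact: opens_fst_sub.
exists (opens_inI W (opens_fst U)), (holo_fst h a *: sres IW e).
split => // z Uz Iz.
by rewrite (se z Uz (IW _ Iz)) (fiber_class_res IW _ Iz) (fiber_scaleE _ _ h).
Qed.

Fact fiber_sections_addA : associative fiber_sections_add.
Proof. by move=> *; apply: fiber_sections_eq => * /=; rewrite addrA. Qed.
Fact fiber_sections_addC : commutative fiber_sections_add.
Proof. by move=> *; apply: fiber_sections_eq => * /=; rewrite addrC. Qed.
Fact fiber_sections_add0 : left_id fiber_sections0 fiber_sections_add.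
Proof. by move=> *; apply: fiber_sections_eq => * /=; rewrite add0r. Qed.
Fact fiber_sections_addN :
  left_inverse fiber_sections0 fiber_sections_opp fiber_sections_add.
Proof. by move=> *; apply: fiber_sections_eq => * /=; rewrite addNr. Qed.

HB.instance Definition _ := GRing.isZmodule.Build (fiber_sections U)
  fiber_sections_addA fiber_sections_addC fiber_sections_add0
  fiber_sections_addN.

Fact fiber_sections_scaleA a b s : fiber_sections_scale a
  (fiber_sections_scale b s) = fiber_sections_scale (a * b) s.
Proof. by apply: fiber_sections_eq => * /=; rewrite fiber_scaleA. Qed.
Fact fiber_sections_scale1 : left_id 1 fiber_sections_scale.
Proof. by move=> *; apply: fiber_sections_eq => * /=; rewrite fiber_scale1. Qed.
Fact fiber_sections_scaleDr : right_distributive fiber_sections_scale +%R.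
Proof. by move=> *; apply: fiber_sections_eq => * /=; rewrite fiber_scaleDr. Qed.
Fact fiber_sections_scaleDl s :
  {morph (fiber_sections_scale)^~ s : a b / a + b}.
Proof. by move=> *; apply: fiber_sections_eq => * /=; rewrite fiber_scaleDl. Qed.

HB.instance Definition _ := GRing.Zmodule_isLmodule.Build (holo U)
  (fiber_sections U) fiber_sections_scaleA fiber_sections_scale1
  fiber_sections_scaleDr fiber_sections_scaleDl.

End Module.

Program Definition fiber_sections_res (U W : opens_in Y) (h : W `<=` U)
    (s : fiber_sections U) : fiber_sections W :=
  {| fiber_fun := fun y Wy => fiber_fun s (h _ Wy) |}.
Next Obligation.
move=> U W h s y Wy; have [Z [e [Zy se]]] := fiber_funP s (h _ Wy).
by exists Z, e; split => // z Uz Wz; exact: se.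
Qed.

Program Definition fiber : sheaf Y := {|
  sections := fun U : opens_in Y => fiber_sections U;
  sres := fiber_sections_res |}.
Next Obligation.
move=> U W h a r s; apply: fiber_sections_eq => y Wy /=.
by rewrite (fiber_scale_res h _ (Wy : W (val (slice_point y)).1)).
Qed.
Next Obligation.
move=> U h s; apply: fiber_sections_eq => y Uy /=.
by congr (fiber_fun _ _); exact: Prop_irrelevance.
Qed.
Next Obligation.
move=> U W Z hW hZ h s; apply: fiber_sections_eq => y Zy /=.
by congr (fiber_fun _ _); exact: Prop_irrelevance.
Qed.
Next Obligation.
move=> U I W h cov r s rs; apply: fiber_sections_eq => y Uy.
have [i _ Wy] := cov _ Uy.
have := congr1 (fun q : fiber_sections (W i) => fiber_fun q Wy) (rs i) => /=.
by rewrite (Prop_irrelevance (h i _ Wy) Uy).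
Qed.
Next Obligation.
move=> U I W h cov s hs.
have compat i j (y : Y) (Wi : W i (val y)) (Wj : W j (val y)) :
    fiber_fun (s i) Wi = fiber_fun (s j) Wj.
  pose Z := opens_inI (W i) (W j).
  have Zi : Z `<=` W i by move=> z [].
  have Zj : Z `<=` W j by move=> z [].
  have Zy : Z (val y) by [].
  have := congr1 (fun q : fiber_sections Z => fiber_fun q Zy) (hs i j Z Zi Zj).
  by rewrite /= (Prop_irrelevance (Zi _ Zy) Wi) (Prop_irrelevance (Zj _ Zy) Wj).
have ix (y : Y) (Uy : U (val y)) : {i : I | W i (val y)}.
  by apply: cid; have [i _] := cov _ Uy; exists i.
pose f y Uy := fiber_fun (s (projT1 (ix y Uy))) (projT2 (ix y Uy)).
have fP (y : Y) : U (val y) ->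
    exists (Z : opens_in (opens_prod Y D)) (e : E Z), Z (val y, val t) /\
    forall (z : Y) (Uz : U (val z)) (Wz : Z (val (slice_point z))),
      f z Uz = fiber_class Wz e.
  move=> Uy; have [i Wy] := ix y Uy.
  have [Z [e [Zy se]]] := fiber_funP (s i) Wy.
  have IZ : opens_inI Z (opens_fst (W i)) `<=` Z by move=> z [].
  exists (opens_inI Z (opens_fst (W i))), (sres IZ e).
  split => // z Uz Iz; have Wz : W i (val z) by case: Iz => _ [].
  by rewrite -(fiber_class_res IZ (IZ _ Iz)) -(se z Wz); exact: compat.
exists (FiberSections fP) => i; apply: fiber_sections_eq => y Wy /=.
exact: compat.
Qed.

End FiberSheaf.

Section Properties.
Variables (K : numFieldType) (V : normedModType K) (X : opens V).
Implicit Type F : sheaf X.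

Definition locally_free_at n F (x : V) :=
  exists U : opens_in X, U x /\ sheaf_iso (free_sheaf U n) (sheaf_restr F U).

(* Torsion-freeness of the stalks F_x over O_x: if the germ of f at x is nonzero
   and f s = 0 then the germ of s at x is zero. *)
Definition torsion_free F :=
  forall (U : opens_in X) (f : holo U) (s : F U) (x : V), U x ->
  ~ (\forall y \near x, valL_ 0 f y = 0) -> f *: s = 0 ->
  exists (W : opens_in X) (h : W `<=` U), W x /\ sres h s = 0.

End Properties.

Section Family.
Variable R : realType.

(* The field of complex numbers, typed so as to inherit the norm and topology
   of a numFieldType. *)
Definition Cfield : numFieldType := R[i].

(* The norm of the library on 'rV_3 is the sup norm, so the Euclidean ball is
   written explicitly. *)
Lemma ball3_subproof :
  open [set x : 'rV[Cfield]_3 | \sum_i `|x 0 i| ^+ 2 < 1].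
Proof.
rewrite openE => x /= x1; rewrite /interior.
pose f (y : 'rV[Cfield]_3) := \sum_i `|y 0 i| ^+ 2.
have fr y : f y \is Num.real by apply: ger0_real; apply: sumr_ge0 => i _; exact: exprn_ge0.
have cg i : continuous (fun y : 'rV[Cfield]_3 => `|y 0 i| ^+ 2).
  have cn : continuous (fun y : 'rV[Cfield]_3 => `|y 0 i|).
    by move=> y; apply: (@cvg_norm _ _ _ (nbhs y) _ (fun z : 'rV[Cfield]_3 => z 0 i)); exact: (@coord_continuous Cfield 1 3 0 i y).
  by move=> y; exact: (cvgM (cn y) (cn y)).
have cf : continuous f.
  have -> : f = \sum_i (fun y : 'rV[Cfield]_3 => `|y 0 i| ^+ 2).
    by apply/funext => y; rewrite fct_sumE.
  elim/big_ind: _ => [|g h cg1 ch1|i _]; [exact: cst_continuous| |exact: cg].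
  by move=> y; exact: (cvgD (cg1 y) (ch1 y)).
have e0 : 0 < 1 - f x by rewrite subr_gt0.
have /cvgrPdist_lt/(_ _ e0) := cf x; apply: filterS => y /=.
rewrite distrC => fxy.
have : f y - f x < 1 - f x by apply: le_lt_trans fxy; apply: real_ler_norm; exact: realB.
by rewrite ltrD2r.
Qed.

Definition ball3 : opens 'rV[Cfield]_3 := Opens ball3_subproof.

Lemma disk_subproof : open [set t : Cfield | `|t| < 1].
Proof.
rewrite (_ : [set t | _] = ball (0 : Cfield) 1); first exact: ball_open.
by apply/seteqP; split => z; rewrite /ball /= sub0r normrN.
Qed.

Definition disk : opens Cfield := Opens disk_subproof.

Lemma disk0_subproof : (0 : Cfield) \in (disk : set Cfield).
Proof. by apply/mem_set; rewrite /= normr0 ltr01. Qed.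

Definition disk0 : disk := SigSub disk0_subproof.

(* The rank of the torsion-free sheaf fiber E disk0 is its rank on the dense
   open set where it is locally free; it is 2 by the fourth condition. *)
Definition family_degenerating (E : sheaf (opens_prod ball3 disk)) :=
  [/\ coherent E,
      forall t : disk, t != disk0 ->
        forall x, ball3 x -> locally_free_at 2 (fiber E t) x,
      torsion_free (fiber E disk0),
      forall x, ball3 x -> x != 0 -> locally_free_at 2 (fiber E disk0) x
    & ~ exists n, locally_free_at n (fiber E disk0) 0].

(* An exact sequence 0 -> O^r -> O^(r+2) -> E -> 0 on some neighbourhood of x. *)
Definition presented_near r (E : sheaf (opens_prod ball3 disk))
    (x : 'rV[Cfield]_3 * Cfield) :=
  exists (U : opens_in (opens_prod ball3 disk))
    (f : sheaf_hom (free_sheaf U r) (free_sheaf U (r + 2)%N))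
    (g : sheaf_hom (free_sheaf U (r + 2)%N) (sheaf_restr E U)),
    U x /\ [/\ sheaf_inj f, sheaf_exact f g & sheaf_surj g].

End Family.

(* Main.v *)
From HB Require Import structures.
Require Import Defs.
From mathcomp Require Import all_boot all_order all_algebra.
From mathcomp Require Import boolp classical_sets functions.
From mathcomp Require Import reals interval_inference prodnormedzmodule topology normedtype landau derive sequences.
From mathcomp Require Import complex.
From mathcomp Require Import ring lra.
Set Implicit Arguments.
Unset Strict Implicit.
Unset Printing Implicit Defensive.
Import Order.TTheory GRing.Theory Num.Theory.
Import numFieldNormedType.Exports.
Local Open Scope classical_set_scope.
Local Open Scope ring_scope.

(** Near the singular point a presentation amounts to a matrix [M] of holomorphic
    functions on a neighbourhood of the origin of the product of [C ^ 3] and [C], with [r]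
    rows and [r + 2] columns; [E] is the cokernel of [v |-> v *m M].

    The fiber of the sheaf [E_t] at a point [x] is then the quotient of [C ^ (r + 2)] by the
    row space of [M (x, t)]. If [E_t] is locally free of rank two at [x], this quotient has
    dimension at most two, so [M (x, t)] has rank [r] ([rank_of_locally_free]); by hypothesis
    this is the case everywhere near the origin, except possibly at the origin itself.
    Conversely, if [M (0, 0)] had rank [r], two constant rows completing it to an invertible
    matrix would give a frame of the central fiber near the origin
    ([locally_free_of_row_free]), which is not locally free there. So the rank of [M] drops
    exactly at the origin.

    This is impossible, because the matrices of size [r * (r + 2)] and rank less than [r]
    form a set of codimension three, whose preimage in a space of dimension four has no
    isolated point. The proof of this ([row_free_at_isolated_point]) replaces dimension
    theory by a variational argument. If [v *m M (0, 0) = 0] with [v] nonzero, then for small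
    nonzero [t] the quotient of [|v *m M (x, t)| ^ 2] by [|v| ^ 2 * (1 + |x| ^ 2)] has a positive
    minimum over a ball of points [x] and all nonzero [v], attained in the interior of the
    ball. At the minimum, the condition that [v *m M] is stationary is a system of [r + 2]
    linear equations for the [r + 3] coordinates of an infinitesimal motion of [v] and [x]. A
    nonzero solution gives a complex line on which, apart from real parts of holomorphic
    functions, the numerator varies by less than any multiple of the square of the
    parameter, while the denominator grows quadratically: the real part of a holomorphic
    function would then have a strict quadratic minimum, against the minimum principle
    ([no_quadratic_growth]).

    The function theory starts from complex differentiability at every point. Means of a
    function over segments replace path integrals; Goursat's lemma for them yields the
    minimum principle, from which the maximum principle, the Schwarz lemma and the Cauchy
    estimates follow. The last ingredient is that [(b (y, t) - b (y, 0)) / t] is holomorphic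
    for a holomorphic [b] ([divided_differentiable]): it shows that the frame generates the
    central fiber, whose sections are classes modulo the coordinate [t]. *)

(** * The norm of a complex space as a real number *)

Section RealNorm.
Variable R : realType.
Local Notation C := (Cfield R).

Definition re (z : C) : R := complex.Re (z : R[i]).
Definition im (z : C) : R := complex.Im (z : R[i]).
Definition ofR (x : R) : C := (Complex x 0 : R[i]).

Lemma reD (z w : C) : re (z + w) = re z + re w.
Proof. by case: z => ? ?; case: w. Qed.
Lemma reN (z : C) : re (- z) = - re z.
Proof. by case: z. Qed.
Lemma reB (z w : C) : re (z - w) = re z - re w.
Proof. by rewrite reD reN. Qed.
Lemma reM (z w : C) : re (z * w) = re z * re w - im z * im w.
Proof. by case: z => ? ?; case: w. Qed.
Lemma imD (z w : C) : im (z + w) = im z + im w.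
Proof. by case: z => ? ?; case: w. Qed.
Lemma imN (z : C) : im (- z) = - im z.
Proof. by case: z. Qed.
Lemma imM (z w : C) : im (z * w) = re z * im w + im z * re w.
Proof. by case: z => ? ?; case: w. Qed.

Lemma ofRM x y : ofR (x * y) = ofR x * ofR y.
Proof. exact: (rmorphM (real_complex R)). Qed.
Lemma ofRD x y : ofR (x + y) = ofR x + ofR y.
Proof. exact: (rmorphD (real_complex R)). Qed.
Lemma ofR_inj : injective ofR.
Proof. by move=> x y []. Qed.
Lemma le_ofR x y : (ofR x <= ofR y) = (x <= y).
Proof. exact: lecR. Qed.
Lemma lt_ofR x y : (ofR x < ofR y) = (x < y).
Proof. exact: ltcR. Qed.
Lemma ofR_re (e : C) : 0 < e -> ofR (re e) = e.
Proof. by move=> e0; apply: (RRe_real (R := R)); exact: gtr0_real. Qed.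
Lemma ofR_nat n : ofR n%:R = n%:R.
Proof. exact: (rmorph_nat (real_complex R)). Qed.
Lemma reZ x z : re (ofR x * z) = x * re z.
Proof. by rewrite reM /ofR /re /im /= mul0r subr0. Qed.

(** The norm of a normed module over [C] takes its values in the partially ordered
    field [C]; its real part takes them in the totally ordered field [R]. *)
Definition nm (V : normedModType C) (u : V) : R := re `|u|.

Section Norm.
Variable V : normedModType C.
Implicit Types u v : V.

Lemma ofR_nm u : ofR (nm u) = `|u|.
Proof. exact: (RRe_real (R := R) (normr_real u)). Qed.
Lemma nm_ge0 u : 0 <= nm u.
Proof. by rewrite -le_ofR ofR_nm; exact: normr_ge0. Qed.
Lemma nm0 : nm (0 : V) = 0.
Proof. by rewrite /nm normr0. Qed.
Lemma nmD u v : nm (u + v) <= nm u + nm v.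
Proof. by rewrite -le_ofR ofRD !ofR_nm; exact: ler_normD. Qed.
Lemma nmN u : nm (- u) = nm u.
Proof. by rewrite /nm normrN. Qed.
Lemma nmB u v : nm (u - v) <= nm u + nm v.
Proof. by rewrite -(nmN v) nmD. Qed.
Lemma nm_sym u v : nm (u - v) = nm (v - u).
Proof. by rewrite -nmN opprB. Qed.
Lemma nm_tri w u v : nm (u - v) <= nm (u - w) + nm (w - v).
Proof. by apply: le_trans (nmD _ _); rewrite addrA subrK. Qed.
Lemma nm_eq0 u : nm u = 0 -> u = 0.
Proof. by move=> u0; apply/eqP; rewrite -normr_eq0 -ofR_nm u0. Qed.
Lemma nm_gt0 u : u != 0 -> 0 < nm u.
Proof.
by rewrite lt0r nm_ge0 andbT; apply: contra => /eqP /nm_eq0 ->.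
Qed.
End Norm.

Lemma nmM (a b : C) : nm (a * b) = nm a * nm b.
Proof. by apply: ofR_inj; rewrite ofRM !ofR_nm normrM. Qed.
Lemma nmZ (V : normedModType C) (a : C) (u : V) : nm (a *: u) = nm a * nm u.
Proof. by apply: ofR_inj; rewrite ofRM !ofR_nm normrZ. Qed.

Lemma nmX (a : C) n : nm (a ^+ n) = nm a ^+ n.
Proof.
elim: n => [|n IH]; first by rewrite !expr0 /nm normr1.
by rewrite !exprS nmM IH.
Qed.
Lemma nm1 : nm (1 : C) = 1.
Proof. by rewrite /nm normr1. Qed.
Lemma nmV (a : C) : nm a^-1 = (nm a)^-1.
Proof.
have [->|a0] := eqVneq a 0; first by rewrite invr0 nm0 invr0.
have na : nm a != 0 by rewrite gt_eqF ?nm_gt0.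
by apply: (mulfI na); rewrite -nmM !divff ?nm1.
Qed.
Lemma nm_ofR x : nm (ofR x) = `|x|.
Proof.
apply: ofR_inj; rewrite ofR_nm [`|ofR x|]normc_def /=.
by rewrite expr0n /= addr0 sqrtr_sqr.
Qed.
Lemma nm_sq (z : C) : nm z ^+ 2 = re z ^+ 2 + im z ^+ 2.
Proof.
apply: ofR_inj; rewrite expr2 ofRM ofR_nm -expr2; exact: esym (add_Re2_Im2 (z : R[i])).
Qed.
Lemma re_le_nm (z : C) : re z <= nm z.
Proof.
apply: le_trans (ler_norm _) _; rewrite -le_ofR [X in _ <= X]ofR_nm.
exact: (normc_ge_Re (z : R[i])).
Qed.
Lemma re_ge_nm (z : C) : - nm z <= re z.
Proof. by have := re_le_nm (- z); rewrite reN nmN; lra. Qed.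
Lemma nm_re_im (z : C) : nm z <= `|re z| + `|im z|.
Proof.
rewrite -ler_sqr ?nnegrE ?nm_ge0 ?addr_ge0 // nm_sq.
rewrite -[re z ^+ 2]real_normK ?num_real // -[im z ^+ 2]real_normK ?num_real //.
by have := normr_ge0 (re z); have := normr_ge0 (im z); nra.
Qed.

(** Multiplication by a suitable unimodular number turns statements about
    moduli into statements about real parts. *)
Lemma unimodular_rotation (z : C) : exists c : C, nm c = 1 /\ re (c * z) = nm z.
Proof.
have [->|z0] := eqVneq z 0; first by exists 1; rewrite nm1 mulr0 nm0.
exists (`|z| / z); rewrite -mulrA mulVf // mulr1; split => //.
by rewrite nmM nmV -ofR_nm nm_ofR ger0_norm ?nm_ge0 // divff // gt_eqF // nm_gt0.
Qed.

(** * Neighbourhoods and derivatives in terms of the real norm *)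

Lemma nbhs_nmP (V : normedModType C) (x : V) (P : set V) :
  (\forall y \near x, P y) <->
  exists d : R, 0 < d /\ forall y, nm (y - x) < d -> P y.
Proof.
split.
  move=> /nbhs_ballP [e /= e0 He].
  have eE := ofR_re e0.
  exists (re e); split; first by rewrite -lt_ofR eE.
  by move=> y yx; apply: He; rewrite -ball_normE /= distrC -ofR_nm -eE lt_ofR.
move=> [d [d0 Hd]]; apply/nbhs_ballP; exists (ofR d); first by rewrite /= (lt_ofR 0).
move=> y; rewrite -ball_normE /= distrC -ofR_nm lt_ofR => yx; exact: Hd.
Qed.

Lemma continuous_nmP (V W : normedModType C) (f : V -> W) (x : V) :
  {for x, continuous f} <->
  forall e : R, 0 < e -> exists d : R, 0 < d /\
    forall y, nm (y - x) < d -> nm (f y - f x) < e.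
Proof.
split=> [cf e e0|cf].
  have /nbhs_nmP : \forall y \near f x, nm (y - f x) < e.
    by apply/nbhs_nmP; exists e.
  by move=> [d [d0 Hd]]; have /nbhs_nmP := cf _ (proj2 (nbhs_nmP _ _) (ex_intro _ d (conj d0 Hd))).
move=> P /nbhs_nmP [e [e0 He]].
have [d [d0 Hd]] := cf e e0; apply/nbhs_nmP; exists d; split=> // y yx.
by apply: He; exact: Hd.
Qed.

Lemma differentiable_nm (V W : normedModType C) (f : V -> W) (x : V) :
  differentiable f x -> forall e : R, 0 < e -> exists d : R, 0 < d /\
    forall u, nm u < d -> nm (f (x + u) - f x - 'd f x u) <= e * nm u.
Proof.
move=> /diff_locallyP [_ /eqaddoP Ef] e e0.
have e0' : 0 < ofR e by rewrite (lt_ofR 0).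
have /nbhs_nmP [d [d0 Hd]] := Ef _ e0'; exists d; split => // u ud.
have := Hd u; rewrite subr0 => /(_ ud); rewrite !fctE /= -!ofR_nm -ofRM.
by rewrite opprD addrA [u + x]addrC => H; rewrite -le_ofR.
Qed.

(** Differentiability asks for a continuous linear map; the bound [M] provides the
    continuity, which is not automatic when [V] has infinite dimension. *)
Lemma differentiable_of_nm (V W : normedModType C) (f : V -> W) (x : V)
    (L : {linear V -> W}) (M : R) : (forall u, nm (L u) <= M * nm u) ->
  (forall e : R, 0 < e -> exists d : R, 0 < d /\
    forall u, nm u < d -> nm (f (x + u) - f x - L u) <= e * nm u) ->
  differentiable f x.
Proof.
move=> LM H.
have cL : continuous L.
  move=> y; apply/continuous_nmP => e e0; have M0 : 0 < `|M| + 1 by rewrite ltr_wpDl.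
  exists (e / (`|M| + 1)); split; first by rewrite divr_gt0.
  move=> z; rewrite ltr_pdivlMr // -linearB => zy.
  apply: le_lt_trans zy; apply: le_trans (LM _) _; rewrite mulrC.
  by rewrite ler_wpM2l ?nm_ge0 //; have := ler_norm M; lra.
have EL : f \o shift x = cst (f x) + L +o_ 0 id.
  apply/eqaddoP => e e0.
  have eE := ofR_re e0.
  have e0' : 0 < re e by rewrite -lt_ofR eE.
  have [d [d0 Hd]] := H _ e0'; apply/nbhs_nmP; exists d; split => // u.
  rewrite subr0 => /Hd; rewrite !fctE /= -eE -!ofR_nm -ofRM.
  by rewrite opprD addrA [u + x]addrC le_ofR.
by apply/diff_locallyP; rewrite (diff_unique cL EL).
Qed.

(** The real and imaginary coordinates give a homeomorphism of the plane, which
    transports compactness from the real line. *)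
Lemma compact_disc (r : R) : compact [set z : C | nm z <= r].
Proof.
pose g (p : R * R) : C := (Complex p.1 p.2 : R[i]).
have cg : continuous g.
  move=> p P /nbhs_nmP [e [e0 He]].
  have e2 : 0 < e / 2 by rewrite divr_gt0.
  have h1 : \forall q \near p, `|p.1 - q.1| < e / 2.
    by move: (e / 2) e2; apply/(@cvgrPdist_lt _ R _ (nbhs p) _ fst); exact: cvg_fst.
  have h2 : \forall q \near p, `|p.2 - q.2| < e / 2.
    by move: (e / 2) e2; apply/(@cvgrPdist_lt _ R _ (nbhs p) _ snd); exact: cvg_snd.
  apply: filterS2 h1 h2 => q q1 q2; apply: He.
  apply: le_lt_trans (nm_re_im _) _; rewrite reD imD reN imN /g /re /im /=.
  by rewrite distrC [`|q.2 - _|]distrC; lra.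
have -> : [set z : C | nm z <= r] =
    g @` ((`[- r, r]%classic `*` `[- r, r]%classic) `&` (g @^-1` [set z | nm z <= r])).
  apply/seteqP; split => [z zr|_ [p [_ pr] <-] //].
  have zE : g (re z, im z) = z by case: z {zr}.
  exists (re z, im z) => //; split => /=; last by rewrite zE.
  have r0 : 0 <= r by exact: le_trans (nm_ge0 _) zr.
  have s1 : re z ^+ 2 <= r ^+ 2.
    by apply: le_trans (_ : nm z ^+ 2 <= _); rewrite ?nm_sq ?lerDl ?sqr_ge0 // -nm_sq ler_sqr // nnegrE ?nm_ge0.
  have s2 : im z ^+ 2 <= r ^+ 2.
    by apply: le_trans (_ : nm z ^+ 2 <= _); rewrite ?nm_sq ?lerDr ?sqr_ge0 // -nm_sq ler_sqr // nnegrE ?nm_ge0.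
  rewrite -[X in X <= _]real_normK ?num_real // ler_sqr ?nnegrE // in s1.
  rewrite -[X in X <= _]real_normK ?num_real // ler_sqr ?nnegrE // in s2.
  by split; rewrite /= in_itv /= -ler_norml.
have cK : compact (`[- r, r]%classic `*` `[- r, r]%classic : set (R * R)).
  by apply: compact_setX; exact: segment_compact.
apply: continuous_compact; first exact: continuous_subspaceT.
apply: (subclosed_compact _ cK); last by move=> p [].
apply: closedI; first by apply: compact_closed cK; exact: norm_hausdorff.
apply: preimage_closed; first by move=> p _; exact: cg.
rewrite -[X in closed X]setCK; apply: open_closedC; rewrite openE => z /= /negP.
rewrite -ltNge => rz; rewrite /interior; apply/(@nbhs_nmP C z); exists (nm z - r); split; first by rewrite subr_gt0.
move=> y yz /=; apply/negP; rewrite -ltNge.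
by have := nm_tri y z 0; rewrite !subr0 nm_sym; lra.
Qed.

End RealNorm.

(** * Bisection *)

Section Bisection.
Variable R : realType.
Local Notation C := (Cfield R).

Lemma halving_small (x d : R) : 0 < d -> exists n, x / 2 ^+ n < d.
Proof.
move=> d0; have /archi_boundP := normr_ge0 (x / d).
set n := Num.bound _ => xn; exists n.
rewrite ltr_pdivrMr ?exprn_gt0 // mulrC -ltr_pdivrMr //.
apply: le_lt_trans (ler_norm _) _; apply: lt_le_trans xn _.
by rewrite -natrX ler_nat ltnW // ltn_expl.
Qed.

Lemma seq_cluster (u : nat -> C) (r : R) (N : nat) :
  (forall n, (N <= n)%N -> nm (u n) <= r) ->
  exists z : C, nm z <= r /\
    forall (e : R) (n : nat), 0 < e -> exists m, (n <= m)%N /\ nm (u m - z) < e.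
Proof.
move=> ur; pose F := fmap u \oo.
have FD : F [set z | nm z <= r] by exists N => // n /= Nn; exact: ur.
have [z [zr cz]] := @compact_disc R r F _ FD.
exists z; split=> // e n e0.
have Fn : F (u @` [set m | (n <= m)%N]) by exists n => // m /= n_m; exists m.
have nz : nbhs z [set w | nm (w - z) < e] by apply/(@nbhs_nmP R C z); exists e.
by have [w [[m n_m <-] /= mz]] := cz _ _ Fn nz; exists m.
Qed.

Definition tends (u : nat -> C) (l : C) :=
  forall e : R, 0 < e -> exists N, forall n, (N <= n)%N -> nm (u n - l) <= e.

Lemma cauchy_tends (u : nat -> C) :
  (forall e : R, 0 < e -> exists N, forall n m, (N <= n)%N -> (N <= m)%N ->
     nm (u n - u m) <= e) -> exists l, tends u l.
Proof.
move=> cu; have [N HN] := cu 1 ltr01.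
have ub n : (N <= n)%N -> nm (u n) <= nm (u N) + 1.
  move=> Nn; have := HN n N Nn (leqnn _).
  by have := nmD (u n - u N) (u N); rewrite subrK; lra.
have [z [_ cz]] := seq_cluster ub; exists z => e e0.
have e2 : 0 < e / 2 by rewrite divr_gt0.
have [M HM] := cu _ e2; exists M => n Mn.
have [m [Mm mz]] := cz _ M e2.
by have := nm_tri (u m) (u n) z; have := HM n m Mn Mm; lra.
Qed.

(** Compactness in the form used by subdivision arguments: a property of cells
    that passes from the halved cells to the cell, and that holds for all small
    enough cells close to any given point, holds for every cell.  Otherwise some
    nested sequence of cells of failure shrinks to a point.  The bound
    [2 * sz t] is the total displacement of the base points of such a sequence. *)
Lemma bisection (T : Type) (inv : T -> Prop) (child : T -> T -> Prop)
    (pt : T -> C) (sz : T -> R) (r : R) (Phi : T -> Prop) :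
  (forall t, inv t -> nm (pt t) <= r) ->
  (forall t t', inv t -> child t t' ->
     [/\ inv t', nm (pt t' - pt t) <= sz t & sz t' = sz t / 2]) ->
  (forall t, inv t -> (forall t', child t t' -> Phi t') -> Phi t) ->
  (forall z, nm z <= r -> exists d, 0 < d /\ forall t, inv t ->
     nm (pt t - z) <= 2 * sz t -> sz t < d -> Phi t) ->
  forall t, inv t -> Phi t.
Proof.
move=> ptr hch hup hloc t0 it0; apply: contrapT => nt0.
pose bad := {t : T | inv t /\ ~ Phi t}.
have nextP (t : bad) : exists t' : bad, child (projT1 t) (projT1 t').
  case: t => t [it nt] /=; apply: contrapT => nex; apply: nt; apply: hup => // t' ch.
  apply: contrapT => nt'; apply: nex.
  by have [it' _ _] := hch _ _ it ch; exists (exist _ t' (conj it' nt')).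
have [next nextE] := choice nextP.
pose u n := iter n next (exist _ t0 (conj it0 nt0) : bad).
pose v n := projT1 (u n).
have iv n : inv (v n) by rewrite /v; case: (u n) => ? [].
have step n : [/\ inv (v n.+1), nm (pt (v n.+1) - pt (v n)) <= sz (v n) & sz (v n.+1) = sz (v n) / 2].
  by apply: hch => //; exact: nextE.
have szE n : sz (v n) = sz t0 / 2 ^+ n.
  elim: n => [|n IH]; first by rewrite expr0 divr1.
  by have [_ _ ->] := step n; rewrite IH exprSr invfM mulrA.
have sz0 n : 0 <= sz (v n) by have [_ + _] := step n; apply: le_trans; exact: nm_ge0.
have tail n k : nm (pt (v (n + k)%N) - pt (v n)) <= 2 * sz (v n) - 2 * sz (v (n + k)%N).
  elim: k => [|k IH]; first by rewrite addn0 !subrr nm0.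
  rewrite addnS; have [_ s1 s2] := step (n + k)%N.
  by have := nm_tri (pt (v (n + k)%N)) (pt (v (n + k).+1)) (pt (v n)); lra.
have [z [zr cz]] : exists z : C, nm z <= r /\
    forall (e : R) (n : nat), 0 < e -> exists m, (n <= m)%N /\ nm (pt (v m) - z) < e.
  by apply: (@seq_cluster (pt \o v) r 0) => n _; exact: ptr.
have near n : nm (pt (v n) - z) <= 2 * sz (v n).
  rewrite leNgt; apply/negP => far.
  move: far; rewrite -subr_gt0 => far.
  have [m [n_m mz]] := cz _ n far.
  have := tail n (m - n)%N; rewrite subnKC //.
  have := nm_tri (pt (v m)) (pt (v n)) z; rewrite (nm_sym (pt (v n)) (pt (v m))).
  by have := sz0 m; lra.
have [d [d0 Hd]] := hloc z zr; have [n nd] := halving_small (sz t0) d0.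
have : Phi (v n) by apply: Hd; rewrite ?szE // -szE.
by rewrite /v; case: (u n) => ? [].
Qed.

End Bisection.

(** * Goursat's lemma for means over segments *)

Section Goursat.
Variable R : realType.
Local Notation C := (Cfield R).

Definition has_deriv (f : C -> C) (z l : C) :=
  forall e : R, 0 < e -> exists d : R, 0 < d /\
    forall h, nm h < d -> nm (f (z + h) - f z - l * h) <= e * nm h.

Lemma derivable_has_deriv (f : C -> C) (z : C) : derivable f z 1 -> has_deriv f z (derive1 f z).
Proof.
move=> df; have dd : differentiable f z by apply/derivable1_diffP.
move=> e e0; have [d [d0 Hd]] := differentiable_nm dd e0.
exists d; split => // h /Hd; congr (nm (_ - _) <= _).
by rewrite diff1E // mulrC.
Qed.

Lemma tends_unique (u : nat -> C) l l' : tends u l -> tends u l' -> l = l'.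
Proof.
move=> ul ul'; apply/eqP; rewrite -subr_eq0; apply/eqP/nm_eq0/eqP.
rewrite eq_le nm_ge0 andbT leNgt; apply/negP => e0.
have e4 : 0 < nm (l - l') / 4 by rewrite divr_gt0.
have [N HN] := ul _ e4; have [M HM] := ul' _ e4.
have := HN (maxn N M) (leq_maxl _ _); have := HM (maxn N M) (leq_maxr _ _).
by have := nm_tri (u (maxn N M)) l l'; rewrite (nm_sym l (u _)); lra.
Qed.

Lemma tends_le (u : nat -> C) l c e : tends u l ->
  (forall n, nm (u n - c) <= e) -> nm (l - c) <= e.
Proof.
move=> ul ue; rewrite leNgt; apply/negP; rewrite -subr_gt0 => far.
have e2 : 0 < (nm (l - c) - e) / 2 by rewrite divr_gt0.
have [N HN] := ul _ e2.
have := HN N (leqnn _); have := ue N.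
by have := nm_tri (u N) l c; rewrite (nm_sym l (u _)); lra.
Qed.

Lemma tends_re_ge (u : nat -> C) l m : tends u l ->
  (forall n, m <= re (u n)) -> m <= re l.
Proof.
move=> ul um; rewrite leNgt; apply/negP; rewrite -subr_gt0 => far.
have e2 : 0 < (m - re l) / 2 by rewrite divr_gt0.
have [N HN] := ul _ e2; have := HN N (leqnn _); have := um N.
by have := re_le_nm (u N - l); rewrite reB; lra.
Qed.

Lemma tendsD (u v : nat -> C) l k : tends u l -> tends v k ->
  tends (fun n => u n + v n) (l + k).
Proof.
move=> ul vk e e0; have e2 : 0 < e / 2 by rewrite divr_gt0.
have [N HN] := ul _ e2; have [M HM] := vk _ e2.
exists (maxn N M) => n; rewrite geq_max => /andP[/HN h1 /HM h2].
by rewrite opprD addrACA; have := nmD (u n - l) (v n - k); lra.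
Qed.

Lemma tendsZ (u : nat -> C) l c : tends u l -> tends (fun n => c * u n) (c * l).
Proof.
move=> ul e e0; have c0 : 0 < nm c + 1 by rewrite ltr_wpDl ?nm_ge0.
have [N HN] := ul (e / (nm c + 1)) (divr_gt0 e0 c0); exists N => n /HN.
rewrite ler_pdivlMr // -mulrBr nmM => h; apply: le_trans h; rewrite mulrC.
by rewrite ler_wpM2l ?nm_ge0 // lerDl.
Qed.

Lemma tendsS (u : nat -> C) l : tends u l -> tends (fun n => u n.+1) l.
Proof. by move=> ul e /ul [N HN]; exists N => n Nn; apply: HN; exact: leqW. Qed.

Definition midpoint (a b : C) : C := (a + b) / 2.
Definition midpoint_convex (S : C -> Prop) :=
  forall a b, S a -> S b -> S (midpoint a b).

Lemma nm_half (z : C) : nm (z / 2) = nm z / 2.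
Proof.
rewrite nmM nmV; congr (_ / _).
by rewrite -(ofR_nat R 2) nm_ofR ger0_norm.
Qed.

Lemma ball_midpoint_convex z e : midpoint_convex (fun w => nm (w - z) <= e).
Proof.
move=> a b az bz; rewrite (_ : _ - z = ((a - z) + (b - z)) / 2); last by rewrite /midpoint; field.
by rewrite nm_half; have := nmD (a - z) (b - z); lra.
Qed.

Lemma ball0_midpoint_convex e : midpoint_convex (fun w => nm w <= e).
Proof. by move=> a b; have := @ball_midpoint_convex 0 e a b; rewrite /= !subr0. Qed.

Lemma re_half (z : C) : re (z / 2) = re z / 2.
Proof.
have -> : z / 2 = ofR 2^-1 * z.
  rewrite mulrC; congr (_ * _); apply: (mulfI (_ : (2 : C) != 0)); rewrite ?pnatr_eq0 //.
  by rewrite divff ?pnatr_eq0 // -(ofR_nat R 2) -ofRM divff ?pnatr_eq0.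
by rewrite reZ mulrC.
Qed.

Lemma halfplane_midpoint_convex m : midpoint_convex (fun w => m <= re w).
Proof. by move=> a b am bm; rewrite re_half reD; lra. Qed.

(** Midpoint Riemann sums of [f] over the segment from [a] to [b], with [2 ^ n]
    equal steps, divided by [b - a]. Dyadic steps make the recursion under halving of the
    segment an identity of sums, not only of limits. *)
Fixpoint riemann_mean (f : C -> C) n a b : C :=
  if n is n'.+1 then
    midpoint (riemann_mean f n' a (midpoint a b)) (riemann_mean f n' (midpoint a b) b)
  else f (midpoint a b).

Lemma midpointC a b : midpoint a b = midpoint b a.
Proof. by rewrite /midpoint addrC. Qed.

Lemma riemann_meanC f n a b : riemann_mean f n a b = riemann_mean f n b a.
Proof.
elim: n a b => [|n IH] a b /=; first by rewrite midpointC.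
by rewrite midpointC (midpointC a b) (IH _ b) (IH a).
Qed.

(** The midpoint rule is exact on affine functions, so a bound [Q] on the difference
    of [f] and an affine function passes to the means. The sets [S] and [Q] are closed
    under midpoints only, like discs and half-planes. *)
Lemma riemann_mean_convex (S Q : C -> Prop) f (al be : C) n a b :
  midpoint_convex S -> midpoint_convex Q ->
  (forall z, S z -> Q (f z - (al + be * z))) -> S a -> S b ->
  Q (riemann_mean f n a b - (al + be * midpoint a b)).
Proof.
move=> mS mQ fQ; elim: n a b => [|n IH] a b Sa Sb /=; first exact/fQ/mS.
set m := midpoint a b.
rewrite (_ : _ - _ = midpoint (riemann_mean f n a m - (al + be * midpoint a m))
   (riemann_mean f n m b - (al + be * midpoint m b))).
  by apply: mQ; apply: IH => //; exact: mS.
by rewrite /midpoint /m /midpoint; field.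
Qed.

Section Mean.
Variables (f : C -> C) (r : R).
Hypothesis f_cont : forall z : C, nm z <= r -> forall e : R, 0 < e ->
  exists d : R, 0 < d /\ forall w, nm (w - z) < d -> nm (f w - f z) < e.

Lemma disc_midpoint a b : nm a <= r -> nm b <= r -> nm (midpoint a b) <= r.
Proof. exact: ball0_midpoint_convex. Qed.

Lemma midpointBl (a b : C) : midpoint a b - a = (b - a) / 2.
Proof. by rewrite /midpoint; field. Qed.
Lemma midpointBr (a b : C) : b - midpoint a b = (b - a) / 2.
Proof. by rewrite /midpoint; field. Qed.

(** The Cauchy property passes from the two halves of a segment to the segment, and
    holds for short segments because [f] is almost constant there: this is the
    bisection principle, which spares uniform continuity. *)
Lemma riemann_mean_cvg a b : nm a <= r -> nm b <= r ->
  exists l, tends (fun n => riemann_mean f n a b) l.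
Proof.
move=> ar br; apply: cauchy_tends => e e0.
pose inv (t : C * C) := nm t.1 <= r /\ nm t.2 <= r.
pose child (t t' : C * C) :=
  t' = (t.1, midpoint t.1 t.2) \/ t' = (midpoint t.1 t.2, t.2).
pose Phi (t : C * C) := exists N, forall n m, (N <= n)%N -> (N <= m)%N ->
  nm (riemann_mean f n t.1 t.2 - riemann_mean f m t.1 t.2) <= e.
apply: (@bisection R _ inv child fst (fun t => nm (t.2 - t.1)) r Phi _ _ _ _ (a, b)) => //.
- by move=> t [].
- move=> [c d] t' [/= cr dr]; have mr := disc_midpoint cr dr.
  have n0 := nm_ge0 (d - c).
  case=> -> /=; split=> //=; rewrite ?midpointBl ?midpointBr ?subrr ?nm0 ?nm_half //; lra.
- move=> [c d] [/= cr dr] ch; pose m := midpoint c d.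
  have [N HN] := ch (c, m) (or_introl erefl); have [M HM] := ch (m, d) (or_intror erefl).
  exists (maxn N M).+1 => -[|n] [|k] //=; rewrite !ltnS !geq_max.
  move=> /andP[n1 n2] /andP[k1 k2]; have /= := HN n k n1 k1; have /= := HM n k n2 k2.
  rewrite -/m; set x1 := riemann_mean _ _ _ _; set x2 := riemann_mean _ _ _ _.
  set x3 := riemann_mean _ _ _ _; set x4 := riemann_mean _ _ _ _ => h1 h2.
  rewrite (_ : _ - _ = ((x3 - x4) + (x1 - x2)) / 2); last by rewrite /midpoint; field.
  by rewrite nm_half; have := nmD (x3 - x4) (x1 - x2); lra.
- move=> z zr; have e2 : 0 < e / 2 by rewrite divr_gt0.
  have [d [d0 Hd]] := f_cont zr e2; exists (d / 4); split; first by rewrite divr_gt0.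
  move=> [c k] [/= cr kr] cz ck; exists 0 => n m _ _.
  have near j : nm (riemann_mean f j c k - (f z + 0 * midpoint c k)) <= e / 2.
    apply: (@riemann_mean_convex (fun w => nm (w - z) <= 3 * nm (k - c))
              (fun w => nm w <= e / 2)).
    + exact: ball_midpoint_convex.
    + exact: ball0_midpoint_convex.
    + move=> w wz; rewrite mul0r addr0; apply/ltW/Hd; lra.
    + by have := nm_ge0 (k - c); lra.
    + by have := nm_tri c k z; lra.
  rewrite mul0r addr0 in near.
  have := near n; have := near m; rewrite (nm_sym (riemann_mean f m _ _)).
  by have := nm_tri (f z) (riemann_mean f n c k) (riemann_mean f m c k); lra.
Qed.

Definition segment_mean a b : C := xget 0 [set l | tends (fun n => riemann_mean f n a b) l].

Lemma segment_meanP a b : nm a <= r -> nm b <= r ->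
  tends (fun n => riemann_mean f n a b) (segment_mean a b).
Proof. by move=> ar br; exact: (xgetPex 0 (riemann_mean_cvg ar br)). Qed.

Lemma segment_meanC a b : segment_mean a b = segment_mean b a.
Proof.
rewrite /segment_mean; congr (xget _ _); apply/funext => l.
by congr (tends _ l); apply/funext => n; exact: riemann_meanC.
Qed.

Lemma segment_mean_midpoint a b : nm a <= r -> nm b <= r ->
  segment_mean a b =
  midpoint (segment_mean a (midpoint a b)) (segment_mean (midpoint a b) b).
Proof.
move=> ar br; have mr := disc_midpoint ar br.
apply: tends_unique (tendsS (segment_meanP ar br)) _.
rewrite /midpoint mulrC; rewrite (_ : (fun n => _) = (fun n => 2^-1 *
  (riemann_mean f n a (midpoint a b) + riemann_mean f n (midpoint a b) b))).
  by apply: tendsZ; apply: tendsD; exact: segment_meanP.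
by apply/funext => n /=; rewrite [in LHS]/midpoint mulrC.
Qed.

Lemma segment_mean_affine (S : C -> Prop) (al be : C) e a b :
  nm a <= r -> nm b <= r -> midpoint_convex S -> S a -> S b ->
  (forall z, S z -> nm (f z - (al + be * z)) <= e) ->
  nm (segment_mean a b - (al + be * midpoint a b)) <= e.
Proof.
move=> ar br mS Sa Sb fe; apply: tends_le (segment_meanP ar br) _ => n.
apply: (riemann_mean_convex (S := S) (Q := fun w => nm w <= e)) => //.
exact: ball0_midpoint_convex.
Qed.

Lemma segment_mean_re_ge (S : C -> Prop) m a b :
  nm a <= r -> nm b <= r -> midpoint_convex S -> S a -> S b ->
  (forall z, S z -> m <= re (f z)) -> m <= re (segment_mean a b).
Proof.
move=> ar br mS Sa Sb fe; apply: tends_re_ge (segment_meanP ar br) _ => n.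
have := @riemann_mean_convex S (fun w => m <= re w) f 0 0 n a b mS
  (@halfplane_midpoint_convex m).
rewrite mul0r addr0 subr0; apply=> // z Sz; rewrite mul0r addr0 subr0; exact: fe.
Qed.

Hypothesis f_deriv : forall z : C, nm z <= r -> derivable f z 1.

Lemma midpointB x y z : midpoint x y - midpoint y z = (x - z) / 2.
Proof. by rewrite /midpoint; field. Qed.
Lemma midpointBC x y z : midpoint x y - midpoint z x = (y - z) / 2.
Proof. by rewrite /midpoint; field. Qed.

Definition boundary_integral (t : C * C * C) : C :=
  let: (x, y, z) := t in
  (y - x) * segment_mean x y + (z - y) * segment_mean y z + (x - z) * segment_mean z x.

Definition perimeter (t : C * C * C) : R :=
  let: (x, y, z) := t in nm (y - x) + nm (z - y) + nm (x - z).

Definition subtriangle (t t' : C * C * C) : Prop :=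
  let: (x, y, z) := t in
  [\/ t' = (x, midpoint x y, midpoint z x), t' = (midpoint x y, y, midpoint y z),
      t' = (midpoint z x, midpoint y z, z) | t' = (midpoint y z, midpoint z x, midpoint x y)].

Lemma boundary_integral_subdivision x y z : nm x <= r -> nm y <= r -> nm z <= r ->
  boundary_integral (x, y, z) =
  boundary_integral (x, midpoint x y, midpoint z x) +
  boundary_integral (midpoint x y, y, midpoint y z) +
  (boundary_integral (midpoint z x, midpoint y z, z) +
  boundary_integral (midpoint y z, midpoint z x, midpoint x y)).
Proof.
move=> xr yr zr; rewrite /boundary_integral.
rewrite (segment_mean_midpoint xr yr) (segment_mean_midpoint yr zr) (segment_mean_midpoint zr xr).
rewrite !midpointBl !midpointBr !midpointB !midpointBC.
set xy := midpoint x y; set yz := midpoint y z; set zx := midpoint z x.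
rewrite (segment_meanC yz zx) (segment_meanC zx xy) (segment_meanC xy yz).
move: (segment_mean _ _) => a1; move: (segment_mean _ _) => a2.
move: (segment_mean _ _) => a3; move: (segment_mean _ _) => a4.
move: (segment_mean _ _) => a5; move: (segment_mean _ _) => a6.
move: (segment_mean _ _) => a7; move: (segment_mean _ _) => a8.
move: (segment_mean _ _) => a9; by rewrite /midpoint; field.
Qed.

Lemma perimeter_subtriangle t t' : subtriangle t t' -> perimeter t' = perimeter t / 2.
Proof.
case: t => [[x y] z]; case=> -> /=;
  rewrite ?midpointBl ?midpointBr ?midpointB ?midpointBC !nm_half; try lra.
by rewrite (nm_sym x y) (nm_sym y z) (nm_sym z x); lra.
Qed.

Lemma subtriangle_base x y z t' : subtriangle (x, y, z) t' ->
  nm (t'.1.1 - x) <= perimeter (x, y, z).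
Proof.
have n1 := nm_ge0 (y - x); have n2 := nm_ge0 (z - y); have n3 := nm_ge0 (x - z).
case=> -> /=; rewrite ?subrr ?nm0.
- lra.
- by rewrite midpointBl nm_half; lra.
- by rewrite midpointC midpointBl nm_half nm_sym; lra.
- have -> : midpoint y z - x = (y - x) / 2 + (z - x) / 2 by rewrite /midpoint; field.
  by have := nmD ((y - x) / 2) ((z - x) / 2); rewrite !nm_half (nm_sym z x); lra.
Qed.

(** Near each point [f] is affine up to a small multiple of the distance,
    affine functions have zero integral over the boundary of a triangle, and the
    boundary integral is additive under subdivision into four half-size
    triangles; so the integral is at most [e] times the square of the perimeter
    for every positive [e]. *)
Lemma goursat (a b c : C) : nm a <= r -> nm b <= r -> nm c <= r ->
  (b - a) * segment_mean a b + (c - b) * segment_mean b c + (a - c) * segment_mean c a = 0.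
Proof.
move=> ar br cr.
suff main (e : R) : 0 < e -> nm (boundary_integral (a, b, c)) <= e * perimeter (a, b, c) ^+ 2.
  apply: nm_eq0; rewrite -/(boundary_integral (a, b, c)); apply/eqP.
  rewrite eq_le nm_ge0 andbT leNgt; apply/negP => b0.
  have s0 := sqr_ge0 (perimeter (a, b, c)).
  have s1 : 0 < 2 * (perimeter (a, b, c) ^+ 2 + 1) by lra.
  have := main _ (divr_gt0 b0 s1); rewrite mulrAC ler_pdivlMr //; nra.
move=> e0.
pose inv (t : C * C * C) := [/\ nm t.1.1 <= r, nm t.1.2 <= r & nm t.2 <= r].
apply: (@bisection R _ inv subtriangle (fun t => t.1.1) perimeter r
  (fun t => nm (boundary_integral t) <= e * perimeter t ^+ 2)) => //.
- by move=> t [].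
- move=> [[x y] z] t' [/= xr yr zr] ch; split.
  + have [xy yz zx] := And3 (disc_midpoint xr yr) (disc_midpoint yr zr) (disc_midpoint zr xr).
    by case: ch => ->.
  + exact: subtriangle_base.
  + exact: (@perimeter_subtriangle (x, y, z)).
- move=> [[x y] z] [xr yr zr] ch; rewrite /= in xr yr zr.
  rewrite boundary_integral_subdivision //.
  have quarter t' : subtriangle (x, y, z) t' ->
      nm (boundary_integral t') <= e * perimeter (x, y, z) ^+ 2 / 4.
    move=> h; apply: le_trans (ch _ h) _; rewrite (perimeter_subtriangle h) exprMn exprVn.
    by rewrite mulrA -natrX.
  have h1 := quarter _ (Or41 _ _ _ erefl); have h2 := quarter _ (Or42 _ _ _ erefl).
  have h3 := quarter _ (Or43 _ _ _ erefl); have h4 := quarter _ (Or44 _ _ _ erefl).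
  apply: le_trans (nmD _ _) _; apply: le_trans (lerD (nmD _ _) (nmD _ _)) _.
  by apply: le_trans (lerD (lerD h1 h2) (lerD h3 h4)) _; lra.
- move=> z zr; have e1 : 0 < e / 3 by rewrite divr_gt0.
  have Hl := derivable_has_deriv (f_deriv zr); move: (derive1 f z) Hl => l Hl.
  have [d [d0 Hd]] := Hl _ e1.
  exists (d / 4); split; first by rewrite divr_gt0.
  move=> [[x y] w] [/= xr yr wr] xz ps.
  have n1 := nm_ge0 (y - x); have n2 := nm_ge0 (w - y); have n3 := nm_ge0 (x - w).
  move: ps xz; set p := nm (y - x) + _ + _ => ps xz.
  have pE : p = nm (y - x) + nm (w - y) + nm (x - w) by [].
  have near u v : nm u <= r -> nm v <= r -> nm (u - z) <= 3 * p -> nm (v - z) <= 3 * p ->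
    nm (segment_mean u v - (f z - l * z + l * midpoint u v)) <= e * p.
    move=> ur vr uz vz.
    apply: (@segment_mean_affine (fun k => nm (k - z) <= 3 * p)) => //.
      exact: ball_midpoint_convex.
    move=> k /= kz; have := Hd (k - z); rewrite [z + _]addrC subrK.
    rewrite (_ : _ - _ - l * (k - z) = f k - (f z - l * z + l * k)); last by ring.
    have e30 := ltW e1; move=> h; apply: (le_trans (h _)); first by lra.
    by apply: le_trans (ler_wpM2l e30 kz) _; rewrite le_eqVlt; apply/orP; left; apply/eqP; field.
  have yz : nm (y - z) <= 3 * p by have := nm_tri x y z; lra.
  have wz : nm (w - z) <= 3 * p by have := nm_tri x w z; rewrite (nm_sym w x); lra.
  have xz' : nm (x - z) <= 3 * p by lra.
  have := near x y xr yr xz' yz; have := near y w yr wr yz wz; have := near w x wr xr wz xz'.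
  rewrite /midpoint; move: (segment_mean _ _) => a1; move: (segment_mean _ _) => a2.
  move: (segment_mean _ _) => a3 h1 h2 h3.
  set q1 := (a1 - _) in h1; set q2 := (a2 - _) in h2; set q3 := (a3 - _) in h3.
  rewrite (_ : _ + _ = (y - x) * q3 + (w - y) * q2 + (x - w) * q1); last first.
    by rewrite /q1 /q2 /q3; field.
  have g1 := ler_wpM2l n3 h1; have g2 := ler_wpM2l n2 h2; have g3 := ler_wpM2l n1 h3.
  have := nmD ((y - x) * q3 + (w - y) * q2) ((x - w) * q1).
  have := nmD ((y - x) * q3) ((w - y) * q2); rewrite !nmM.
  rewrite (_ : e * p ^+ 2 = nm (y - x) * (e * p) + nm (w - y) * (e * p) + nm (x - w) * (e * p)).
    by lra.
  by rewrite /p; ring.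
Qed.
End Mean.
End Goursat.

(** * The minimum principle for real parts *)

Section MaximumPrinciple.
Variable R : realType.
Local Notation C := (Cfield R).

Lemma derivable_continuous_nm (f : C -> C) (z : C) : derivable f z 1 ->
  forall e : R, 0 < e -> exists d : R, 0 < d /\
    forall w, nm (w - z) < d -> nm (f w - f z) < e.
Proof.
move=> df; apply/(@continuous_nmP R C C f z).
by apply: differentiable_continuous; apply/derivable1_diffP.
Qed.

Lemma disc_minimum (u : C -> R) (r : R) : 0 <= r ->
  (forall z, nm z <= r -> forall e : R, 0 < e -> exists d : R, 0 < d /\
    forall w, nm (w - z) < d -> `|u w - u z| < e) ->
  exists p, nm p <= r /\ forall z, nm z <= r -> u p <= u z.
Proof.
move=> r0 cu.
have [||p /set_mem pr pmin] := @compact_EVT_min C R u _ _ (@compact_disc R r).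
- by exists 0; rewrite /= nm0.
- apply: continuous_in_subspaceT => z /set_mem zr P /nbhs_ballP [e /= e0 He].
  have [d [d0 Hd]] := cu z zr e e0; apply/(@nbhs_nmP R C z); exists d; split => // w /Hd wz.
  by apply: He; rewrite -ball_normE /= distrC.
- by exists p; split => // z zr; apply: pmin; exact/mem_set.
Qed.

(** The second derivative test for the Laplacian. Summing over the four points [h]
    with [h ^ 4 = x ^ 4] kills the terms of degrees 1 and 2 of a complex polynomial, but
    not the Laplacian of the squared modulus. *)
Lemma no_interior_minimum (S : C -> C) (p s1 s2 : C) (k d : R) :
  0 < k -> 0 < d ->
  (forall e : R, 0 < e -> exists d : R, 0 < d /\ forall h, nm h < d ->
     nm (S (p + h) - S p - (s1 * h + s2 * h ^+ 2)) <= e * nm h ^+ 2) ->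
  ~ (forall h, nm h < d -> re (S p) - k * nm p ^+ 2 <= re (S (p + h)) - k * nm (p + h) ^+ 2).
Proof.
move=> k0 d0 S2 pmin; have k2 : 0 < k / 2 by rewrite divr_gt0.
have [d' [d'0 Hd']] := S2 _ k2.
pose x := Num.min d d' / 2; have x0 : 0 < x by rewrite divr_gt0 // lt_min d0.
have [xd xd'] : x < d /\ x < d'.
  by split; rewrite /x ltr_pdivrMr // mulrC mulr_natl mulr2n;
     [apply: ltr_pwDl|apply: ltr_pwDl] => //; rewrite ge_min lexx ?orbT.
have point (a b : R) : a ^+ 2 + b ^+ 2 = x ^+ 2 ->
    - (k * nm p ^+ 2) <= (re s1 * a - im s1 * b) +
      (re s2 * (a * a - b * b) - im s2 * (a * b + b * a)) + k / 2 * x ^+ 2 -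
      k * ((re p + a) ^+ 2 + (im p + b) ^+ 2).
  move=> abx; pose h : C := (Complex a b : R[i]).
  have hx : nm h = x.
    by apply: (pexpIrn (n := 2)); rewrite ?nnegrE ?nm_ge0 ?(ltW x0) // nm_sq.
  have := pmin h; rewrite hx => /(_ xd) h1.
  have := Hd' h; rewrite hx => /(_ xd') h2.
  have := re_le_nm (S (p + h) - S p - (s1 * h + s2 * h ^+ 2)); rewrite !reB.
  move: h1; rewrite (nm_sq (p + h)) reD imD -/(re h) -/(im h) (reD (s1 * h)).
  rewrite (reM s1) (reM s2) expr2 (reM h) (imM h) -[re h]/a -[im h]/b.
  by lra.
have e1 : x ^+ 2 + 0 ^+ 2 = x ^+ 2 by ring.
have e2 : (- x) ^+ 2 + 0 ^+ 2 = x ^+ 2 by ring.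
have e3 : 0 ^+ 2 + x ^+ 2 = x ^+ 2 by ring.
have e4 : 0 ^+ 2 + (- x) ^+ 2 = x ^+ 2 by ring.
have p1 := point _ _ e1; have p2 := point _ _ e2; have p3 := point _ _ e3.
have p4 := point _ _ e4; have kx : 0 < k * x ^+ 2 by rewrite mulr_gt0 ?exprn_gt0.
by move: p1 p2 p3 p4; rewrite nm_sq; lra.
Qed.

Section ShiftedMean.
Variables (f : C -> C) (r : R).
Hypothesis f_deriv : forall z : C, nm z <= r -> derivable f z 1.

Let f_cont (z : C) : nm z <= r -> forall e : R, 0 < e ->
  exists d : R, 0 < d /\ forall w, nm (w - z) < d -> nm (f w - f z) < e.
Proof. by move=> /f_deriv; exact: derivable_continuous_nm. Qed.

Lemma segment_mean_taylor (p : C) : nm p < r ->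
  exists l : C, forall e : R, 0 < e -> exists d : R, 0 < d /\ forall h, nm h < d ->
    nm (segment_mean f p (p + h) - (f p + l / 2 * h)) <= e * nm h.
Proof.
move=> pr; have Hl := derivable_has_deriv (f_deriv (ltW pr)).
exists (derive1 f p) => e e0; move: (derive1 f p) Hl => l Hl.
have [d [d0 Hd]] := Hl e e0; exists (Num.min d (r - nm p)); rewrite lt_min d0 subr_gt0.
split=> // h; rewrite lt_min => /andP[hd hr].
have phr : nm (p + h) <= r by have := nmD p h; lra.
rewrite (_ : f p + l / 2 * h = f p - l * p + l * midpoint p (p + h)); last first.
  by rewrite /midpoint; field.
apply: (segment_mean_affine f_cont (S := fun w => nm (w - p) <= nm h)) => //.
- exact: ltW.
- exact: ball_midpoint_convex.
- by rewrite subrr nm0 nm_ge0.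
- by rewrite [p + h]addrC addrK.
- move=> z zp; have := Hd (z - p) (le_lt_trans zp hd); rewrite [p + _]addrC subrK.
  rewrite (_ : _ - _ - l * (z - p) = f z - (f p - l * p + l * z)); last by ring.
  by move=> h1; apply: le_trans h1 _; rewrite ler_wpM2l // ltW.
Qed.

(** By Goursat's lemma [z * segment_mean f 0 z] is a primitive of [f], and
    [segment_mean f p (p + d)] is a difference quotient of that primitive; hence it
    is twice differentiable in [p]. *)
Lemma shifted_mean_taylor (p d : C) : d != 0 -> nm p < r -> nm (p + d) < r ->
  exists s1 s2 : C, forall e : R, 0 < e -> exists k : R, 0 < k /\ forall h, nm h < k ->
    nm (segment_mean f (p + h) (p + h + d) - segment_mean f p (p + d) -
        (s1 * h + s2 * h ^+ 2)) <= e * nm h ^+ 2.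
Proof.
move=> d0 pr pdr; have [l Hl] := segment_mean_taylor pr; have [m Hm] := segment_mean_taylor pdr.
exists ((f (p + d) - f p) / d), ((m - l) / 2 / d) => e e0.
have nd : 0 < nm d by exact: nm_gt0.
have e1 : 0 < e * nm d / 2 by rewrite divr_gt0 // mulr_gt0.
have [k1 [k10 H1]] := Hl _ e1; have [k2 [k20 H2]] := Hm _ e1.
exists (Num.min (Num.min k1 k2) (Num.min (r - nm p) (r - nm (p + d)))).
rewrite !lt_min k10 k20 !subr_gt0 pr pdr; split=> // h.
rewrite !lt_min => /andP[/andP[hk1 hk2] /andP[hr1 hr2]].
have r1 : nm (p + h) <= r by have := nmD p h; lra.
have r2 : nm (p + d + h) <= r by have := nmD (p + d) h; lra.
have r0 : nm (0 : C) <= r by rewrite nm0; have := nm_ge0 p; lra.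
have {}H1 := H1 h hk1; have {}H2 := H2 h hk2.
have G (u v : C) : nm u <= r -> nm v <= r ->
    (v - u) * segment_mean f u v = v * segment_mean f 0 v - u * segment_mean f 0 u.
  move=> ur vr; have := goursat f_cont f_deriv r0 ur vr.
  rewrite (segment_meanC f v 0) => E; apply/eqP; rewrite -subr_eq0; apply/eqP.
  by apply: etrans E; ring.
have prW := ltW pr; have pdrW := ltW pdr.
have G1 := G _ _ prW pdrW; have G2 : nm (p + h + d) <= r -> _ := G _ _ r1.
rewrite addrAC in G2; have {}G2 := G2 r2.
have G3 := G _ _ prW r1; have G4 := G _ _ pdrW r2.
rewrite [p + h + d]addrAC.
move: G1 G2 G3 G4 H1 H2.
rewrite (_ : p + d - p = d); last by ring.
rewrite (_ : p + d + h - (p + h) = d); last by ring.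
rewrite (_ : p + h - p = h); last by ring.
rewrite (_ : p + d + h - (p + d) = h); last by ring.
set A := segment_mean f p (p + d); set B := segment_mean f (p + h) _.
set A1 := segment_mean f p _; set A2 := segment_mean f (p + d) _.
move: (segment_mean f 0 p) (segment_mean f 0 (p + d)) => q1 q2.
move: (segment_mean f 0 (p + h)) (segment_mean f 0 (p + d + h)) => q3 q4.
move=> G1 G2 G3 G4 H1 H2.
(* The increment of [S] is written with the primitive, then with the means over the
   segments of length [h] at [p] and at [p + d], which have a first order expansion. *)
have E : B - A - ((f (p + d) - f p) / d * h + (m - l) / 2 / d * h ^+ 2) =
   h / d * ((A2 - (f (p + d) + m / 2 * h)) - (A1 - (f p + l / 2 * h))).
  apply: (mulfI d0).
  rewrite (_ : d * (_ - _ - _) = d * B - d * A - ((f (p + d) - f p) * h + (m - l) / 2 * h ^+ 2)).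
    have -> : d * B - d * A = h * A2 - h * A1 by rewrite G1 G2 G3 G4; ring.
    by field; exact: d0.
  by field; exact: d0.
rewrite E nmM nmM nmV; have := nmB (A2 - (f (p + d) + m / 2 * h)) (A1 - (f p + l / 2 * h)).
set q := nm (_ - _ - _) => hq.
have hq' : q <= e * nm d * nm h by lra.
rewrite -(ler_pM2l nd) (_ : nm d * _ = nm h * q); last by field; rewrite gt_eqF.
by have := ler_wpM2l (nm_ge0 h) hq'; rewrite (_ : nm d * _ = nm h * (e * nm d * nm h)) //; ring.
Qed.

End ShiftedMean.

(** The minimum principle for the real part of a holomorphic function, in the
    form in which it is used. The difference quotients of a primitive of [f] are
    close to [f] and twice differentiable, so that the second derivative test
    applies at an interior minimum of their real part minus [c / 2 * |z| ^ 2]. *)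
Lemma no_quadratic_growth (f : C -> C) (r c : R) : 0 < r -> 0 < c ->
  (forall z, nm z <= r -> derivable f z 1) -> f 0 = 0 ->
  ~ (forall z, nm z <= r -> c * nm z ^+ 2 <= re (f z)).
Proof.
move=> r0 c0 df f0 fc.
have f_cont (z : C) : nm z <= r -> forall e : R, 0 < e -> exists d : R, 0 < d /\
    forall w, nm (w - z) < d -> nm (f w - f z) < e.
  by move=> /df; exact: derivable_continuous_nm.
have cr : 0 < c * r ^+ 2 by rewrite mulr_gt0 ?exprn_gt0.
(* The shift [d] is small enough that [S 0], of size at most [c r^2 / 20], beats the
   boundary value: there [re S - c r^2 / 8] is at least [c (7 / 16 r)^2 - c r^2 / 8],
   which is larger. *)
have e0 : 0 < c * r ^+ 2 / 20 by rewrite divr_gt0.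
have r00 : nm (0 : C) <= r by rewrite nm0 ltW.
have [d1 [d10 Hd1]] := f_cont 0 r00 _ e0; rewrite f0 in Hd1.
pose d := Num.min d1 (r / 8) / 2.
have m0 : 0 < Num.min d1 (r / 8) by rewrite lt_min d10 divr_gt0.
have [m1 m2] : Num.min d1 (r / 8) <= d1 /\ Num.min d1 (r / 8) <= r / 8.
  by split; rewrite ge_min lexx ?orbT.
have [d0 dd1 dr] : [/\ 0 < d, d < d1 & d <= r / 16] by split; rewrite /d; lra.
pose D : C := ofR d; have nD : nm D = d by rewrite nm_ofR gtr0_norm.
have D0 : D != 0 by apply/eqP => D0; move: nD; rewrite D0 nm0; lra.
pose S z := segment_mean f z (z + D); pose u z := re (S z) - c / 2 * nm z ^+ 2.
have Staylor p : nm p <= r / 2 -> exists s1 s2 : C, forall e : R, 0 < e ->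
    exists k : R, 0 < k /\ forall h, nm h < k ->
    nm (S (p + h) - S p - (s1 * h + s2 * h ^+ 2)) <= e * nm h ^+ 2.
  move=> pr; apply: (@shifted_mean_taylor f r df p D) => //; first by lra.
  by have := nmD p D; rewrite nD; lra.
have [p [pr pmin]] : exists p, nm p <= r / 2 /\ forall z, nm z <= r / 2 -> u p <= u z.
  apply: disc_minimum; first by lra.
  move=> p pr e {}e0; have [s1 [s2 H]] := Staylor p pr.
  have [k [k0 Hk]] := H 1 ltr01; have p0 := nm_ge0 p.
  pose M := nm s1 + nm s2 + 1 + c * (2 * nm p + 1).
  have n1 := nm_ge0 s1; have n2 := nm_ge0 s2.
  have cp : 0 <= c * (2 * nm p + 1) by apply: mulr_ge0; lra.
  have M0 : 0 < M by rewrite /M; lra.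
  exists (Num.min (Num.min k 1) (e / M)); rewrite !lt_min k0 ltr01 divr_gt0 //; split=> // w.
  rewrite !lt_min ltr_pdivlMr // => /andP[/andP[wk w1] wM].
  move: wk w1 wM; set h := w - p; have -> : w = p + h by rewrite addrC subrK.
  move=> hk h1 hM; have h0 := nm_ge0 h; apply: le_lt_trans hM.
  have hh : nm h ^+ 2 <= nm h by rewrite expr2 ler_piMr // ltW.
  have b1 : nm (S (p + h) - S p) <= nm h * (nm s1 + nm s2 + 1).
    have := nmD (S (p + h) - S p - (s1 * h + s2 * h ^+ 2)) (s1 * h + s2 * h ^+ 2).
    rewrite subrK; have := nmD (s1 * h) (s2 * h ^+ 2); rewrite !nmM.
    have := Hk h hk; have := ler_wpM2l n2 hh; lra.
  have b2 : `|nm (p + h) ^+ 2 - nm p ^+ 2| <= nm h * (2 * nm p + 1).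
    rewrite ler_norml; have t1 := nmD p h; have t2 := nmB (p + h) h; rewrite addrK in t2.
    by have ph0 := nm_ge0 (p + h); apply/andP; split; nra.
  have b3 : `|re (S (p + h)) - re (S p)| <= nm (S (p + h) - S p).
    by rewrite -reB ler_norml re_ge_nm re_le_nm.
  rewrite /u (_ : _ - _ = (re (S (p + h)) - re (S p)) - c / 2 * (nm (p + h) ^+ 2 - nm p ^+ 2)); last by ring.
  apply: le_trans (ler_normB _ _) _; rewrite normrM (ger0_norm (_ : 0 <= c / 2)); last by lra.
  have c2 : 0 <= c / 2 by lra.
  have := ler_wpM2l c2 b2; rewrite /M; have : 0 <= c / 2 * (nm h * (2 * nm p + 1)).
    by rewrite mulr_ge0 // mulr_ge0 //; lra.
  by lra.
have u0 : u 0 <= c * r ^+ 2 / 20.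
  rewrite /u /S nm0 expr0n mulr0 subr0; apply: le_trans (re_le_nm _) _.
  have := @segment_mean_affine _ f r f_cont (fun w => nm w <= d) 0 0 (c * r ^+ 2 / 20) 0 (0 + D).
  rewrite mul0r addr0 subr0; apply=> //; rewrite ?add0r ?nm0 ?nD ?(ltW d0) //; first by lra.
    exact: ball0_midpoint_convex.
  by move=> w wd; rewrite mul0r addr0 subr0 -(subr0 (f w)); apply/ltW/Hd1; rewrite subr0; lra.
have pr' : nm p < r / 2.
  rewrite lt_neqAle pr andbT; apply/eqP => pE.
  have : c * (r / 2 - d) ^+ 2 <= re (S p).
    apply: (segment_mean_re_ge f_cont (S := fun w => nm (w - p) <= d)); first by lra.
    - by have := nmD p D; lra.
    - exact: ball_midpoint_convex.
    - by rewrite subrr nm0 ltW.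
    - by rewrite [p + D]addrC addrK nD.
    move=> w wp; have t1 := nm_tri w p 0; rewrite !subr0 (nm_sym p w) in t1.
    have t2 := nmD (w - p) p; rewrite subrK in t2.
    apply: le_trans (fc w _); last by lra.
    by rewrite ler_wpM2l ?(ltW c0) // ler_sqr ?nnegrE ?nm_ge0 //; lra.
  have := pmin 0; rewrite nm0 => /(_ (ltW (divr_gt0 r0 (ltr0n _ 2)))); rewrite /u in u0 *.
  rewrite pE; have rd : 7 / 16 * r <= r / 2 - d by lra.
  have : (7 / 16 * r) ^+ 2 <= (r / 2 - d) ^+ 2 by rewrite ler_sqr ?nnegrE //; lra.
  by move=> /(ler_wpM2l (ltW c0)); lra.
have [s1 [s2 Hs]] := Staylor p pr.
have c2 : 0 < c / 2 by lra.
have d2 : 0 < r / 2 - nm p by lra.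
apply: (@no_interior_minimum S p s1 s2 _ _ c2 d2 Hs) => h hr.
by apply: pmin; have := nmD p h; lra.
Qed.

End MaximumPrinciple.

(** * The maximum principle and the Schwarz lemma *)

Section CauchyEstimates.
Variable R : realType.
Local Notation C := (Cfield R).

Lemma has_deriv_derivable (f : C -> C) (z l : C) : has_deriv f z l -> derivable f z 1.
Proof.
move=> fl; apply/derivable1_diffP.
apply: (@differentiable_of_nm R C C f z ( *:%R l : {linear C -> C}) (nm l)) => [u|e /fl //].
by rewrite -nmZ.
Qed.

Lemma has_deriv_line (V : normedModType C) (f : V -> C) (x u : V) (l : C) :
  differentiable f (x + l *: u) ->
  has_deriv (fun l : C => f (x + l *: u)) l ('d f (x + l *: u) u).
Proof.
move=> df e e0; have u1 : 0 < nm u + 1 by rewrite ltr_wpDl ?nm_ge0.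
have [d [d0 Hd]] := differentiable_nm df (divr_gt0 e0 u1).
exists (d / (nm u + 1)); split; first by rewrite divr_gt0.
move=> h; rewrite ltr_pdivlMr // => hd; have h0 := nm_ge0 h; have u0 := nm_ge0 u.
have hu : nm (h *: u) <= nm h * (nm u + 1) by rewrite nmZ ler_wpM2l // lerDl.
have E : 'd f (x + l *: u) (h *: u) = 'd f (x + l *: u) u * h by rewrite linearZ /= mulrC.
have := Hd (h *: u) (le_lt_trans hu hd); rewrite E -[x + l *: u + _]addrA -scalerDl => H.
apply: le_trans H _; rewrite mulrAC ler_pdivrMr // -mulrA ler_wpM2l // ltW //.
Qed.

Lemma derivable_line (V : normedModType C) (f : V -> C) (x u : V) (l : C) :
  differentiable f (x + l *: u) -> derivable (fun l : C => f (x + l *: u)) l 1.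
Proof. by move/has_deriv_line/has_deriv_derivable. Qed.

Lemma derivable_shift (f : C -> C) (p l : C) :
  derivable f (p + l) 1 -> derivable (fun l : C => f (p + l)) l 1.
Proof.
move=> /derivable_has_deriv df; apply: (@has_deriv_derivable _ _ (derive1 f (p + l))) => e /df.
by move=> [d [d0 Hd]]; exists d; split=> // h /Hd; rewrite addrA.
Qed.

Lemma derivable_comb (f g : C -> C) (a z : C) : derivable f z 1 -> derivable g z 1 ->
  derivable (fun l => f l - a * g l) z 1.
Proof.
by move=> df dg; exact: (derivableB df (derivableM (derivable_cst a z 1) dg)).
Qed.

Definition cj (z : C) : C := (Complex (re z) (- im z) : R[i]).

(** If [f] were larger inside, then after a rotation making [a * f z1] real,
    [- re (a * f)] minus a small multiple of the squared modulus would have an interior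
    minimum [p]; recentring at [p], where the cross term of the squared modulus is the real
    part of a linear function, contradicts the minimum principle. *)
Lemma maximum_principle (f : C -> C) (r M : R) : 0 < r ->
  (forall z, nm z <= r -> derivable f z 1) ->
  (forall z, nm z = r -> nm (f z) <= M) ->
  forall z, nm z <= r -> nm (f z) <= M.
Proof.
move=> r0 df fM z1 z1r; rewrite leNgt; apply/negP; rewrite -subr_gt0.
set g := _ - M => g0.
have [a [na az1]] := unimodular_rotation (f z1).
pose e := g / 2 / r ^+ 2; have r2 : 0 < r ^+ 2 by rewrite exprn_gt0.
have e0 : 0 < e by apply: divr_gt0 => //; exact: divr_gt0.
have er : e * r ^+ 2 = g / 2 by rewrite divfK // gt_eqF.
pose u z := - re (a * f z) - e * nm z ^+ 2.
have [p [pr pmin]] : exists p, nm p <= r /\ forall z, nm z <= r -> u p <= u z.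
  apply: disc_minimum (ltW r0) _ => z zr k k0.
  have k2 : 0 < k / 2 by rewrite divr_gt0.
  have [d [d0 Hd]] := derivable_continuous_nm (df z zr) k2.
  pose D := 2 * r + 1; have D0 : 0 < D by rewrite /D; lra.
  have eD : 0 < e * D by exact: mulr_gt0.
  exists (Num.min (Num.min d 1) (k / 2 / (e * D))); rewrite !lt_min d0 ltr01 (divr_gt0 k2 eD).
  split=> // w; rewrite !lt_min => /andP[/andP[wd w1]]; rewrite (ltr_pdivlMr _ _ eD) => wD.
  have h1 := Hd w wd; have t1 := nm_tri w z 0; have t2 := nm_tri z w 0.
  rewrite !subr0 (nm_sym z w) in t1 t2; have n1 := nm_ge0 z; have n2 := nm_ge0 w.
  have wz0 := nm_ge0 (w - z).
  have h2 : `|nm w ^+ 2 - nm z ^+ 2| <= nm (w - z) * D.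
    rewrite subr_sqr normrM; apply: ler_pM => //; first by rewrite ler_norml; lra.
    by rewrite ger0_norm /D; lra.
  have h3 : `|re (a * f w) - re (a * f z)| <= nm (f w - f z).
    by rewrite -reB -mulrBr -[X in _ <= X]mul1r -na -nmM ler_norml re_ge_nm re_le_nm.
  rewrite /u (_ : _ - _ = - (re (a * f w) - re (a * f z)) - e * (nm w ^+ 2 - nm z ^+ 2)); last by ring.
  apply: le_lt_trans (ler_normB _ _) _; rewrite normrN normrM (gtr0_norm e0).
  have := ler_wpM2l (ltW e0) h2; lra.
have pr' : nm p < r.
  rewrite lt_neqAle pr andbT; apply/eqP => pE.
  have := pmin z1 z1r; rewrite /u az1 pE er.
  have := re_le_nm (a * f p); rewrite nmM na mul1r; have := fM p pE.
  have : 0 <= e * nm z1 ^+ 2 by rewrite mulr_ge0 ?sqr_ge0 // ltW.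
  by rewrite /g in g0 *; lra.
have rp : 0 < r - nm p by lra.
pose b := ofR (2 * e) * cj p.
apply: (@no_quadratic_growth R (fun l : C => a * f p - a * f (p + l) - b * l) (r - nm p) e rp e0).
- move=> z zr; have zr' : nm (p + z) <= r by have := nmD p z; lra.
  apply: (derivable_comb (f := fun l : C => a * f p - a * f (p + l)) (g := id)).
    apply: (derivable_comb (f := cst (a * f p)) (g := fun l : C => f (p + l))).
      exact: derivable_cst.
    by apply/derivable_shift/df.
  exact: derivable_id.
- by rewrite addr0 subrr mulr0 subrr.
- move=> z zr; have zr' : nm (p + z) <= r by have := nmD p z; lra.
  have := pmin _ zr'; rewrite /u !reB /b -mulrA reZ !nm_sq (reM (cj p)) reD imD.
  by rewrite -[re (cj p)]/(re p) -[im (cj p)]/(- im p); lra.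
Qed.

Lemma expr_small (x e : R) : 0 <= x -> x < 1 -> 0 < e -> exists n, x ^+ n < e.
Proof.
move=> x0 x1 e0.
have := @cvg_expr _ x; rewrite ger0_norm // => /(_ x1) /cvgrPdist_lt/(_ _ e0) [N _ HN].
exists N; have := HN N (leqnn _); rewrite /= sub0r normrN ger0_norm ?exprn_ge0 //.
Qed.

(** [z * f z ^+ n] is differentiable at [0] as soon as [f] is continuous there;
    taking [n]-th roots and letting [n] grow removes the factor [z]. *)
Lemma punctured_maximum_principle (f : C -> C) (r M : R) : 0 < r ->
  (forall z : C, z != 0 -> nm z <= r -> derivable f z 1) ->
  (forall e : R, 0 < e -> exists d : R, 0 < d /\ forall w, nm w < d -> nm (f w - f 0) < e) ->
  (forall z, nm z = r -> nm (f z) <= M) ->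
  forall z, nm z <= r -> nm (f z) <= M.
Proof.
move=> r0 df f0 fM.
have power n (z : C) : nm z <= r -> nm (z * f z ^+ n) <= r * M ^+ n.
  apply: (maximum_principle (f := fun z : C => z * f z ^+ n)) => // [w wr|w wr].
    have [->|w0] := eqVneq w 0.
      apply: (@has_deriv_derivable _ 0 (f 0 ^+ n)) => e e0.
      have dX : derivable (fun z : C => z ^+ n) (f 0) 1 by exact: exprn_derivable.
      have [k [k0 Hk]] := derivable_continuous_nm dX e0.
      have [d [d0 Hd]] := f0 k k0; exists d; split=> // h /Hd /Hk /ltW fh.
      by rewrite add0r mul0r subr0 (mulrC h) -mulrBl nmM ler_wpM2r ?nm_ge0.
    have -> : (fun z : C => z * f z ^+ n) = id * (f ^+ n) by apply/funext => y; rewrite !fctE.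
    by apply: derivableM; [exact: derivable_id|apply: derivableX; exact: df].
  by rewrite nmM nmX wr ler_wpM2l ?(ltW r0) // lerXn2r ?nnegrE ?nm_ge0 ?fM // (le_trans (nm_ge0 _) (fM w wr)).
have M0 : 0 <= M.
  by apply: le_trans (nm_ge0 _) (fM (ofR r) _); rewrite nm_ofR gtr0_norm.
have main (z : C) : z != 0 -> nm z <= r -> nm (f z) <= M.
  move=> z0 zr; rewrite leNgt; apply/negP => Mf.
  have fz0 : 0 < nm (f z) by exact: le_lt_trans Mf.
  have nz0 := nm_gt0 z0.
  have q1 : M / nm (f z) < 1 by rewrite ltr_pdivrMr // mul1r.
  have [n] := expr_small (divr_ge0 M0 (ltW fz0)) q1 (divr_gt0 nz0 r0).
  rewrite exprMn exprVn ltr_pdivrMr ?exprn_gt0 // mulrAC ltr_pdivlMr //.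
  by have := power n z zr; rewrite nmM nmX; lra.
move=> z zr; have [->|/main/(_ zr)//] := eqVneq z 0.
rewrite leNgt; apply/negP; rewrite -subr_gt0 => far.
have [d [d0 Hd]] := f0 _ far.
pose x := Num.min d r / 2; have m0 : 0 < Num.min d r by rewrite lt_min d0.
have [m1 m2] : Num.min d r <= d /\ Num.min d r <= r by rewrite !ge_min !lexx orbT.
have nx : nm (ofR x) = x by rewrite nm_ofR ger0_norm // /x; lra.
have xz : ofR x != 0 by apply/eqP => x0; move: nx; rewrite x0 nm0 /x; lra.
have := main _ xz; rewrite nx => /(_ _)/wrap[]; first by rewrite /x; lra.
have := Hd (ofR x); rewrite nx => /(_ _)/wrap[]; first by rewrite /x; lra.
by rewrite nm_sym; have := nmD (f 0 - f (ofR x)) (f (ofR x)); rewrite subrK; lra.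
Qed.

Lemma derivable_quotient (f : C -> C) (c z : C) : z != 0 -> derivable f z 1 ->
  derivable (fun w => (f w - c) / w) z 1.
Proof.
move=> z0 df; apply: (@derivableM C C (fun w => f w - c) (fun w => w^-1)).
  exact: (derivableB df (derivable_cst c z 1)).
by apply: (@derivableV C C id); [exact: z0|exact: derivable_id].
Qed.

(** The quotient [(f z - f 0) / z], continued by [l], is continuous at [0] and
    differentiable elsewhere, so the maximum principle with a puncture bounds it by its
    values on the circle; its value [l] at [0] gives the Cauchy estimate. *)
Lemma schwarz (f : C -> C) (r M : R) (l : C) : 0 < r ->
  (forall z, nm z <= r -> derivable f z 1) ->
  (forall z, nm z <= r -> nm (f z) <= M) -> has_deriv f 0 l ->
  nm l <= 2 * M / r /\ forall z, nm z <= r -> nm (f z - f 0) <= 2 * M / r * nm z.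
Proof.
move=> r0 df fM fl.
pose K (z : C) := if z == 0 then l else (f z - f 0) / z.
have KM z : nm z <= r -> nm (K z) <= 2 * M / r.
  apply: (@punctured_maximum_principle K r (2 * M / r) r0) => [w w0 wr|e e0|w wr].
  - apply/derivable1_diffP.
    apply: (@near_differentiable _ _ (fun z => (f z - f 0) / z) K).
      apply/(@nbhs_nmP R C w); exists (nm w); split; first exact: nm_gt0.
      move=> y yw; rewrite /K ifF //; apply/eqP => y0.
      by move: yw; rewrite y0 sub0r nmN ltxx.
    by apply/derivable1_diffP/derivable_quotient => //; exact: df.
  - have e2 : 0 < e / 2 by rewrite divr_gt0.
    have [d [d0 Hd]] := fl _ e2; exists d; split=> // w wd.
    rewrite {2}/K eqxx /K; have [_|w0] := eqVneq w 0; first by rewrite subrr nm0.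
    have nw := nm_gt0 w0; have := Hd w wd; rewrite add0r.
    rewrite (_ : (f w - f 0) / w - l = (f w - f 0 - l * w) / w); last by field.
    by rewrite nmM nmV -ler_pdivrMr // => h; apply: le_lt_trans h _; lra.
  - have w0 : w != 0 by apply/eqP => w0; move: wr r0; rewrite w0 nm0 => ->; rewrite ltxx.
    have r00 : nm (0 : C) <= r by rewrite nm0 ltW.
    rewrite /K (negbTE w0) nmM nmV wr ler_pM2r ?invr_gt0 //.
    by have := nmB (f w) (f 0); have := fM w; have := fM 0 r00; rewrite wr lexx => ? /(_ erefl); lra.
split; first by have := KM 0; rewrite /K eqxx nm0; apply; exact: ltW.
move=> z zr; have [->|z0] := eqVneq z 0; first by rewrite subrr !nm0 mulr0.
have := KM z zr; rewrite /K (negbTE z0) nmM nmV ler_pdivrMr ?nm_gt0 //.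
Qed.

Lemma schwarz_at (f : C -> C) (p : C) (r M : R) : 0 < r ->
  (forall z, nm (z - p) <= r -> derivable f z 1) ->
  (forall z, nm (z - p) <= r -> nm (f z) <= M) ->
  forall z, nm z <= r -> nm (f (p + z) - f p) <= 2 * M / r * nm z.
Proof.
move=> r0 df fM.
have inp z : nm z <= r -> nm (p + z - p) <= r by rewrite [p + z]addrC addrK.
have dg z : nm z <= r -> derivable (fun z : C => f (p + z)) z 1.
  by move=> zr; apply/derivable_shift/df/inp.
have r00 : nm (0 : C) <= r by rewrite nm0 ltW.
have [|_] := @schwarz (fun z => f (p + z)) r M _ r0 dg _ (derivable_has_deriv (dg 0 r00)).
  by move=> z zr; apply/fM/inp.
by rewrite addr0.
Qed.

Lemma nm_nat n : nm (n%:R : C) = n%:R.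
Proof. by rewrite -ofR_nat nm_ofR ger0_norm. Qed.

(** Iterating the hypothesis bounds [g z] by [2 ^ n * g (z / 2 ^ n)], which
    vanishes in the limit, plus a geometric series. *)
Lemma halving_estimate (g : C -> C) (rho B : R) (k : nat) : (2 <= k)%N -> 0 <= B ->
  g 0 = 0 -> has_deriv g 0 0 ->
  (forall z, nm z <= rho -> nm (g z) <= 2 * nm (g (z / 2)) + B * nm z ^+ k) ->
  forall z, nm z <= rho -> nm (g z) <= 2 * B * nm z ^+ k.
Proof.
move=> k2 B0 g0 dg half.
have iter n (z : C) : nm z <= rho ->
    nm (g z) <= 2 ^+ n * nm (g (z / 2 ^+ n)) + 2 * B * nm z ^+ k.
  elim: n z => [|n IH] z zr.
    by rewrite !expr0 divr1 mul1r lerDl mulr_ge0 ?exprn_ge0 ?nm_ge0 // mulr_ge0.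
  have zr2 : nm (z / 2) <= rho by rewrite nm_half; have := nm_ge0 z; lra.
  have zE : z / 2 ^+ n.+1 = z / 2 / 2 ^+ n by rewrite exprS invfM mulrA.
  have pE : 2 ^+ n.+1 = 2 * 2 ^+ n :> R by rewrite exprS.
  have z0 : 0 <= nm z ^+ k by rewrite exprn_ge0 ?nm_ge0.
  have zk : nm (z / 2) ^+ k <= nm z ^+ k / 4.
    rewrite nm_half exprMn exprVn ler_wpM2l // lef_pV2 ?posrE ?exprn_gt0 //.
    rewrite (_ : 4 = 2 ^+ 2 :> R); last by rewrite -natrX.
    by rewrite ler_eXn2l // ltr1n.
  have := IH _ zr2; have := half z zr; rewrite zE pE => h1 h2.
  by have := ler_wpM2l B0 zk; lra.
move=> z zr; apply/ler_addgt0Pr => e e0; have z0 := nm_ge0 z.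
have z1 : 0 < nm z + 1 by rewrite ltr_wpDl.
have [d [d0 Hd]] := dg _ (divr_gt0 e0 z1).
have [n nd] := halving_small (nm z) d0.
have n2 : nm (2 ^+ n : C) = 2 ^+ n by rewrite nmX nm_nat.
have := Hd (z / 2 ^+ n); rewrite add0r g0 subr0 mul0r subr0 nmM nmV n2 => /(_ nd) h.
apply: le_trans (iter n z zr) _; rewrite addrC lerD //.
have p2 : 0 < 2 ^+ n :> R by rewrite exprn_gt0.
rewrite -ler_pdivlMl // [_^-1 * e]mulrC; apply: le_trans h _.
rewrite mulrA ler_pM2r ?invr_gt0 // mulrAC ler_pdivrMr // ler_wpM2l ?(ltW e0) //.
by rewrite lerDl.
Qed.

(** The difference quotients [w |-> (f (w + z) - f w) / z] are bounded by the
    Schwarz lemma, hence Lipschitz by the Schwarz lemma again. This bounds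
    [f (2 z) - 2 f z + f 0] quadratically, and halving repeatedly bounds the
    remainder of the first order expansion. *)
Lemma second_order_bound (f : C -> C) (r M : R) (l : C) : 0 < r ->
  (forall z, nm z <= r -> derivable f z 1) ->
  (forall z, nm z <= r -> nm (f z) <= M) -> has_deriv f 0 l ->
  forall z, nm z <= r / 2 -> nm (f z - f 0 - l * z) <= 8 * M / r ^+ 2 * nm z ^+ 2.
Proof.
move=> r0 df fM fl.
have r00 : nm (0 : C) <= r by rewrite nm0 ltW.
have M0 : 0 <= M by exact: le_trans (nm_ge0 _) (fM 0 r00).
pose B := 4 * M / r ^+ 2; have r2 : 0 < r ^+ 2 by rewrite exprn_gt0.
have B0 : 0 <= B by rewrite divr_ge0 ?mulr_ge0 // ltW.
have second (z : C) : nm z <= r / 4 -> nm (f (z + z) - 2 * f z + f 0) <= 4 * B * nm z ^+ 2.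
  move=> zr; have [->|z0] := eqVneq z 0.
    by rewrite addr0 (_ : _ + _ = 0); [rewrite nm0 expr0n mulr0|ring].
  have nz := nm_gt0 z0; have rh : 0 < r / 2 by rewrite divr_gt0.
  pose phi (w : C) := (f (w + z) - f w) / z.
  have phi_bound w : nm w <= r / 2 -> nm (phi w) <= 4 * M / r.
    move=> wr; rewrite /phi nmM nmV ler_pdivrMr //.
    have zr2 : nm z <= r / 2 by lra.
    have := @schwarz_at f w (r / 2) M rh _ _ z zr2.
    rewrite (_ : 2 * M / (r / 2) = 4 * M / r); last by field; rewrite gt_eqF.
    by apply=> y yw; [apply: df|apply: fM]; have := nmD (y - w) w; rewrite subrK; lra.
  have dphi w : nm w <= r / 2 -> derivable phi w 1.
    move=> wr.
    apply: (@derivableM C C (fun w => f (w + z) - f w) (cst z^-1)); last exact: derivable_cst.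
    have w1 : nm w <= r by lra.
    have w2 : nm (w + z) <= r by have := nmD w z; lra.
    apply: (@derivableB C C C (fun w => f (w + z)) f); last exact: df.
    have := @derivable_shift f z w; rewrite addrC => /(_ (df _ w2)).
    by under eq_fun do rewrite addrC.
  have r02 : nm (0 : C) <= r / 2 by rewrite nm0 ltW.
  have [_ lip] := schwarz rh dphi phi_bound (derivable_has_deriv (dphi 0 r02)).
  have zr2 : nm z <= r / 2 by lra.
  have := lip z zr2.
  rewrite /phi add0r (_ : _ - _ = (f (z + z) - 2 * f z + f 0) / z); last by field.
  rewrite nmM nmV ler_pdivrMr // => h; apply: le_trans h _.
  rewrite le_eqVlt; apply/orP; left; apply/eqP; rewrite /B; field; rewrite gt_eqF //.
pose g (z : C) := f z - f 0 - l * z.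
have half (z : C) : nm z <= r / 2 -> nm (g z) <= 2 * nm (g (z / 2)) + B * nm z ^+ 2.
  move=> zr; have zr4 : nm (z / 2) <= r / 4 by rewrite nm_half; lra.
  have := second _ zr4; rewrite nm_half (_ : z / 2 + z / 2 = z); last by field.
  have -> : g z = 2 * g (z / 2) + (f z - 2 * f (z / 2) + f 0) by rewrite /g; field.
  have := nmD (2 * g (z / 2)) (f z - 2 * f (z / 2) + f 0).
  by rewrite nmM nm_nat; lra.
have -> : 8 * M / r ^+ 2 = 2 * B by rewrite /B; field; rewrite gt_eqF.
apply: (halving_estimate (g := g)) => //; first by rewrite /g subrr mulr0 subr0.
move=> e /fl [d [d0 Hd]]; exists d; split=> // h /Hd.
by rewrite /g !add0r (_ : _ - _ - 0 * h = f h - f 0 - l * h) //; ring.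
Qed.

End CauchyEstimates.

(** * Differentials and difference quotients in several variables *)

Section SeveralVariables.
Variable R : realType.
Local Notation C := (Cfield R).

Lemma nm_pair (V W : normedModType C) (v : V) (w : W) :
  nm (v, w) = Num.max (nm v) (nm w).
Proof.
apply: (@ofR_inj R); rewrite ofR_nm [LHS]prod_normE /= -(ofR_nm v) -(ofR_nm w).
by rewrite /Order.max lt_ofR; case: ifP.
Qed.

(** Restriction to the complex line through [x] in the direction [u], rescaled to
    radius [r / nm u]. No coordinates are used, so [V] may be any normed space. *)
Lemma cauchy_estimates (V : normedModType C) (f : V -> C) (x : V) (r M : R) : 0 < r ->
  (forall y, nm (y - x) <= r -> differentiable f y) ->
  (forall y, nm (y - x) <= r -> nm (f y) <= M) -> forall u,
  [/\ nm ('d f x u) <= 2 * M / r * nm u,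
      nm u <= r -> nm (f (x + u) - f x) <= 2 * M / r * nm u &
      nm u <= r / 2 -> nm (f (x + u) - f x - 'd f x u) <= 8 * M / r ^+ 2 * nm u ^+ 2].
Proof.
move=> r0 df fM u.
have [->|u0] := eqVneq u 0.
  by rewrite addr0 subrr linear0 subr0 !nm0 expr0n !mulr0.
have nu := nm_gt0 u0.
pose phi (l : C) := f (x + l *: u); pose rho := r / nm u.
have rho0 : 0 < rho by exact: divr_gt0.
have inp (l : C) : nm l <= rho -> nm (x + l *: u - x) <= r.
  by rewrite [x + _]addrC addrK nmZ /rho ler_pdivlMr.
have dphi (l : C) : nm l <= rho -> derivable phi l 1.
  by move=> lr; apply: derivable_line; apply/df/inp.
have phiM (l : C) : nm l <= rho -> nm (phi l) <= M by move=> lr; apply/fM/inp.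
have d0 : has_deriv phi 0 ('d f x u).
  have := @has_deriv_line R V f x u 0; rewrite scale0r addr0; apply.
  by apply: df; rewrite subrr nm0 ltW.
have [s1 s2] := schwarz rho0 dphi phiM d0.
have E : 2 * M / rho = 2 * M / r * nm u by rewrite /rho; field; rewrite !gt_eqF.
rewrite E in s1 s2; split => // ur.
  have := s2 1; rewrite nm1 /phi scale1r scale0r addr0 mulr1; apply.
  by rewrite /rho ler_pdivlMr // mul1r.
have := @second_order_bound R phi rho M _ rho0 dphi phiM d0 1.
rewrite nm1 /phi scale1r scale0r addr0 mulr1 expr1n mulr1 (_ : 8 * M / rho ^+ 2 = 8 * M / r ^+ 2 * nm u ^+ 2).
  by apply; rewrite /rho; rewrite ler_pdivlMr // ler_pdivlMr //; lra.
by rewrite /rho; field; rewrite !gt_eqF.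
Qed.

Section DifferenceQuotient.
Variables (V : normedModType C) (f : V -> C) (x e : V) (r M : R).
Hypotheses (r0 : 0 < r) (e1 : nm e <= 1).
Hypothesis f_diff : forall y, nm (y - x) <= 4 * r -> differentiable f y.
Hypothesis f_bound : forall y, nm (y - x) <= 4 * r -> nm (f y) <= M.

Definition diff_quot (d : C) (y : V) : C :=
  if d == 0 then 'd f y e else (f (y + d *: e) - f y) / d.

Let M0 : 0 <= M.
Proof.
by apply: le_trans (nm_ge0 _) (f_bound (y := x) _); rewrite subrr nm0 mulr_ge0 // ltW.
Qed.

Let nm_de (d : C) : nm (d *: e) <= nm d.
Proof. by rewrite nmZ ler_piMr ?nm_ge0. Qed.

Let near2 y z : nm (y - x) <= 2 * r -> nm (z - y) <= 2 * r -> nm (z - x) <= 4 * r.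
Proof. by move=> ? ?; have := nm_tri y z x; lra. Qed.

Let r20 : 0 < 2 * r. Proof. by rewrite mulr_gt0. Qed.

Lemma diff_quot_bound d y : nm d <= r -> nm (y - x) <= 2 * r ->
  nm (diff_quot d y) <= M / r.
Proof.
move=> dr yr.
have [h1 h2 _] := cauchy_estimates r20 (fun z hz => f_diff (near2 yr hz))
   (fun z hz => f_bound (near2 yr hz)) (if d == 0 then e else d *: e).
have E : 2 * M / (2 * r) = M / r by field; rewrite gt_eqF.
have Mr : 0 <= M / r by rewrite divr_ge0 // ltW.
rewrite /diff_quot E in h1 h2 *; case: (eqVneq d 0) h1 h2 => [_|d0] h1 h2.
  by apply: le_trans h1 _; rewrite ler_piMr.
have nd := nm_gt0 d0; rewrite nmM nmV ler_pdivrMr //.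
apply: le_trans (h2 _) _; first by have := nm_de d; lra.
by rewrite ler_wpM2l.
Qed.

Lemma diff_quot_cvg d y : nm d <= r -> nm (y - x) <= 2 * r ->
  nm (diff_quot d y - diff_quot 0 y) <= 2 * M / r ^+ 2 * nm d.
Proof.
move=> dr yr; rewrite /diff_quot eqxx; have [->|d0] := eqVneq d 0.
  by rewrite subrr !nm0 mulr0.
have [_ _ h] := cauchy_estimates r20 (fun z hz => f_diff (near2 yr hz))
   (fun z hz => f_bound (near2 yr hz)) (d *: e).
have nd := nm_gt0 d0.
rewrite (_ : _ / d - _ = (f (y + d *: e) - f y - 'd f y (d *: e)) / d); last first.
  by rewrite (_ : 'd f y (d *: e) = d * 'd f y e); [field|rewrite linearZ].
rewrite nmM nmV ler_pdivrMr //; apply: le_trans (h _) _; first by have := nm_de d; lra.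
rewrite (_ : 8 * M / (2 * r) ^+ 2 = 2 * M / r ^+ 2); last by field; rewrite gt_eqF.
rewrite -[X in _ <= X]mulrA -expr2 ler_wpM2l ?divr_ge0 ?mulr_ge0 ?exprn_ge0 // ?(ltW r0) //.
by rewrite ler_sqr ?nnegrE ?nm_ge0.
Qed.

Lemma diff_quot_differentiable d y : d != 0 -> nm d <= r -> nm (y - x) <= 2 * r ->
  differentiable (diff_quot d) y.
Proof.
move=> d0 dr yr.
have -> : diff_quot d = (fun z => (f (z + d *: e) - f z) * d^-1).
  by apply/funext => z; rewrite /diff_quot (negbTE d0).
apply: (@differentiableM _ _ (fun z => f (z + d *: e) - f z) (cst d^-1)); last exact: differentiable_cst.
have h1 : nm (y + d *: e - y) <= 2 * r.
  by rewrite [y + _]addrC addrK; have := nm_de d; have := r0; lra.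
have h2 : nm (y - y) <= 2 * r by rewrite subrr nm0 ltW.
apply: (@differentiableB _ _ _ (fun z => f (z + d *: e)) f); last exact: f_diff (near2 yr h2).
apply: (@differentiable_comp _ _ _ _ (fun z => z + d *: e) f).
  by apply: (@differentiableD _ _ _ id (cst (d *: e))); [exact: ex_diff|exact: differentiable_cst].
exact: f_diff (near2 yr h1).
Qed.

Lemma diff_quot_taylor d u : d != 0 -> nm d <= r -> nm u <= r ->
  nm (diff_quot d (x + u) - diff_quot d x - 'd (diff_quot d) x u) <= 2 * M / r ^+ 3 * nm u ^+ 2.
Proof.
move=> d0 dr ur.
have [_ _ h] := cauchy_estimates r20 (fun z => diff_quot_differentiable d0 dr)
   (fun z => diff_quot_bound dr) u.
have := h _; rewrite (_ : 8 * (M / r) / (2 * r) ^+ 2 = 2 * M / r ^+ 3); last by field; rewrite gt_eqF.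
by apply; lra.
Qed.

(** The difference of two difference quotients is small and holomorphic, so its
    differential is small by the Cauchy estimate. *)
Lemma diff_quot_diff_cauchy d d' u : d != 0 -> d' != 0 -> nm d <= r -> nm d' <= r ->
  nm ('d (diff_quot d) x u - 'd (diff_quot d') x u) <= 2 * M / r ^+ 3 * (nm d + nm d') * nm u.
Proof.
move=> d0 d'0 dr d'r.
have dq y : nm (y - x) <= 2 * r -> differentiable (diff_quot d - diff_quot d') y.
  move=> yr; apply: (@differentiableB _ _ _ (diff_quot d) (diff_quot d')).
    exact: diff_quot_differentiable.
  exact: diff_quot_differentiable.
have x2 : nm (x - x) <= 2 * r by rewrite subrr nm0 ltW.
have bq y : nm (y - x) <= 2 * r ->
    nm ((diff_quot d - diff_quot d') y) <= 2 * M / r ^+ 2 * (nm d + nm d').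
  move=> yr; rewrite -[(_ - _) y]/(diff_quot d y - diff_quot d' y) mulrDr.
  apply: le_trans (nm_tri (diff_quot 0 y) _ _) _; rewrite lerD ?diff_quot_cvg //.
  by rewrite nm_sym diff_quot_cvg.
have [h _ _] := cauchy_estimates r20 dq bq u.
have E : 'd (diff_quot d - diff_quot d') x u = 'd (diff_quot d) x u - 'd (diff_quot d') x u.
  exact: (congr1 (fun g : V -> C => g u)
    (diffB (diff_quot_differentiable d0 dr x2) (diff_quot_differentiable d'0 d'r x2))).
rewrite E in h; apply: le_trans h _; rewrite le_eqVlt; apply/orP; left; apply/eqP.
by field; rewrite gt_eqF.
Qed.

Let step n : C := ofR (r / 2 ^+ n).

Let nm_step n : nm (step n) = r / 2 ^+ n.
Proof. by rewrite nm_ofR ger0_norm // divr_ge0 ?exprn_ge0 // ltW. Qed.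

Let step_neq0 n : step n != 0.
Proof.
apply/eqP => s0; have := nm_step n; rewrite s0 nm0 => /esym/eqP.
by rewrite gt_eqF // divr_gt0 // exprn_gt0.
Qed.

Let step_le n N : (N <= n)%N -> nm (step n) <= r / 2 ^+ N.
Proof.
by move=> Nn; rewrite nm_step ler_pM2l // lef_pV2 ?posrE ?exprn_gt0 // ler_eXn2l // ltr1n.
Qed.

Let step_r n : nm (step n) <= r.
Proof. by have := step_le (leq0n n); rewrite expr0 divr1. Qed.

Let step_small (B e0 : R) : 0 <= B -> 0 < e0 ->
  exists N, forall n, (N <= n)%N -> B * nm (step n) <= e0.
Proof.
move=> B0 e00; have [N HN] := halving_small (B * r) e00; exists N => n /step_le h.
by apply: le_trans (ler_wpM2l B0 h) _; rewrite mulrA ltW.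
Qed.

(** The differentials at [x] of the difference quotients converge, and the limit
    [L] is the differential of the partial derivative ['d f _ e]. The joint
    expansion in the increment and in the point is what the division by a
    coordinate needs. *)
Lemma diff_quot_expansion : exists (L : {linear V -> C}) (k : C) (K : R),
  (forall u, nm (L u) <= K * nm u) /\
  forall d u, nm d <= r -> nm u <= r ->
    nm (diff_quot d (x + u) - diff_quot 0 x - L u - k * d) <= K * (nm u + nm d) ^+ 2.
Proof.
(* From here on the differentials of the difference quotients matter only through a
   few estimates with a common constant [A]. *)
have [A [D [K0 [A0 [Dlin [DZ [DK0 [Dc Dt]]]]]]]] : exists (A : R) (D : C -> V -> C) (K0 : R),
    0 <= A /\ (forall d a u v, D d (a *: u + v) = a * D d u + D d v) /\
    (forall d a u, D d (a *: u) = a * D d u) /\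
    (forall u, nm (D (step 0) u) <= K0 * nm u) /\
    (forall d d' u, d != 0 -> d' != 0 -> nm d <= r -> nm d' <= r ->
       nm (D d u - D d' u) <= A * (nm d + nm d') * nm u) /\
    (forall d u, d != 0 -> nm d <= r -> nm u <= r ->
       nm (diff_quot d (x + u) - diff_quot d x - D d u) <= A * nm u ^+ 2).
  exists (2 * M / r ^+ 3), (fun d u => 'd (diff_quot d) x u), (2 * (M / r) / (2 * r)).
  split; first by rewrite divr_ge0 ?exprn_ge0 ?(ltW r0) // mulr_ge0.
  split; first by move=> d a u v; rewrite linearP.
  split; first by move=> d a u; rewrite linearZ.
  split; last by split; [exact: diff_quot_diff_cauchy|exact: diff_quot_taylor].
  move=> u; have [h _ _] := cauchy_estimates r20
    (fun z => diff_quot_differentiable (step_neq0 0) (step_r 0))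
    (fun z => diff_quot_bound (step_r 0)) u.
  exact: h.
have [L0 L0P] : exists L0 : V -> C, forall u, tends (fun n => D (step n) u) (L0 u).
  have cv u : exists l, tends (fun n => D (step n) u) l.
    apply: cauchy_tends => e0 e00.
    have [N HN] := step_small (mulr_ge0 A0 (nm_ge0 u)) (divr_gt0 e00 (ltr0n _ 2)).
    exists N => n m /HN h1 /HN h2.
    have := Dc _ _ u (step_neq0 n) (step_neq0 m) (step_r n) (step_r m); lra.
  by have [L0 HL] := choice cv; exists L0.
have L0lin : linear L0.
  move=> a u v; apply: tends_unique (L0P _) _.
  have -> : (fun n => D (step n) (a *: u + v)) = (fun n => a * D (step n) u + D (step n) v).
    by apply/funext => n; rewrite Dlin.
  by apply: tendsD; [apply: tendsZ|].
have DL d u : d != 0 -> nm d <= r -> nm (D d u - L0 u) <= A * nm d * nm u.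
  move=> d0 dr; apply/ler_addgt0Pr => e0 e00.
  have e20 : 0 < e0 / 2 by rewrite divr_gt0.
  have [N HN] := step_small (mulr_ge0 A0 (nm_ge0 u)) e20.
  have [N' HN'] := L0P u _ e20.
  have := HN (maxn N N') (leq_maxl _ _); have := HN' (maxn N N') (leq_maxr _ _).
  move: (maxn N N') => n h1 h2.
  have := Dc d (step n) u d0 (step_neq0 n) dr (step_r n).
  by have := nm_tri (D (step n) u) (D d u) (L0 u); lra.
have L0K u : nm (L0 u) <= (K0 + A * r) * nm u.
  have := DL (step 0) u (step_neq0 0) (step_r 0); have := DK0 u.
  have := nmB (D (step 0) u) (D (step 0) u - L0 u); rewrite subKr.
  by rewrite nm_step expr0 divr1; lra.
have [k kE] : exists k, k = L0 e / 2 by exists (L0 e / 2).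
(* At the point [x] itself, a third order remainder [g] of [f] along [e] satisfies the
   hypothesis of the halving estimate; the coefficient [k] is half of the second
   derivative. *)
have base d : nm d <= r -> nm (diff_quot d x - diff_quot 0 x - k * d) <= A / 2 * nm d ^+ 2.
  move=> dr; have [->|d0] := eqVneq d 0.
    by rewrite subrr mulr0 subr0 !nm0 expr0n mulr0.
  pose g (z : C) := f (x + z *: e) - f x - 'd f x e * z - k * z ^+ 2.
  have xin : nm (x - x) <= 4 * r by rewrite subrr nm0 mulr_ge0 // ltW.
  have g0 : g 0 = 0 by rewrite /g scale0r addr0; ring.
  have dg : has_deriv g 0 0.
    move=> e0 e00; have e20 : 0 < e0 / 2 by rewrite divr_gt0.
    have df0 : differentiable f (x + 0 *: e) by rewrite scale0r addr0; exact: f_diff.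
    have [d' [d'0 Hd']] := has_deriv_line df0 e20; rewrite !scale0r !addr0 in Hd'.
    have k0 : 0 < nm k + 1 by rewrite ltr_wpDl ?nm_ge0.
    exists (Num.min d' (e0 / 2 / (nm k + 1))); rewrite lt_min d'0 divr_gt0 //; split=> // h.
    rewrite lt_min ltr_pdivlMr // => /andP[/Hd' h1 h2].
    rewrite g0 !add0r mul0r !subr0 /g.
    have := nmB (f (x + h *: e) - f x - 'd f x e * h) (k * h ^+ 2).
    rewrite !nmM; rewrite add0r in h1; have h0 := nm_ge0 h; have nk := nm_ge0 k.
    have : nm k * (nm h * nm h) <= e0 / 2 * nm h.
      rewrite mulrA ler_wpM2r //; apply: le_trans (ltW h2); rewrite mulrC ler_wpM2l //.
      by rewrite lerDl.
    by lra.
  have A40 : 0 <= A / 4 by rewrite divr_ge0.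
  have := halving_estimate (g := g) (rho := r) (k := 3) isT A40 g0 dg _ dr.
  have gE : g d = d * (diff_quot d x - diff_quot 0 x - k * d).
    by rewrite /g /diff_quot eqxx (negbTE d0); field.
  have nd := nm_gt0 d0; rewrite gE nmM => H.
  rewrite -(ler_pM2l nd); apply: le_trans (H _) _; last first.
    by rewrite le_eqVlt; apply/orP; left; apply/eqP; field.
  move=> z zr; have [y yE] : exists y, y = z / 2 by exists (z / 2).
  have zE : z = y + y by rewrite yE; field.
  rewrite -yE.
  have [y0|y0] := eqVneq y 0.
    have z0 : z = 0 by rewrite zE y0 addr0.
    by rewrite z0 y0 g0 nm0 expr0n !mulr0 addr0.
  have ny := nm_gt0 y0; have nyE : nm y = nm z / 2 by rewrite yE nm_half.
  have yr : nm y <= r by lra.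
  have yer : nm (y *: e) <= r by apply: le_trans (nm_de _) _.
  have t1 := Dt _ _ y0 yr yer; have t2 := DL _ e y0 yr.
  have E : g z = 2 * g y + (y * (diff_quot y (x + y *: e) - diff_quot y x - D y (y *: e)) +
      y ^+ 2 * (D y e - L0 e)).
    rewrite DZ /diff_quot (negbTE y0) /g -[x + y *: e + _]addrA -scalerDl {1 2 3}zE kE; field; exact: y0.
  rewrite E; apply: le_trans (nmD _ _) _; rewrite nmM nm_nat lerD2l.
  apply: le_trans (nmD _ _) _; rewrite !nmM.
  have t3 : nm (y *: e) ^+ 2 <= nm y ^+ 2 by rewrite ler_sqr ?nnegrE ?nm_ge0.
  have t4 := ler_wpM2l A0 t3.
  have t5 : nm (D y e - L0 e) <= A * nm y.
    by apply: le_trans t2 _; rewrite ler_piMr // mulr_ge0 // ltW.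
  have t6 := ler_wpM2l (ltW ny) (le_trans t1 t4).
  have y20 : 0 <= nm y * nm y by rewrite mulr_ge0 // ltW.
  have t7 := ler_wpM2l y20 t5.
  by move: t6 t7; rewrite nyE; lra.
have main d u : d != 0 -> nm d <= r -> nm u <= r ->
    nm (diff_quot d (x + u) - diff_quot 0 x - L0 u - k * d) <= A * (nm u + nm d) ^+ 2.
  move=> d0 dr ur.
  have := nmD (diff_quot d (x + u) - diff_quot d x - D d u)
     ((D d u - L0 u) + (diff_quot d x - diff_quot 0 x - k * d)).
  have := nmD (D d u - L0 u) (diff_quot d x - diff_quot 0 x - k * d).
  rewrite (_ : _ - D d u + (_ + _) = diff_quot d (x + u) - diff_quot 0 x - L0 u - k * d); last by ring.
  have := Dt d u d0 dr ur; have := DL d u d0 dr; have := base d dr.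
  have : 0 <= A * (nm d * nm u) by rewrite mulr_ge0 // mulr_ge0 ?nm_ge0.
  have : 0 <= A * nm d ^+ 2 by rewrite mulr_ge0 // sqr_ge0.
  by lra.
have Lm : exists L : {linear V -> C}, forall u, L u = L0 u.
  pose L : {linear V -> C} := HB.pack L0 (GRing.isLinear.Build C V C _ L0 L0lin).
  by exists L.
have [L LE] := Lm; exists L, k, (Num.max (K0 + A * r) A); split.
  move=> u; rewrite LE; apply: le_trans (L0K u) _.
  by rewrite ler_wpM2r ?nm_ge0 // le_max lexx.
move=> d u dr ur; rewrite LE.
apply: (@le_trans _ _ (A * (nm u + nm d) ^+ 2)); last first.
  by rewrite ler_wpM2r ?sqr_ge0 // le_max lexx orbT.
(* For [d = 0] the estimate is the limit of the estimates for small nonzero steps. *)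
have [->|d0] := eqVneq d 0; last exact: main.
apply/ler_addgt0Pr => e0 e00.
have Mr : 0 <= 2 * M / r ^+ 2 by rewrite divr_ge0 ?exprn_ge0 ?(ltW r0) // mulr_ge0.
have B0 : 0 <= A * (3 * r) + 2 * M / r ^+ 2 + nm k.
  by rewrite !addr_ge0 ?nm_ge0 // mulr_ge0 // mulr_ge0 // ltW.
have [N HN] := step_small B0 e00; have {HN} := HN N (leqnn _).
have := main _ _ (step_neq0 N) (step_r N) ur.
have xu : nm (x + u - x) <= 2 * r.
  by rewrite [x + u]addrC addrK; apply: le_trans ur _; have := r0; lra.
have := diff_quot_cvg (step_r N) xu; move: (step_r N).
move: (step N) => s sr h1 h2 h3; rewrite mulr0 subr0 nm0 addr0.
have s0 := nm_ge0 s; have u0 := nm_ge0 u.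
have t1 : A * (nm u + nm s) ^+ 2 <= A * nm u ^+ 2 + A * (3 * r) * nm s.
  rewrite -[X in _ <= _ + X]mulrA -mulrDr ler_wpM2l //.
  by have : nm s * (2 * nm u + nm s) <= nm s * (3 * r); [rewrite ler_wpM2l //; lra|lra].
have := nmB (diff_quot s (x + u) - diff_quot 0 x - L0 u - k * s)
  ((diff_quot s (x + u) - diff_quot 0 (x + u)) - k * s).
have := nmB (diff_quot s (x + u) - diff_quot 0 (x + u)) (k * s).
rewrite (_ : _ - k * s - (_ - k * s) = diff_quot 0 (x + u) - diff_quot 0 x - L0 u); last by ring.
by rewrite nmM; lra.
Qed.

End DifferenceQuotient.
End SeveralVariables.

(** * Division by the last coordinate *)

Section Division.
Variable R : realType.
Local Notation C := (Cfield R).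

Lemma nbhs_bounded (V : normedModType C) (f : V -> C) (W : set V) (x : V) :
  open W -> (forall y, W y -> differentiable f y) -> W x ->
  exists r M : R, 0 < r /\ forall y, nm (y - x) <= 4 * r -> W y /\ nm (f y) <= M.
Proof.
move=> oW df Wx.
have /nbhs_nmP [d1 [d10 H1]] : nbhs x W by exact: open_nbhs_nbhs.
have [d2 [d20 H2]] := (@continuous_nmP R _ _ f x).1 (differentiable_continuous (df x Wx)) 1 ltr01.
have [m1 m2] : Num.min d1 d2 <= d1 /\ Num.min d1 d2 <= d2 by rewrite !ge_min !lexx orbT.
have m0 : 0 < Num.min d1 d2 by rewrite lt_min d10.
exists (Num.min d1 d2 / 8), (nm (f x) + 1); split; first by rewrite divr_gt0.
move=> y yx; split; first by apply: H1; lra.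
have yx2 : nm (y - x) < d2 by lra.
by have := H2 y yx2; have := nmD (f y - f x) (f x); rewrite subrK; lra.
Qed.

Definition divided (V : normedModType C) (b : V * C -> C) (p : V * C) : C :=
  if p.2 == 0 then 'd b p (0, 1) else (b p - b (p.1, 0)) / p.2.

Lemma dividedP (V : normedModType C) (b : V * C -> C) (p : V * C) :
  b p = b (p.1, 0) + p.2 * divided b p.
Proof.
rewrite /divided; have [p0|p0] := eqVneq p.2 0; last by field.
by rewrite p0 mul0r addr0; congr b; case: p p0 => y t /= ->.
Qed.

(** Off the hyperplane where the last coordinate vanishes this is the quotient
    rule; on it, [divided b] is the difference quotient of [b] in the last
    coordinate, whose joint expansion is known. *)
Lemma divided_differentiable (V : normedModType C) (b : V * C -> C) (W : set (V * C)) :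
  open W -> (forall p, W p -> differentiable b p) ->
  forall p, W p -> W (p.1, 0) -> differentiable (divided b) p.
Proof.
move=> oW db [y t] /= Wp Wp0; have [t0|t0] := eqVneq t 0; last first.
  apply: (@near_differentiable _ _ (fun p => (b p - b (p.1, 0)) / p.2)).
    apply/nbhs_nmP; exists (nm t); split; first exact: nm_gt0.
    move=> [y' t']; rewrite nm_pair gt_max /divided /= => /andP[_ tt].
    by rewrite ifF //; apply/eqP => t'0; move: tt; rewrite t'0 sub0r nmN ltxx.
  have dsnd : differentiable (snd : V * C -> C) (y, t).
    by apply: linear_differentiable => ?; exact: cvg_snd.
  have dfst : differentiable (fun p : V * C => (p.1, 0 : C)) (y, t).
    apply: (@differentiable_pair _ _ _ _ fst (cst 0)); last exact: differentiable_cst.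
    by apply: linear_differentiable => ?; exact: cvg_fst.
  apply: (@differentiableM _ _ (fun p => b p - b (p.1, 0)) (fun p => p.2^-1)).
    apply: (@differentiableB _ _ _ b (fun p => b (p.1, 0))); first exact: db.
    by apply: (@differentiable_comp _ _ _ _ (fun p : V * C => (p.1, 0 : C)) b); [exact: dfst|exact: db].
  exact: (@differentiableV _ _ snd _ dsnd t0).
subst t; have [r [M [r0 rP]]] := nbhs_bounded oW db Wp.
have e1 : nm ((0, 1) : V * C) <= 1 by rewrite nm_pair nm0 nm1 ge_max ler01 lexx.
have [L [k [K [LK H]]]] := diff_quot_expansion r0 e1
  (fun z hz => db z (rP z hz).1) (fun z hz => (rP z hz).2).
have nm1_le (u : V * C) : nm u.1 <= nm u by case: u => u1 u2; rewrite nm_pair le_max lexx.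
have nm2_le (u : V * C) : nm u.2 <= nm u by case: u => u1 u2; rewrite nm_pair le_max lexx orbT.
have nm_fst (w : V) : nm ((w, 0) : V * C) = nm w by rewrite nm_pair nm0 max_l // nm_ge0.
have dE (u : V * C) : divided b ((y, 0) + u) = diff_quot b (0, 1) u.2 ((y, 0) + (u.1, 0)).
  case: u => w s; rewrite /divided /diff_quot /= add0r.
  rewrite -[(y, 0) + (w, s)]/(y + w, 0 + s) -[(y, 0) + (w, 0)]/(y + w, 0 + 0) !add0r.
  have [->//|s0] := eqVneq s 0.
  rewrite -[_ + s *: _]/(y + w + s *: 0, 0 + s *: 1) scaler0 addr0 add0r.
  by rewrite (_ : s *: 1 = s) //; exact: mulr1.
pose L0 (u : V * C) := L (u.1, 0) + k * u.2.
have L0lin : linear L0.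
  move=> a u v; rewrite /L0 /= (_ : (a *: u.1 + v.1, 0) = a *: (u.1, 0) + (v.1, 0) :> V * C).
    rewrite linearP -[a *: u.2]/(a * u.2) -[a *: (_ + _)]/(a * (_ + _)) -[a *: L _]/(a * L _).
    by ring.
  by rewrite -[RHS]/(a *: u.1 + v.1, a *: 0 + 0) scaler0 addr0.
pose Lp : {linear (V * C)%type -> C} := HB.pack L0 (GRing.isLinear.Build C (V * C)%type C _ L0 L0lin).
have K0 : 0 <= `|K| by exact: normr_ge0.
have KK : K <= `|K| by exact: ler_norm.
apply: (@differentiable_of_nm R _ _ _ _ Lp (`|K| + nm k)) => [u|e e0].
  rewrite -[Lp u]/(L (u.1, 0) + k * u.2); apply: le_trans (nmD _ _) _; rewrite mulrDl nmM.
  apply: lerD; last by rewrite ler_wpM2l ?nm_ge0 // nm2_le.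
  apply: le_trans (LK _) _; rewrite nm_fst.
  by apply: le_trans (ler_wpM2r (nm_ge0 _) KK) _; rewrite ler_wpM2l // nm1_le.
have D0 : 0 < 4 * `|K| + 1 by lra.
exists (Num.min r (e / (4 * `|K| + 1))); rewrite lt_min r0 divr_gt0 //; split=> // u.
rewrite lt_min ltr_pdivlMr // => /andP[ur ue]; have u0 := nm_ge0 u.
have u1 : nm ((u.1, 0) : V * C) <= nm u by rewrite nm_fst nm1_le.
have h := H u.2 (u.1, 0) (le_trans (nm2_le u) (ltW ur)) (le_trans u1 (ltW ur)).
rewrite dE -[Lp u]/(L (u.1, 0) + k * u.2) (_ : divided b (y, 0) = diff_quot b (0, 1) 0 (y, 0)); last first.
  by rewrite /divided /diff_quot /= eqxx.
rewrite opprD addrA; apply: le_trans h _.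
have := nm2_le u; move: u1 (nm_ge0 ((u.1, 0) : V * C)) (nm_ge0 u.2) ue u0.
move: (nm ((u.1, 0) : V * C)) (nm u.2) (nm u) => a c d ad a0 c0 de d0 cd.
apply: (@le_trans _ _ (`|K| * (2 * d) ^+ 2)).
  apply: le_trans (ler_wpM2r (sqr_ge0 _) KK) _; rewrite ler_wpM2l // ler_sqr ?nnegrE; lra.
rewrite (_ : `|K| * (2 * d) ^+ 2 = 4 * `|K| * d * d); last by ring.
by rewrite ler_wpM2r //; lra.
Qed.

End Division.

(** * The Euclidean norm of matrices *)

Section HermitianNorm.
Variable R : realType.
Local Notation C := (Cfield R).

Lemma nm_coord m n (A : 'M[C]_(m, n)) i j : nm (A i j) <= nm A.
Proof.
rewrite -le_ofR !ofR_nm [X in _ <= X]/Num.Def.normr /= mx_normE -[X in X <= _]nngE num_le.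
exact: (le_bigmax _ _ (i, j)).
Qed.

Lemma nm_continuous (V : normedModType C) : continuous (@nm R V).
Proof.
move=> v P /nbhs_ballP [e /= e0 He]; apply/nbhs_nmP; exists e; split=> // w wv.
apply: He; rewrite -ball_normE /=; apply: le_lt_trans wv.
have := nmD (w - v) v; have := nmD (v - w) w; rewrite !subrK (nm_sym v w) => h1 h2.
by rewrite ler_norml; lra.
Qed.

Lemma compact_closed_ball_rV n (r : R) : compact [set x : 'rV[C]_n | nm x <= r].
Proof.
have cP : compact [set x : 'rV[C]_n | forall i, [set z : C | nm z <= r] (x ord0 i)].
  by apply: (@rV_compact C n (fun=> [set z : C | nm z <= r])) => i; exact: compact_disc.
apply: (subclosed_compact _ cP); last by move=> x xr i; exact: le_trans (nm_coord _ _ _) xr.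
rewrite (_ : [set x | _] = @nm R _ @^-1` [set y | y <= r]) //.
apply: preimage_closed; first by move=> x _; exact: nm_continuous.
exact: closed_le.
Qed.

(** The Frobenius norm, squared. Unlike the maximum norm of matrices it has an expansion
    whose middle term is the real part of a function holomorphic in [A]
    ([nsq_expansion]). *)
Definition nsq m n (A : 'M[C]_(m, n)) : R := \sum_i \sum_j nm (A i j) ^+ 2.
Definition herm m n (A B : 'M[C]_(m, n)) : C := \sum_i \sum_j A i j * cj (B i j).

Lemma re_sum (I : finType) (F : I -> C) : re (\sum_i F i) = \sum_i re (F i).
Proof. by elim/big_rec2: _ => // i x y _ <-; rewrite reD. Qed.

Lemma nsq_expansion m n (A B : 'M[C]_(m, n)) :
  nsq A = nsq B + 2 * re (herm (A - B) B) + nsq (A - B).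
Proof.
rewrite /nsq /herm re_sum mulr_sumr -!big_split /=; apply: eq_bigr => i _.
rewrite re_sum mulr_sumr -!big_split /=; apply: eq_bigr => j _.
rewrite !mxE reM -[re (cj _)]/(re (B i j)) -[im (cj _)]/(- im (B i j)).
by rewrite !nm_sq reD imD reN imN; ring.
Qed.

Lemma nsq_ge0 m n (A : 'M[C]_(m, n)) : 0 <= nsq A.
Proof. by apply: sumr_ge0 => i _; apply: sumr_ge0 => j _; exact: sqr_ge0. Qed.

Lemma nsq_coord m n (A : 'M[C]_(m, n)) i j : nm (A i j) ^+ 2 <= nsq A.
Proof.
rewrite /nsq (bigD1 i) //= (bigD1 j) //= -addrA lerDl addr_ge0 //.
  by apply: sumr_ge0 => k _; exact: sqr_ge0.
by apply: sumr_ge0 => k _; apply: sumr_ge0 => l _; exact: sqr_ge0.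
Qed.

Lemma nsq_gt0 m n (A : 'M[C]_(m, n)) : A != 0 -> 0 < nsq A.
Proof.
move=> A0; rewrite lt_neqAle nsq_ge0 andbT; apply/eqP => n0; move/eqP: A0; apply.
apply/matrixP => i j; rewrite mxE; apply: nm_eq0; apply/eqP.
rewrite -sqrf_eq0 eq_le sqr_ge0 andbT n0; exact: nsq_coord.
Qed.

Lemma nsq0 m n : nsq (0 : 'M[C]_(m, n)) = 0.
Proof. by apply: big1 => i _; apply: big1 => j _; rewrite mxE nm0 expr0n. Qed.

Lemma nsqZ m n (a : C) (A : 'M[C]_(m, n)) : nsq (a *: A) = nm a ^+ 2 * nsq A.
Proof.
rewrite /nsq mulr_sumr; apply: eq_bigr => i _; rewrite mulr_sumr.
by apply: eq_bigr => j _; rewrite mxE nmM exprMn.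
Qed.

(** This makes [nsq u * (1 + nsq x)] the squared norm of a vector depending
    holomorphically on [u] and [x]. *)
Lemma nsq_outer m n (a : 'rV[C]_m) (b : 'rV[C]_n) : nsq (a^T *m b) = nsq a * nsq b.
Proof.
rewrite /nsq !big_ord1 mulr_suml; apply: eq_bigr => i _.
by rewrite mulr_sumr; apply: eq_bigr => j _; rewrite !mxE big_ord1 !mxE nmM exprMn.
Qed.

Lemma nsq_col_mx m1 m2 n (A : 'M[C]_(m1, n)) (B : 'M[C]_(m2, n)) :
  nsq (col_mx A B) = nsq A + nsq B.
Proof.
rewrite /nsq big_split_ord /=; congr (_ + _); apply: eq_bigr => i _; apply: eq_bigr => j _.
  by rewrite col_mxEu.
by rewrite col_mxEd.
Qed.

Lemma cvg_sum_fin (K : numFieldType) (V : normedModType K) (T : Type) (F : set_system T)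
    (I : Type) (s : seq I) (f : I -> T -> V) (l : I -> V) : Filter F ->
  (forall i, f i @ F --> l i) -> (fun q => \sum_(i <- s) f i q) @ F --> \sum_(i <- s) l i.
Proof.
move=> FF fl; elim: s => [|i s IH].
  by rewrite big_nil; under eq_fun do rewrite big_nil; exact: cvg_cst.
by rewrite big_cons; under eq_fun do rewrite big_cons; exact: cvgD (fl i) IH.
Qed.

Lemma continuous_nsq (T : topologicalType) m n (F : T -> 'M[C]_(m, n)) (p : T) :
  (forall i j, {for p, continuous (fun q => F q i j)}) ->
  {for p, continuous (fun q => nsq (F q))}.
Proof.
move=> cF; rewrite /nsq /prop_for /continuous_at.
apply: (@cvg_sum_fin R R) => i; apply: (@cvg_sum_fin R R) => j.
have c0 : (fun q => nm (F q i j)) @ p --> nm (F p i j).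
  exact: (continuous_comp (cF i j) (@nm_continuous C _)).
exact: (cvgM c0 c0).
Qed.

Lemma continuous_mulmx_entry (T : topologicalType) m n k (A : T -> 'M[C]_(m, n))
    (B : T -> 'M[C]_(n, k)) (p : T) :
  (forall i j, {for p, continuous (fun q => A q i j)}) ->
  (forall i j, {for p, continuous (fun q => B q i j)}) ->
  forall i j, {for p, continuous (fun q => (A q *m B q) i j)}.
Proof.
move=> cA cB i j; rewrite /prop_for /continuous_at mxE; under eq_fun do rewrite mxE.
by apply: (@cvg_sum_fin C C) => l; exact: (cvgM (cA i l) (cB l j)).
Qed.

Lemma compact_minimum (T : topologicalType) (K : set T) (f : T -> R) :
  compact K -> K !=set0 -> (forall p, K p -> {for p, continuous f}) ->
  exists p, K p /\ forall q, K q -> f p <= f q.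
Proof.
move=> cK K0 cf; have [|p /set_mem Kp pmin] := @compact_EVT_min T R f K K0 cK.
  by apply: continuous_in_subspaceT => q /set_mem; exact: cf.
by exists p; split=> // q Kq; apply: pmin; exact/mem_set.
Qed.

Lemma nm_normalize (V : normedModType C) (v : V) : v != 0 -> nm ((ofR (nm v))^-1 *: v) = 1.
Proof.
move=> v0; have nv := nm_gt0 v0.
by rewrite nmZ nmV nm_ofR ger0_norm ?nm_ge0 // mulVf // gt_eqF.
Qed.
End HermitianNorm.

Section MatrixDerivatives.
Variable R : realType.
Local Notation C := (Cfield R).

Lemma finite_radius (I : finType) (P : I -> C -> Prop) :
  (forall i, exists d : R, 0 < d /\ forall h, nm h < d -> P i h) ->
  exists d : R, 0 < d /\ forall h, nm h < d -> forall i, P i h.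
Proof.
move=> HP; have : nbhs (0 : C) [set h | forall i, P i h].
  have := @filter_forall C I (fun i => [set h | P i h]) (nbhs (0 : C)) _; apply=> i.
  by apply/(@nbhs_nmP R C 0); have [d [d0 Hd]] := HP i; exists d; split=> // h; rewrite subr0; exact: Hd.
by move=> /(@nbhs_nmP R C 0) [d [d0 Hd]]; exists d; split=> // h; rewrite -{1}(subr0 h); exact: Hd.
Qed.

Lemma has_deriv_sum n (F : 'I_n -> C -> C) (z : C) (l : 'I_n -> C) :
  (forall i, has_deriv (F i) z (l i)) ->
  has_deriv (fun w => \sum_i F i w) z (\sum_i l i).
Proof.
move=> dF e e0; have n0 : 0 < n%:R + 1 :> R by rewrite ltr_wpDl.
have [k [k0 Hk]] := finite_radius (fun i => dF i _ (divr_gt0 e0 n0)).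
exists k; split=> // h /Hk {}Hk.
rewrite mulr_suml -!sumrB.
have sub (I : Type) (s : seq I) (G : I -> C) : nm (\sum_(i <- s) G i) <= \sum_(i <- s) nm (G i).
  by elim/big_rec2: _ => [|i x y _ IH]; rewrite ?nm0 // (le_trans (nmD _ _)) // lerD2l.
apply: le_trans (sub _ _ _) _; apply: le_trans (ler_sum _ (fun i _ => Hk i)) _.
rewrite sumr_const card_ord -[_ *+ n]mulr_natl mulrA ler_wpM2r ?nm_ge0 //.
by rewrite mulrCA ler_piMr ?(ltW e0) // ler_pdivrMr // mul1r lerDl.
Qed.

Lemma has_deriv_affine_mul (f : C -> C) (a b l : C) : has_deriv f 0 l ->
  has_deriv (fun h => (a + h * b) * f h) 0 (a * l + b * f 0).
Proof.
move=> df e e0; have e2 : 0 < e / 2 by rewrite divr_gt0.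
have a1 : 0 < nm a + 1 by rewrite ltr_wpDl ?nm_ge0.
have b1 : 0 < nm b + 1 by rewrite ltr_wpDl ?nm_ge0.
have [d [d0 Hd]] := df _ (divr_gt0 e2 a1).
have [d' [d'0 Hd']] := derivable_continuous_nm (has_deriv_derivable df) (divr_gt0 e2 b1).
exists (Num.min d d'); rewrite lt_min d0; split=> // h.
rewrite lt_min => /andP[/Hd h1 hd']; have {Hd'} h2 := Hd' h; rewrite subr0 in h2.
have {}h2 := ltW (h2 hd'); rewrite add0r in h1 *.
rewrite (_ : _ - _ = a * (f h - f 0 - l * h) + h * (b * (f h - f 0))); last by ring.
apply: le_trans (nmD _ _) _; rewrite !nmM.
have n0 := nm_ge0 h; have an := nm_ge0 a; have bn := nm_ge0 b.
have t1 := ler_wpM2l an h1; have t2 := ler_wpM2l bn h2.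
have t3 : nm a * (e / 2 / (nm a + 1)) <= e / 2.
  by rewrite mulrCA ler_piMr ?(ltW e2) // ler_pdivrMr // mul1r lerDl.
have t4 : nm b * (e / 2 / (nm b + 1)) <= e / 2.
  by rewrite mulrCA ler_piMr ?(ltW e2) // ler_pdivrMr // mul1r lerDl.
have t5 := ler_wpM2r n0 t3; have t6 := ler_wpM2l n0 (le_trans t2 t4).
by rewrite mulrA in t1; lra.
Qed.

Lemma nsq_little_o m n (F : C -> 'M[C]_(m, n)) :
  (forall i j, has_deriv (fun l => F l i j) 0 0) ->
  forall e : R, 0 < e -> exists d : R, 0 < d /\
    forall l, nm l < d -> nsq (F l - F 0) <= e * nm l ^+ 2.
Proof.
move=> dF e e0; pose N : R := (n%:R * m%:R) + 1.
have N0 : 0 < N by rewrite ltr_wpDl // mulr_ge0.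
pose k := Num.min 1 (e / N); have k0 : 0 < k by rewrite lt_min ltr01 divr_gt0.
have k1 : k <= 1 by rewrite ge_min lexx.
have ke : k <= e / N by rewrite ge_min lexx orbT.
have [c [c0 Hc]] := finite_radius (fun ij : 'I_m * 'I_n => dF ij.1 ij.2 k k0).
exists c; split=> // l /Hc {}Hc.
have l0 := nm_ge0 l.
have Hij i j : nm ((F l - F 0) i j) ^+ 2 <= e / N * nm l ^+ 2.
  rewrite !mxE; apply: (@le_trans _ _ ((k * nm l) ^+ 2)).
    rewrite ler_sqr ?nnegrE ?mulr_ge0 ?nm_ge0 ?(ltW k0) //.
    by have := Hc (i, j); rewrite /= add0r mul0r subr0.
  rewrite exprMn ler_wpM2r ?sqr_ge0 //; apply: le_trans ke.
  by rewrite expr2 ler_piMr // ltW.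
rewrite /nsq; apply: le_trans (ler_sum _ (fun i _ => ler_sum _ (fun j _ => Hij i j))) _.
rewrite !sumr_const !card_ord -mulrnA -[_ *+ (n * m)]mulr_natl natrM mulrA.
rewrite ler_wpM2r ?sqr_ge0 // mulrCA ler_piMr ?(ltW e0) //.
by rewrite ler_pdivrMr // mul1r lerDl.
Qed.

Lemma derivable_sum_fun n (F : 'I_n -> C -> C) (z : C) :
  (forall i, derivable (F i) z 1) -> derivable (fun w => \sum_i F i w) z 1.
Proof.
move=> dF; apply: (@has_deriv_derivable _ _ _ (\sum_i derive1 (F i) z)).
by apply: has_deriv_sum => i; exact: derivable_has_deriv.
Qed.

Lemma derivable_herm m n (F : C -> 'M[C]_(m, n)) (A B : 'M[C]_(m, n)) (z : C) :
  (forall i j, derivable (fun l => F l i j) z 1) ->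
  derivable (fun l => herm (F l - A) B) z 1.
Proof.
move=> dF; apply: derivable_sum_fun => i; apply: derivable_sum_fun => j.
have -> : (fun l => (F l - A) i j * cj (B i j)) =
    (fun l => - A i j * cj (B i j) - (- cj (B i j)) * F l i j).
  by apply/funext => l; rewrite !mxE; ring.
exact: (derivable_comb (f := cst (- A i j * cj (B i j)))
  (derivable_cst (- A i j * cj (B i j)) z 1) (dF i j)).
Qed.

Lemma derivable_affine (a b z : C) : derivable (fun l : C => a + l * b) z 1.
Proof.
apply: (@derivableD C C C (cst a) (fun l => l * b)); first exact: derivable_cst.
by apply: (@derivableM C C id (cst b)); [exact: derivable_id|exact: derivable_cst].
Qed.

Lemma derivable_quadratic (a b c z : C) :
  derivable (fun l : C => a + (l * b + l * l * c)) z 1.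
Proof.
apply: (@derivableD C C C (cst a) (fun l => l * b + l * l * c)); first exact: derivable_cst.
have dl : derivable (fun l : C => l * l) z 1.
  by apply: (@derivableM C C id id); exact: derivable_id.
apply: (@derivableD C C C (fun l => l * b) (fun l => l * l * c)).
  by apply: (@derivableM C C id (cst b)); [exact: derivable_id|exact: derivable_cst].
by apply: (@derivableM C C (fun l => l * l) (cst c)); [exact: dl|exact: derivable_cst].
Qed.
End MatrixDerivatives.

(** * Isolated points of degeneracy *)

Section InteriorMinimum.
Variable R : realType.
Local Notation C := (Cfield R).

(** More unknowns than equations: there is a nonzero infinitesimal motion of the
    point and the vector under which [v *m M x] is stationary. *)
Lemma stationary_direction d r s (M : 'rV[C]_d -> 'M[C]_(r, s)) (p : 'rV[C]_d)
    (v : 'rV[C]_r) : (s < d + r)%N ->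
  exists (w : 'rV[C]_d) (v1 : 'rV[C]_r), row_mx w v1 != 0 /\
    forall j, \sum_i (v 0 i * 'd (fun x => M x i j) p w + v1 0 i * M p i j) = 0.
Proof.
move=> sdr.
pose J := \matrix_(k < d, j < s) \sum_i v 0 i * 'd (fun x => M x i j) p (delta_mx 0 k).
pose B := col_mx J (M p).
have kB : kermx B != 0.
  rewrite -mxrank_eq0 mxrank_ker subn_eq0 -ltnNge.
  by apply: leq_ltn_trans sdr; exact: rank_leq_col.
have /rowV0Pn [u /sub_kermxP uB u0] := kB.
exists (lsubmx u), (rsubmx u); rewrite hsubmxK; split=> // j.
move: uB; rewrite -{1}(hsubmxK u) mul_row_col => /matrixP /(_ 0 j); rewrite !mxE => uB.
rewrite big_split /= -[RHS]uB; congr (_ + _).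
under [RHS]eq_bigr => k _ do rewrite [X in _ * X]mxE mulr_sumr.
rewrite exchange_big /=; apply: eq_bigr => i _.
rewrite {1}(row_sum_delta (lsubmx u)) linear_sum mulr_sumr.
by apply: eq_bigr => k _; rewrite linearZ /= mulrCA.
Qed.

(** The function [nsq (v *m M x) / (nsq v * (1 + nsq x))] has no positive minimum
    at an interior point. Along the stationary direction the numerator is
    [nsq (g l)] with [g] holomorphic and [g' 0 = 0], the denominator is [nsq (V l)]
    with [V] holomorphic and [V' 0 != 0]; the real part of
    [2 <g - g 0, g 0> - 2 mu <V - V 0, V 0>] then has a strict quadratic minimum. *)
Lemma no_interior_minimum_ratio d r s (M : 'rV[C]_d -> 'M[C]_(r, s)) (p : 'rV[C]_d)
    (v : 'rV[C]_r) (rho mu : R) : (s < d + r)%N -> 0 < rho -> 0 < mu -> v != 0 ->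
  (forall (x : 'rV[C]_d) i j, nm (x - p) <= rho -> differentiable (fun x => M x i j) x) ->
  nsq (v *m M p) = mu * (nsq v * (1 + nsq p)) ->
  ~ (forall (x : 'rV[C]_d) (u : 'rV[C]_r), nm (x - p) <= rho -> mu * (nsq u * (1 + nsq x)) <= nsq (u *m M x)).
Proof.
move=> sdr rho0 mu0 v0 dM Mp minM.
have [w [v1 [wv0 stat]]] := stationary_direction M p v sdr.
pose x (l : C) := p + l *: w; pose u (l : C) := v + l *: v1.
pose g (l : C) := u l *m M (x l).
(* Segre coordinates: [nsq (V l)] is the denominator of the ratio along the line. *)
pose V (l : C) : 'M[C]_(1 + d, r) := col_mx (u l) ((x l)^T *m u l).
have x0 : x 0 = p by rewrite /x scale0r addr0.
have u0 : u 0 = v by rewrite /u scale0r addr0.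
have V_nsq l : nsq (V l) = nsq (u l) * (1 + nsq (x l)).
  by rewrite /V nsq_col_mx nsq_outer; ring.
pose V1 : 'M[C]_(1 + d, r) := col_mx v1 (p^T *m v1 + w^T *m v).
pose V2 : 'M[C]_(1 + d, r) := col_mx 0 (w^T *m v1).
have VE l : V l = V 0 + (l *: V1 + l ^+ 2 *: V2).
  rewrite /V /V1 /V2 x0 u0 !scale_col_mx !add_col_mx scaler0 addr0; congr col_mx.
  have -> : (x l)^T = p^T + l *: w^T by rewrite /x linearD linearZ.
  rewrite /u mulmxDl !mulmxDr -!scalemxAl -!scalemxAr scalerA -expr2.
  by rewrite scalerDr !addrA.
have V10 : V1 != 0.
  apply/eqP => V10; move/eqP: wv0; apply.
  have : nsq V1 = 0 by rewrite V10 nsq0.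
  rewrite nsq_col_mx => /eqP; rewrite paddr_eq0 ?nsq_ge0 // => /andP[/eqP n1 /eqP n2].
  have v10 : v1 = 0.
    by apply/eqP; apply: contraT => /nsq_gt0; rewrite n1 ltxx.
  move: n2; rewrite v10 mulmx0 add0r nsq_outer => /eqP.
  rewrite mulf_eq0 (gt_eqF (nsq_gt0 v0)) orbF => /eqP n2.
  have -> : w = 0 by apply/eqP; apply: contraT => /nsq_gt0; rewrite n2 ltxx.
  exact: row_mx0.
have [i [j aij]] : exists i j, V1 i j != 0.
  apply: contrapT => nex; move/eqP: V10; apply; apply/matrixP => i j; rewrite [RHS]mxE.
  by apply/eqP; apply: contraT => h; case: nex; exists i, j.
have [a aE] : exists a, a = V1 i j by exists (V1 i j).
have [b bE] : exists b, b = V2 i j by exists (V2 i j).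
rewrite -aE in aij; have na := nm_gt0 aij; have nb := nm_ge0 b.
have w1 : 0 < nm w + 1 by rewrite ltr_wpDl ?nm_ge0.
have xin (l : C) : nm l <= rho / (nm w + 1) -> nm (x l - p) <= rho.
  rewrite ler_pdivlMr // => lw; rewrite /x [p + _]addrC addrK nmZ; apply: le_trans lw.
  by rewrite ler_wpM2l ?nm_ge0 // lerDl.
have gE l k : g l 0 k = \sum_i0 (v 0 i0 + l * v1 0 i0) * M (x l) i0 k.
  by rewrite /g mxE; apply: eq_bigr => i0 _; rewrite !mxE.
have dMx (l : C) i0 k : nm l <= rho / (nm w + 1) -> derivable (fun l => M (x l) i0 k) l 1.
  move=> lr; apply: (@derivable_line R _ (fun x => M x i0 k) p w l).
  by apply: dM; exact: xin.
have dg (l : C) i0 k : nm l <= rho / (nm w + 1) -> derivable (fun l => g l i0 k) l 1.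
  move=> lr; rewrite (ord1 i0).
  have -> : (fun l => g l 0 k) = (fun l => \sum_i (v 0 i + l * v1 0 i) * M (x l) i k).
    by apply/funext => y; rewrite gE.
  apply: derivable_sum_fun => i1.
  apply: (@derivableM C C (fun l => v 0 i1 + l * v1 0 i1) (fun l => M (x l) i1 k)); last exact: dMx.
  exact: derivable_affine.
have dg0 i0 k : has_deriv (fun l => g l i0 k) 0 0.
  rewrite (ord1 i0); rewrite -[X in has_deriv _ _ X](stat k).
  have -> : (fun l => g l 0 k) = (fun l => \sum_i (v 0 i + l * v1 0 i) * M (x l) i k).
    by apply/funext => y; rewrite gE.
  apply: has_deriv_sum => i1.
  have p0 : nm (p + 0 *: w - p) <= rho by rewrite scale0r addr0 subrr nm0 ltW.
  have := has_deriv_line (dM _ i1 k p0); rewrite scale0r addr0.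
  move=> /(has_deriv_affine_mul (v 0 i1) (v1 0 i1)).
  by rewrite scale0r addr0.
have e0 : 0 < mu * nm a ^+ 2 / 8 by rewrite divr_gt0 // mulr_gt0 // exprn_gt0.
have [d1 [d10 Hd1]] := nsq_little_o dg0 e0.
have b1 : 0 < nm b + 1 by rewrite ltr_wpDl.
pose k := Num.min (Num.min d1 (rho / (nm w + 1))) (nm a / 2 / (nm b + 1)).
have k0 : 0 < k by rewrite !lt_min d10 !divr_gt0.
have [kd1 [kr kb]] : k <= d1 /\ k <= rho / (nm w + 1) /\ k <= nm a / 2 / (nm b + 1).
  by rewrite /k !ge_min !lexx !orbT.
pose H (l : C) := herm (g l - g 0) (g 0) - ofR mu * herm (V l - V 0) (V 0).
have k2 : 0 < k / 2 by rewrite divr_gt0.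
apply: (@no_quadratic_growth R H (k / 2) (mu * nm a ^+ 2 / 16) k2).
- by rewrite divr_gt0 // mulr_gt0 // exprn_gt0.
- move=> l lk; apply: (derivable_comb (f := fun l => herm (g l - g 0) (g 0))
    (g := fun l => herm (V l - V 0) (V 0))).
    by apply: derivable_herm => i0 k'; apply: dg; lra.
  apply: derivable_herm => i0 k'.
  have -> : (fun l => V l i0 k') = (fun l => V 0 i0 k' + (l * V1 i0 k' + (l * l) * V2 i0 k')).
    by apply/funext => y; rewrite VE !mxE expr2.
  exact: derivable_quadratic.
- have herm0 m n (A : 'M[C]_(m, n)) : herm (A - A) A = 0.
    by rewrite subrr; apply: big1 => i0 _; apply: big1 => j0 _; rewrite mxE mul0r.
  by rewrite /H !herm0 mulr0 subr0.
move=> l lk; have l0 := nm_ge0 l.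
have h1 : nsq (g l - g 0) <= mu * nm a ^+ 2 / 8 * nm l ^+ 2 by apply: Hd1; lra.
have h2 : nm l ^+ 2 * (nm a ^+ 2 / 4) <= nsq (V l - V 0).
  apply: le_trans (nsq_coord _ i j).
  have -> : (V l - V 0) i j = l * a + l ^+ 2 * b.
    by rewrite (VE l) aE bE addrC addKr !mxE.
  have : nm l * (nm a / 2) <= nm (l * a + l ^+ 2 * b).
    have := nmB (l * a + l ^+ 2 * b) (l ^+ 2 * b); rewrite addrK !nmM.
    have lb : nm l * nm b <= nm a / 2.
      have lb1 : nm l <= nm a / 2 / (nm b + 1) by lra.
      by move: lb1; rewrite ler_pdivlMr //; lra.
    by have := ler_wpM2l l0 lb; lra.
  move=> h; have z0 : 0 <= nm l * (nm a / 2) by rewrite mulr_ge0 // divr_ge0 // ltW.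
  have : (nm l * (nm a / 2)) ^+ 2 <= nm (l * a + l ^+ 2 * b) ^+ 2.
    by rewrite ler_sqr ?nnegrE // nm_ge0.
  by apply: le_trans; rewrite le_eqVlt; apply/orP; left; apply/eqP; field.
have h3 : mu * nsq (V l) <= nsq (g l) by rewrite V_nsq; apply/minM/xin; lra.
have h4 : nsq (g 0) = mu * nsq (V 0) by rewrite V_nsq /g u0 x0 Mp.
rewrite /H reB reZ.
have := nsq_expansion (g l) (g 0); have := nsq_expansion (V l) (V 0) => h5.
have h6 := ler_wpM2l (ltW mu0) h2.
rewrite h4 => h7; rewrite h5 in h3; move: h1 h3 h6 h7.
move: (nsq (g l)) (nsq (g l - g 0)) (nsq (V 0)) (nsq (V l - V 0)) (re _) (re _) (nm l) (nm a).
by clear=> G G1 V0 V1 h v x y h1 h3 h6 h7; lra.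
Qed.
End InteriorMinimum.

Section IsolatedDegeneracy.
Variable R : realType.
Local Notation C := (Cfield R).

Section Ratio.
Variables (d r s : nat) (M : 'rV[C]_d * C -> 'M[C]_(r, s)) (W : set ('rV[C]_d * C)).
Hypothesis dM : forall p i j, W p -> differentiable (fun q => M q i j) p.

(** The factor [1 + nsq x] makes minima strict also along directions that move [x] only. *)
Definition ratio (q : 'rV[C]_d * C * 'rV[C]_r) : R :=
  nsq (q.2 *m M q.1) / (nsq q.2 * (1 + nsq q.1.1)).

Lemma ratio_denom_gt0 (v : 'rV[C]_r) (x : 'rV[C]_d) : v != 0 -> 0 < nsq v * (1 + nsq x).
Proof. by move=> v0; rewrite mulr_gt0 ?nsq_gt0 // ltr_wpDr // nsq_ge0. Qed.

Lemma ratio_continuous q : W q.1 -> q.2 != 0 -> {for q, continuous ratio}.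
Proof.
move=> Wq q0.
have c2 i j : {for q, continuous (fun q : 'rV[C]_d * C * 'rV[C]_r => q.2 i j)}.
  exact: (continuous_comp (f := snd) cvg_snd (@coord_continuous C 1 r i j q.2)).
have c11 : {for q, continuous (fun q : 'rV[C]_d * C * 'rV[C]_r => q.1.1)}.
  exact: (continuous_comp (f := fst) cvg_fst cvg_fst).
have c1 i j : {for q, continuous (fun q : 'rV[C]_d * C * 'rV[C]_r => q.1.1 i j)}.
  exact: (continuous_comp c11 (@coord_continuous C 1 d i j q.1.1)).
have cM i j : {for q, continuous (fun q : 'rV[C]_d * C * 'rV[C]_r => M q.1 i j)}.
  exact: (continuous_comp (f := fst) cvg_fst (differentiable_continuous (dM i j Wq))).
have n1 := continuous_nsq (continuous_mulmx_entry c2 cM).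
have n2 := continuous_nsq c2; have n3 := continuous_nsq c1.
apply: cvgM; first exact: n1.
apply: cvgV; first by rewrite gt_eqF // ratio_denom_gt0.
by apply: cvgM; [exact: n2|apply: cvgD; [exact: cvg_cst|exact: n3]].
Qed.

Lemma ratio_gt0 q : q.2 != 0 -> row_free (M q.1) -> 0 < ratio q.
Proof.
move=> q0 fM; rewrite divr_gt0 ?ratio_denom_gt0 // nsq_gt0 //.
by rewrite mulmx_free_eq0.
Qed.

Lemma ratioZ (p : 'rV[C]_d * C) (v : 'rV[C]_r) (a : C) : a != 0 -> v != 0 ->
  ratio (p, a *: v) = ratio (p, v).
Proof.
move=> a0 v0; rewrite /ratio /= -scalemxAl !nsqZ.
have na := nm_gt0 a0; have := ratio_denom_gt0 p.1 v0; move: (nsq _) (nsq v) (nsq p.1) => A B D BD.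
by rewrite -(mulrA _ B) -mulf_div divff ?mul1r // expf_neq0 // gt_eqF.
Qed.
End Ratio.

(** Matrices of size [r * s] and rank less than [r] form a set of codimension
    [s - r + 1], at most [d + 1] here, so that in a space of dimension [d + 2] they cannot
    occur at an isolated point. Suppose that [v *m M (0, 0) = 0]. The [ratio] is bounded
    below for [nm x = rho], uniformly in [t], while at [x = 0] and at the vector [v] it tends
    to [0] with [t]; so for some small nonzero [t] its minimum is positive and interior,
    which [no_interior_minimum_ratio] excludes. *)
Lemma row_free_at_isolated_point d r s (M : 'rV[C]_d.+1 * C -> 'M[C]_(r, s))
    (W : set ('rV[C]_d.+1 * C)) :
  (s < d.+1 + r)%N -> open W -> W (0, 0) ->
  (forall p i j, W p -> differentiable (fun q => M q i j) p) ->
  (forall p, W p -> p != (0, 0) -> row_free (M p)) -> row_free (M (0, 0)).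
Proof.
move=> sdr oW W0 dM fM; rewrite -kermx_eq0; apply: contraT => /rowV0Pn [v' /sub_kermxP v'M v'0].
pose v := (ofR (nm v'))^-1 *: v'.
have nv : nm v = 1 by exact: nm_normalize.
have v0 : v != 0 by apply/eqP => v0; move: nv; rewrite v0 nm0 => /eqP; rewrite eq_sym oner_eq0.
have vM : v *m M (0, 0) = 0 by rewrite /v -scalemxAl v'M scaler0.
have /(@nbhs_nmP R) [d0 [d00 Wd0]] : nbhs ((0, 0) : 'rV[C]_d.+1 * C) W by exact: open_nbhs_nbhs.
pose rho := d0 / 2; have rho0 : 0 < rho by rewrite divr_gt0.
have Wrho (x : 'rV[C]_d.+1) (t : C) : nm x <= rho -> nm t <= rho -> W (x, t).
  move=> xr tr; apply: Wd0; rewrite nm_pair -[(x, t).1]/x /= !subr0.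
  by rewrite gt_max; apply/andP; rewrite /rho in xr tr; split; lra.
pose T := ('rV[C]_d.+1 * C * 'rV[C]_r)%type.
pose B : set T := [set x | nm x <= rho] `*` [set t | nm t <= rho] `*` [set v | nm v <= 1].
have cB : compact B.
  apply: compact_setX; last exact: compact_closed_ball_rV.
  by apply: compact_setX; [exact: compact_closed_ball_rV|exact: compact_disc].
have clo (f : T -> R) (c : R) : continuous f -> closed [set q | f q = c].
  move=> cf; rewrite (_ : [set q | _] = f @^-1` [set y | y = c]) //.
  by apply: preimage_closed; [move=> q _; exact: cf|exact: closed_eq].
have cn2 : continuous (fun q : T => nm q.2).
  by move=> q; exact: (continuous_comp (f := snd) cvg_snd (@nm_continuous R _ q.2)).
have cn11 : continuous (fun q : T => nm q.1.1).
  move=> q; have c11 : {for q, continuous (fun q : T => q.1.1)}.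
    exact: (continuous_comp (f := fst) cvg_fst cvg_fst).
  exact: (continuous_comp c11 (@nm_continuous R _ q.1.1)).
have cn12 (t : C) : continuous (fun q : T => nm (q.1.2 - t)).
  move=> q; have c12 : {for q, continuous (fun q : T => q.1.2)}.
    exact: (continuous_comp (f := fst) cvg_fst cvg_snd).
  have c12t : {for q, continuous (fun q : T => q.1.2 - t)}.
    exact: (cvgB c12 (cvg_cst t)).
  exact: (continuous_comp c12t (@nm_continuous R _ (q.1.2 - t))).
have nz (u : 'rV[C]_r) : nm u = 1 -> u != 0.
  by move=> nu; apply/eqP => u0; move: nu; rewrite u0 nm0 => /eqP; rewrite eq_sym oner_eq0.
have minG (K : set T) : closed K -> (forall q, K q -> nm q.2 = 1) -> (B `&` K) !=set0 ->
    exists p, (B `&` K) p /\ forall q, (B `&` K) q -> ratio M p <= ratio M q.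
  move=> cK K1 K0; apply: compact_minimum => //.
    apply: (subclosed_compact _ cB); last by move=> q [].
    by apply: closedI; [apply: compact_closed cB; exact: norm_hausdorff|exact: cK].
  move=> q [[[/= q11 q12] q2] /K1 /nz q20]; apply: ratio_continuous => //.
    exact: dM.
  by rewrite (surjective_pairing q.1); exact: Wrho.
pose K1 : set T := [set q | nm q.1.1 = rho] `&` [set q | nm q.2 = 1].
have cK1 : closed K1 by apply: closedI; exact: clo.
have [x1 nx1] : exists x : 'rV[C]_d.+1, nm x = rho.
  have e0 : (delta_mx 0 0 : 'rV[C]_d.+1) != 0.
    by apply/eqP => /matrixP /(_ 0 0); rewrite !mxE !eqxx => /eqP; rewrite oner_eq0.
  by exists (ofR rho *: ((ofR (nm (delta_mx 0 0 : 'rV[C]_d.+1)))^-1 *: delta_mx 0 0));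
    rewrite nmZ nm_normalize // mulr1 nm_ofR gtr0_norm.
have [q1 [[Bq1 [q11 q12]] min1]] : exists p, (B `&` K1) p /\
    forall q, (B `&` K1) q -> ratio M p <= ratio M q.
  apply: minG => //; first by move=> q [].
  exists (x1, 0, v); split; last by split.
  by split; [split|]; rewrite /= ?nx1 ?nm0 ?nv // ltW.
have kappa0 : 0 < ratio M q1.
  apply: ratio_gt0; first exact: nz.
  have [[/= b1 b2] _] := Bq1; rewrite (surjective_pairing q1.1); apply: fM; first exact: Wrho.
  by apply/eqP => -[x0 _]; move: q11; rewrite /= x0 nm0 => r0; move: rho0; rewrite -r0 ltxx.
have [t [t0 [tr tk]]] : exists t : C, t != 0 /\ nm t <= rho /\ ratio M (0, t, v) < ratio M q1.
  have c0 : {for ((0, 0), v), continuous (ratio M)} by apply: (ratio_continuous dM).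
  have r0 : ratio M ((0, 0), v) = 0 by rewrite /ratio /= vM !nsq0 mul0r.
  have nearq : nbhs ((0, 0, v) : T) [set q | ratio M q < ratio M q1].
    move/cvgrPdist_lt : c0 => /(_ _ kappa0); apply: filterS => q /=.
    by rewrite r0 sub0r normrN; apply: le_lt_trans; exact: ler_norm.
  have [e [e0 He]] := (@nbhs_nmP R _ ((0, 0, v) : T) _).1 nearq.
  pose y := Num.min e rho / 2.
  have m0 : 0 < Num.min e rho by rewrite lt_min e0.
  have [m1 m2] : Num.min e rho <= e /\ Num.min e rho <= rho by rewrite !ge_min !lexx orbT.
  have ny : nm (ofR y) = y by rewrite nm_ofR gtr0_norm // divr_gt0.
  exists (ofR y); split; last split.
  - by apply/eqP => y0; move: ny; rewrite y0 nm0 /y; lra.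
  - by rewrite ny /y; lra.
  apply: He; rewrite -[_ - _]/((0 - 0, ofR y - 0), v - v) !subrr subr0 !nm_pair !nm0 ny.
  by rewrite !gt_max e0 /= /y andbT; lra.
pose K2 : set T := [set q | nm (q.1.2 - t) = 0] `&` [set q | nm q.2 = 1].
have cK2 : closed K2 by apply: closedI; exact: clo.
have in2 (x : 'rV[C]_d.+1) (u : 'rV[C]_r) : nm x <= rho -> nm u = 1 -> (B `&` K2) (x, t, u).
  move=> xr nu; split; first by split; [split|]; rewrite /= ?nu.
  by split; rewrite //= subrr nm0.
have [[[p t'] u] [[[[/= b1 b2] b3] [/= tt nu]] min2]] : exists p, (B `&` K2) p /\
    forall q, (B `&` K2) q -> ratio M p <= ratio M q.
  apply: minG => //; first by move=> q [].
  by exists (0, t, v); apply: in2; rewrite ?nm0 // ltW.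
have {tt} t't : t' = t by apply/eqP; rewrite -subr_eq0; apply/eqP/nm_eq0.
subst t'.
have pr : nm p < rho.
  rewrite lt_neqAle b1 andbT; apply/eqP => pE.
  have := min2 _ (in2 0 v _ nv); rewrite nm0 => /(_ (ltW rho0)) h1.
  have h2 := min1 (p, t, u) (conj (conj (conj b1 b2) b3) (conj pE nu)).
  by move: (lt_le_trans tk h2); rewrite ltNge h1.
have u0 := nz _ nu.
have fMt (x : 'rV[C]_d.+1) : nm x <= rho -> row_free (M (x, t)).
  by move=> xr; apply: fM; [exact: Wrho|apply/eqP => -[_ /eqP]; rewrite (negbTE t0)].
have mu0 : 0 < ratio M (p, t, u) by apply: ratio_gt0 => //; exact: fMt.
have rp : 0 < rho - nm p by rewrite subr_gt0.
have inr (x : 'rV[C]_d.+1) : nm (x - p) <= rho - nm p -> nm x <= rho.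
  by move=> xp; have := nmD (x - p) p; rewrite subrK; lra.
exfalso; apply: (@no_interior_minimum_ratio R _ _ _ (fun x => M (x, t)) p u _ _ sdr rp mu0 u0).
- move=> x i j /inr xr.
  apply: (@differentiable_comp _ _ _ _ (fun x => (x, t)) (fun q => M q i j)).
    apply: (@differentiable_pair _ _ _ _ id (cst t)); last exact: differentiable_cst.
    exact: ex_diff.
  by apply: dM; exact: Wrho.
- by rewrite /ratio /= divfK // gt_eqF // ratio_denom_gt0.
move=> x z /inr xr; have [->|z0] := eqVneq z 0.
  by rewrite mul0mx nsq0 mul0r mulr0 nsq0.
rewrite -ler_pdivlMr ?ratio_denom_gt0 //; rewrite -[X in _ <= X]/(ratio M (x, t, z)).
have nz0 : (ofR (nm z))^-1 != 0.
  by rewrite invr_eq0; apply/eqP => z'; move: (nm_gt0 z0); rewrite (_ : nm z = 0) ?ltxx //; apply: (@ofR_inj R).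
by rewrite -(ratioZ M (x, t) nz0 z0); apply: min2; apply: in2 => //; exact: nm_normalize.
Qed.
End IsolatedDegeneracy.

(** * Values of holomorphic functions and matrices of sheaf morphisms *)

Section Evaluation.
Variables (K : numFieldType) (V : normedModType K).

Definition point_of (W : set V) (x : V) (Wx : W x) : W := SigSub (mem_set Wx).

(** Evaluation is named so that it can carry the structure of a ring morphism, through
    which matrices of functions are evaluated. *)
Definition ev (W : opens V) (w : W) (a : holo W) : K := a w.

Fact ev_is_zmod_morphism W w : zmod_morphism (@ev W w).
Proof. by []. Qed.
Fact ev_is_monoid_morphism W w : monoid_morphism (@ev W w).
Proof. by []. Qed.
HB.instance Definition _ W w :=
  GRing.isZmodMorphism.Build (holo W) K (@ev W w) (@ev_is_zmod_morphism W w).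
HB.instance Definition _ W w :=
  GRing.isMonoidMorphism.Build (holo W) K (@ev W w) (@ev_is_monoid_morphism W w).

Lemma map_ev_res (U W : opens V) (h : W `<=` U) (w : W) m n (A : 'M[holo U]_(m, n)) :
  map_mx (ev w) (map_mx (holo_res h) A) = map_mx (ev (subset_incl h w)) A.
Proof. by apply/matrixP => i j; rewrite !mxE. Qed.

Lemma map_ev_subZ (W : opens V) (w : W) m n (A B D : 'M[holo W]_(m, n)) (t : holo W) :
  ev w t = 0 -> map_mx (ev w) (A - B - t *: D) = map_mx (ev w) A - map_mx (ev w) B.
Proof.
move=> t0; apply/matrixP => i j; rewrite !mxE.
have -> : ev w (A i j - B i j - t * D i j) = ev w (A i j) - ev w (B i j) - ev w t * ev w (D i j) by [].
by rewrite t0 mul0r subr0.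
Qed.

Lemma subset_incl_point (U W : set V) (h : W `<=` U) x (Wx : W x) (Ux : U x) :
  subset_incl h (point_of Wx) = point_of Ux.
Proof. exact: val_inj. Qed.

Section FreeMorphism.
Variables (X : opens V) (r n : nat) (f : sheaf_hom (free_sheaf X r) (free_sheaf X n)).

Definition hom_mx : 'M[holo (opens_inT X)]_(r, n) :=
  \matrix_i f (opens_inT X) (delta_mx 0 i).

Lemma hom_mxE (W : opens_in X) (v : 'rV[holo W]_r) (h : W `<=` opens_inT X) :
  f W v = v *m map_mx (holo_res h) hom_mx.
Proof.
rewrite {1}(row_sum_delta v) linear_sum mulmx_sum_row; apply: eq_bigr => i _.
rewrite linearZ -map_row rowK; congr (_ *: _).
have <- : sres h (delta_mx 0 i : free_sheaf X r (opens_inT X)) = delta_mx 0 i.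
  apply/rowP => j; rewrite !mxE; case: (_ && _); exact: holo_eq.
by rewrite shom_res.
Qed.

Lemma ev_hom (W : opens_in X) (v : 'rV[holo W]_r) x (Wx : W x) (Xx : opens_inT X x) :
  map_mx (ev (point_of Wx)) (f W v) =
  map_mx (ev (point_of Wx)) v *m map_mx (ev (point_of Xx)) hom_mx.
Proof.
rewrite (hom_mxE v (@opens_inP _ _ W)) map_mxM map_ev_res.
by rewrite (subset_incl_point _ _ Xx).
Qed.

End FreeMorphism.
End Evaluation.

(** Injectivity makes the local preimages of a section unique, so they agree on
    overlaps and glue. *)
Lemma sheaf_iso_of_inj_surj (K : numFieldType) (V : normedModType K) (X : opens V)
    (F G : sheaf X) (f : sheaf_hom F G) :
  sheaf_inj f -> sheaf_surj f -> forall U : opens_in X, bijective (f U).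
Proof.
move=> finj fsurj U; suff surj s : exists t, f U t = s.
  have [k kP] := choice surj.
  by exists k => [t|//]; apply: (finj U); rewrite kP.
have H (u : U) : exists (W : opens_in X), exists (h : W `<=` U) (t : F W),
    W (val u) /\ f W t = sres h s.
  by have [W [h [t Wt]]] := fsurj U s (val u) (set_mem (valP u)); exists W, h, t.
pose W u := projT1 (cid (H u)); pose H1 u := cid (projT2 (cid (H u))).
pose h u : W u `<=` U := projT1 (H1 u); pose H2 u := cid (projT2 (H1 u)).
pose t u : F (W u) := projT1 (H2 u).
have Ht u : W u (val u) /\ f (W u) (t u) = sres (h u) s := projT2 (H2 u).
have cov : U `<=` \bigcup_u W u.
  by move=> x Ux; exists (point_of Ux) => //; have [] := Ht (point_of Ux).
have [|k kP] := sheaf_glue h cov (s := t) _.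
  move=> u v Z hu hv; apply: (finj Z); rewrite !shom_res.
  have [_ ->] := Ht u; have [_ ->] := Ht v.
  have hZ : Z `<=` U by move=> x /hu /h.
  by rewrite !(sres_comp _ _ hZ).
exists k; apply: (sheaf_separated cov) => u.
by rewrite -shom_res kP; have [_ ->] := Ht u.
Qed.

(** * Fibers of a presented sheaf *)

Section PresentedFiber.
Variables (K : numFieldType) (V : normedModType K) (Y : opens V) (D : opens K).
Variables (E : sheaf (opens_prod Y D)) (U : opens_in (opens_prod Y D)) (r n : nat).
Variables (f : sheaf_hom (free_sheaf U r) (free_sheaf U n)).
Variables (g : sheaf_hom (free_sheaf U n) (sheaf_restr E U)).
Hypotheses (fg_exact : sheaf_exact f g) (g_surj : sheaf_surj g).

Definition mx_at (q : V * K) (Uq : opens_inT U q) : 'M[K]_(r, n) :=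
  map_mx (ev (point_of Uq)) (hom_mx f).

(** Elements of the stalk of [E_t] have no value at [p], but vectors of functions that
    represent them do, and the rows of the matrix of [f] at [p] measure how far these values
    are from being determined. So the stalk modulo the functions vanishing at [p] is handled as
    a quotient of [K ^ n], through a relation. *)
Definition represents (p : opens_prod Y D) (z : fiber_stalk E p) (b : 'rV[K]_n) : Prop :=
  exists (W : opens_in U) (Wp : W (val p)) (a : 'rV[holo W]_n),
    z = @fiber_class _ _ _ E p (opens_in_incl W) Wp (g W a) /\
    b = map_mx (ev (point_of Wp)) a.

Lemma g_res (W Z : opens_in U) (h : Z `<=` W) (a : 'rV[holo W]_n) :
  g Z (map_mx (holo_res h) a) = @sres _ _ _ E (opens_in_incl W) (opens_in_incl Z) h (g W a).
Proof. exact: (shom_res g h a). Qed.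

Lemma represents_res (p : opens_prod Y D) (W Z : opens_in U) (h : Z `<=` W)
    (Wp : W (val p)) (Zp : Z (val p)) (a : 'rV[holo W]_n) :
  @fiber_class _ _ _ E p (opens_in_incl W) Wp (g W a) =
    @fiber_class _ _ _ E p (opens_in_incl Z) Zp (g Z (map_mx (holo_res h) a)) /\
  map_mx (ev (point_of Wp)) a = map_mx (ev (point_of Zp)) (map_mx (holo_res h) a).
Proof.
split; first by rewrite g_res; exact: fiber_class_res.
by rewrite map_ev_res (subset_incl_point _ _ Wp).
Qed.

Definition cut (W : opens_in (opens_prod Y D)) : opens_in U :=
  @OpensIn _ (U : set _) (opensI W U) (fun x => @proj2 _ _).

Lemma cut_sub (W : opens_in (opens_prod Y D)) : opens_in_incl (cut W) `<=` W.
Proof. by move=> x []. Qed.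

Lemma lift_section (W : opens_in (opens_prod Y D)) (e : E W) (x : V * K) :
  W x -> U x -> exists (Z : opens_in U) (h : opens_in_incl Z `<=` W) (a : 'rV[holo Z]_n),
    Z x /\ g Z a = sres h e.
Proof.
move=> Wx Ux.
have [Z [h [a [Zx gZ]]]] := @g_surj (cut W) (sres (@cut_sub W) e) x (conj Wx Ux).
have k : opens_in_incl Z `<=` W by move=> y /h [].
exists Z, k, a; split=> //; rewrite gZ.
exact: (@sres_comp _ _ _ E W (opens_in_incl (cut W)) (opens_in_incl Z)).
Qed.

Lemma represents_ex (p : opens_prod Y D) (z : fiber_stalk E p) : U (val p) ->
  exists b, represents z b.
Proof.
move=> Up; have [W [Wp [e ->]]] := fiber_stalkP z.
have [Z [h [a [Zp gZ]]]] := lift_section e Wp Up.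
exists (map_mx (ev (point_of Zp)) a), Z, Zp, a; split=> //; rewrite gZ.
exact: (@fiber_class_res _ _ _ E p W (opens_in_incl Z)).
Qed.

Lemma represents0 (p : opens_prod Y D) : U (val p) -> represents (0 : fiber_stalk E p) 0.
Proof.
move=> Up; exists (opens_inT U), Up, 0; split; last by rewrite map_mx0.
rewrite linear0; exact: fiber_zeroE.
Qed.

Lemma representsD (p : opens_prod Y D) (z z' : fiber_stalk E p) b b' :
  represents z b -> represents z' b' -> represents (z + z') (b + b').
Proof.
move=> [W [Wp [a [-> ->]]]] [W' [W'p [a' [-> ->]]]].
pose Z := opens_inI W W'; have Zp : Z (val p) by split.
have h : Z `<=` W by move=> x [].
have h' : Z `<=` W' by move=> x [].
have [e1 e2] := represents_res h Wp Zp a; have [e3 e4] := represents_res h' W'p Zp a'.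
exists Z, Zp, (map_mx (holo_res h) a + map_mx (holo_res h') a'); split.
  by rewrite e1 e3 -fiber_classD linearD.
by rewrite e2 e4 map_mxD.
Qed.

Lemma representsZ (p : opens_prod Y D) (z : fiber_stalk E p) b (A : opens V)
    (Ap : A (val p).1) (c : holo A) :
  represents z b -> represents (fiber_scale Ap c z) (ev (point_of Ap) c *: b).
Proof.
move=> [W [Wp [a [-> ->]]]].
pose Z : opens_in U := opens_inI W (opens_fst A).
have Zp : Z (val p) by split.
have h : Z `<=` W by move=> x [].
have k : opens_in_incl Z `<=` fst @^-1` A by move=> x [_ []].
have [e1 e2] := represents_res h Wp Zp a.
exists Z, Zp, (holo_fst k c *: map_mx (holo_res h) a); split.
  by rewrite e1 (@fiber_scaleE _ _ _ E p A Ap c (opens_in_incl Z) k) linearZ.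
rewrite e2 map_mxZ; congr (_ *: _); rewrite /ev /=; congr (c _); exact: val_inj.
Qed.

(** Equality in the stalk of [E_t] holds up to a multiple of [tau - t], whose
    value at [p] is [0], and up to the image of [f], whose value is a combination of rows. *)
Lemma represents_unique (p : opens_prod Y D) (z : fiber_stalk E p) b b'
    (Up : opens_inT U (val p)) :
  represents z b -> represents z b' -> exists c, b - b' = c *m mx_at Up.
Proof.
move=> [W [Wp [a [-> ->]]]] [W' [W'p [a' [zE ->]]]].
have [Z [h [h' [e [Zp ze]]]]] := (@fiber_classE _ _ _ E p (opens_in_incl W) (opens_in_incl W') Wp W'p (g W a) (g W' a')).1 zE.
have [T [k [d [Tp gT]]]] := lift_section e Zp Up.
have hT : T `<=` W by move=> x /k /h.
have hT' : T `<=` W' by move=> x /k /h'.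
pose tau : holo T := holo_snd_sub T (val p).2.
pose w := map_mx (holo_res hT) a - map_mx (holo_res hT') a' - tau *: d.
have gw : g T w = 0.
  have c1 := @sres_comp _ _ _ E (opens_in_incl W) Z (opens_in_incl T) h k hT (g W a).
  have c2 := @sres_comp _ _ _ E (opens_in_incl W') Z (opens_in_incl T) h' k hT' (g W' a').
  have := congr1 (sres k) ze; rewrite c1 sresD c2 sresZ holo_res_snd_sub => E1.
  rewrite /w !linearB linearZ !g_res gT E1.
  by rewrite [X in X - _ - _]addrC addrK subrr.
have [T' [l [v [T'p vE]]]] := (fg_exact w).1 gw _ Tp.
exists (map_mx (ev (point_of T'p)) v).
have := ev_hom f v T'p Up; rewrite /mx_at vE => <-.
apply: etrans (esym (map_ev_res l (point_of T'p) w)).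
rewrite (subset_incl_point _ _ Tp) map_ev_subZ; last by rewrite /ev /tau /= subrr.
by rewrite !map_ev_res (subset_incl_point _ _ Wp) (subset_incl_point _ _ W'p).
Qed.

End PresentedFiber.

Section LocallyFreeFiber.
Variables (K : numFieldType) (V : normedModType K) (Y : opens V) (D : opens K).
Variables (E : sheaf (opens_prod Y D)) (U : opens_in (opens_prod Y D)) (r n : nat).
Variables (f : sheaf_hom (free_sheaf U r) (free_sheaf U n)).
Variables (g : sheaf_hom (free_sheaf U n) (sheaf_restr E U)).
Hypotheses (fg_exact : sheaf_exact f g) (g_surj : sheaf_surj g).
Variable t : D.

Lemma slice_open_subproof (W : opens (V * K)%type) : open [set y : V | W (y, val t)].
Proof.
have -> : [set y : V | W (y, val t)] = (fun y : V => (y, val t)) @^-1` W by [].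
apply: open_comp; last exact: opensP.
move=> y _; apply: differentiable_continuous.
apply: (@differentiable_pair _ _ _ _ id (cst (val t))); last exact: differentiable_cst.
exact: ex_diff.
Qed.

Definition slice_open (W : opens (V * K)%type) : opens V := Opens (slice_open_subproof W).

Definition image_fun (Z : opens_in Y) (h : Z `<=` slice_open U) (c : 'rV[holo (opens_inT U)]_n)
    (y : Y) (Zy : Z (val y)) : fiber_stalk E (slice_point t y) :=
  @fiber_class _ _ _ E (slice_point t y) (opens_in_incl (opens_inT U)) (h _ Zy)
    (g (opens_inT U) c).

Lemma image_funP (Z : opens_in Y) (h : Z `<=` slice_open U) (c : 'rV[holo (opens_inT U)]_n)
    (y : Y) : Z (val y) ->
  exists (W : opens_in (opens_prod Y D)) (e : E W), W (val y, val t) /\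
    forall (z : Y) (Zz : Z (val z)) (Wz : W (val (slice_point t z))),
      image_fun h c Zz = fiber_class Wz e.
Proof.
move=> Zy; exists (opens_in_incl (opens_inT U)), (g (opens_inT U) c).
split; first exact: h _ Zy.
by move=> z Zz Wz; rewrite /image_fun; congr fiber_class; exact: Prop_irrelevance.
Qed.

Definition image_section (Z : opens_in Y) (h : Z `<=` slice_open U)
  (c : 'rV[holo (opens_inT U)]_n) : fiber_sections E t Z := FiberSections (image_funP h c).

Lemma represents_image (Z : opens_in Y) (h : Z `<=` slice_open U)
    (c : 'rV[holo (opens_inT U)]_n) (y : Y) (Zy : Z (val y))
    (Uy : opens_inT U (val (slice_point t y))) :
  represents g (fiber_fun (image_section h c) Zy) (map_mx (ev (point_of Uy)) c).
Proof.
exists (opens_inT U), Uy, c; split=> //.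
by rewrite /= /image_fun; congr fiber_class; exact: Prop_irrelevance.
Qed.

Lemma represents_comb m (Z : opens_in Y) (c : 'rV[holo Z]_m)
    (e : 'I_m -> fiber_sections E t Z) (y : Y) (Zy : Z (val y)) (b : 'M[K]_(m, n)) :
  U (val (slice_point t y)) ->
  (forall j, represents g (fiber_fun (e j) Zy) (row j b)) ->
  represents g (fiber_fun (\sum_j c 0 j *: e j) Zy) (map_mx (ev (point_of Zy)) c *m b).
Proof.
move=> Uy eb; rewrite mulmx_sum_row.
elim/big_ind2: _ => [|z1 b1 z2 b2 h1 h2|j _]; first exact: represents0.
  exact: representsD.
have := representsZ (p := slice_point t y) (A := Z) Zy (c 0 j) (eb j).
by rewrite !mxE.
Qed.

(** A frame of [m] sections of [E_t] is represented at [y] by the rows of some [B];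
    every basis vector of [K ^ n] also induces a section of [E_t], hence a combination of
    the frame, and so lies in the span of [B] and of the rows of the matrix of [f]. *)
Lemma rank_of_locally_free m (y : Y) (Uy : opens_inT U (val (slice_point t y))) :
  locally_free_at m (fiber E t) (val y) -> (n <= \rank (mx_at f Uy) + m)%N.
Proof.
move=> [U0 [U0y [phi phi_bij]]].
pose U1 : opens_in U0 := opens_inI (opens_inT U0) (slice_open U).
have U1y : U1 (val y) by split.
pose Z : opens_in Y := opens_in_incl U1.
have h : Z `<=` slice_open U by move=> x [].
pose e j : fiber_sections E t Z := phi U1 (delta_mx 0 j).
have [b eb] : exists b : 'I_m -> 'rV[K]_n, forall j,
    represents g (@fiber_fun _ _ _ _ _ _ Z (e j) y U1y) (b j).
  have H j : exists b, represents g (@fiber_fun _ _ _ _ _ _ Z (e j) y U1y) b.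
    exact: (represents_ex g_surj).
  by have [b Hb] := choice H; exists b.
pose B := \matrix_j b j.
have full k : ((delta_mx 0 k : 'rV[K]_n) <= col_mx (mx_at f Uy) B)%MS.
  pose s := image_section h (delta_mx 0 k).
  have [inv _ invK] := phi_bij U1.
  pose c : 'rV[holo Z]_m := inv s.
  have sE : s = \sum_j c 0 j *: e j.
    rewrite -[LHS](invK s) -/c {1}(row_sum_delta c) linear_sum; apply: eq_bigr => j _.
    by rewrite linearZ.
  have eB j : represents g (@fiber_fun _ _ _ _ _ _ Z (e j) y U1y) (row j B) by rewrite rowK.
  have r1 := represents_comb c Uy eB; have r2 := @represents_image Z h (delta_mx 0 k) y U1y Uy.
  rewrite -sE -/s in r1 r2.
  have [a aE] := represents_unique fg_exact g_surj Uy r2 r1.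
  have -> : delta_mx 0 k = a *m mx_at f Uy + map_mx (ev (point_of (U1y : Z (val y)))) c *m B.
    by rewrite -aE subrK map_delta_mx.
  by rewrite -mul_row_col submxMl.
have rk : row_full (col_mx (mx_at f Uy) B).
  by rewrite -sub1mx; apply/row_subP => k; rewrite rowE mulmx1.
apply: (@leq_trans (\rank (col_mx (mx_at f Uy) B))); first by rewrite (eqP rk).
rewrite -addsmxE; apply: leq_trans (mxrank_adds_leqif _ _) _.
by rewrite leq_add2l rank_leq_row.
Qed.

End LocallyFreeFiber.

(** * Free generators of the fiber where the matrix has full rank *)

Section Complement.
Variable K : fieldType.

Lemma exists_complement r m (A : 'M[K]_(r, r + m)) : row_free A ->
  exists B : 'M[K]_(m, r + m), col_mx A B \in unitmx.
Proof.
move=> /eqP rA.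
have e : \rank (A^C)%MS = m by rewrite mxrank_compl rA addKn.
have [B AB] : exists B : 'M[K]_(m, r + m), (A^C <= B)%MS.
  have := eqmx_sym (eq_row_base (A^C)%MS); move: (row_base _); rewrite e => B AB.
  by exists B; rewrite AB.
exists B; rewrite -row_full_unit -sub1mx.
apply: (@submx_trans _ _ _ _ _ _ (A + A^C)%MS); first by rewrite sub1mx addsmx_compl_full.
by rewrite -addsmxE addsmxS.
Qed.

End Complement.

Section FreeGenerators.
Variables (K : numFieldType) (V : normedModType K).

Fact holo_cst_subproof (W : opens V) (c : K) : (fun _ : W => c) \in holomorphic W.
Proof.
by apply: (@holomorphic_ext _ _ _ _ (cst c)) => // x _; exact: differentiable_cst.
Qed.

Definition holo_cst (W : opens V) (c : K) : holo W := Holo (holo_cst_subproof W c).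

Lemma nonvanishing_open_subproof (X : opens V) (d : holo X) :
  open [set x : V | X x /\ valL_ 0 d x != 0].
Proof.
rewrite openE => x /= [Xx dx]; rewrite /interior.
have /differentiable_continuous cd : differentiable (valL_ 0 d) x.
  by have /asboolP := holoP d; apply.
apply: filterI; first by exact: open_nbhs_nbhs (conj (opensP X) Xx).
apply: (cd [set z | z != 0]); apply: open_nbhs_nbhs; split=> //.
rewrite (_ : [set z | z != 0] = ~` [set 0]); last first.
  by apply/seteqP; split=> z /= /eqP.
by apply: closed_openC; apply: accessible_closed_set1; exact: hausdorff_accessible.
Qed.

Definition nonvanishing (X : opens V) (d : holo X) : opens V :=
  Opens (nonvanishing_open_subproof d).

Lemma nonvanishing_sub (X : opens V) (d : holo X) : nonvanishing d `<=` X.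
Proof. by move=> x []. Qed.

Lemma holo_inverse (X : opens V) (d : holo X) :
  exists i : holo (nonvanishing d), i * holo_res (@nonvanishing_sub X d) d = 1.
Proof.
have iP : (fun x : nonvanishing d => (valL_ 0 d (val x))^-1) \in holomorphic (nonvanishing d).
  apply: (@holomorphic_ext _ _ _ _ (fun x => (valL_ 0 d x)^-1)) => // x [Xx dx].
  have dd : differentiable (valL_ 0 d) x by have /asboolP := holoP d; apply.
  exact: (@differentiableV _ _ (valL_ 0 d) _ dd dx).
exists (Holo iP); apply: holo_eq => x.
have [Xx dx] := set_mem (valP x).
rewrite -[LHS]/((valL_ 0 d (val x))^-1 * d (subset_incl (@nonvanishing_sub X d) x)).
have -> : d (subset_incl (@nonvanishing_sub X d) x) = valL_ 0 d (val x).
  by rewrite -valL_val.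
by rewrite mulVf.
Qed.

Lemma sres_comb (X : opens V) (F : sheaf X) (U W : opens_in X) (h : W `<=` U)
    m (c : 'I_m -> holo U) (s : 'I_m -> F U) :
  sres h (\sum_j c j *: s j) = \sum_j holo_res h (c j) *: sres h (s j).
Proof.
pose G (x : F U) (y : F W) := sres h x = y; apply: (big_ind2 G); rewrite /G.
- exact: sres0.
- move=> x1 y1 x2 y2 <- <-; have := sres_linear h 1 x1 x2; rewrite !scale1r => ->.
  by rewrite (_ : holo_res h 1 = 1) ?scale1r //; exact: holo_eq.
by move=> j _; have := sres_linear h (c j) (s j) 0; rewrite sres0 !addr0.
Qed.

Lemma hom_of_sections (X : opens V) (F : sheaf X) (U : opens_in X) m (s : 'I_m -> F U) :
  exists phi : sheaf_hom (free_sheaf U m) (sheaf_restr F U),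
    forall (W : opens_in U) (h : opens_in_incl W `<=` U) (u : 'rV[holo W]_m),
      phi W u = \sum_j u 0 j *: (sres h (s j) : F (opens_in_incl W)).
Proof.
pose h (W : opens_in U) : opens_in_incl W `<=` U := @opens_inP _ _ W.
pose p (W : opens_in U) (u : 'rV[holo W]_m) : F (opens_in_incl W) :=
  \sum_j u 0 j *: (sres (h W) (s j) : F (opens_in_incl W)).
have plin W : linear (@p W).
  move=> a u v; rewrite /p scaler_sumr -big_split; apply: eq_bigr => j _ /=.
  by rewrite !mxE scalerDl scalerA.
pose q (W : opens_in U) : {linear free_sheaf U m W -> sheaf_restr F U W} :=
  HB.pack (@p W) (GRing.isLinear.Build _ _ _ _ (@p W) (plin W)).
have qres (W Z : opens_in U) (k : Z `<=` W) (u : free_sheaf U m W) :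
    q Z (sres k u) = sres k (q W u).
  apply: etrans (esym (@sres_comb X F (opens_in_incl W) (opens_in_incl Z) k m _ _)).
  by apply: eq_bigr => j _; rewrite mxE (sres_comp _ _ (h Z)).
by exists (SheafHom qres) => W k u; apply: eq_bigr => j _; rewrite (Prop_irrelevance (h W) k).
Qed.

End FreeGenerators.

Section FiberCombination.
Variables (K : numFieldType) (V : normedModType K).

Fact holo_res_is_zmod_morphism (U W : opens V) (h : W `<=` U) : zmod_morphism (holo_res h).
Proof. by move=> a b; exact: holo_eq. Qed.
Fact holo_res_is_monoid_morphism (U W : opens V) (h : W `<=` U) : monoid_morphism (holo_res h).
Proof. by split=> [|a b]; exact: holo_eq. Qed.
HB.instance Definition _ (U W : opens V) (h : W `<=` U) :=
  GRing.isZmodMorphism.Build (holo U) (holo W) (holo_res h) (holo_res_is_zmod_morphism h).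
HB.instance Definition _ (U W : opens V) (h : W `<=` U) :=
  GRing.isMonoidMorphism.Build (holo U) (holo W) (holo_res h) (holo_res_is_monoid_morphism h).

Lemma cramer_comb r m (W : opens V) (A : 'M[holo W]_(r, r + m)) (B : 'M[holo W]_(m, r + m))
    (i : holo W) (a : 'rV[holo W]_(r + m)) :
  i * \det (col_mx A B) = 1 ->
  exists (c : 'rV[holo W]_r) (b : 'I_m -> holo W), a = c *m A + \sum_j b j *: row j B.
Proof.
move=> iT; pose x := a *m (i *: \adj (col_mx A B)).
have : x *m col_mx A B = a.
  by rewrite -mulmxA -scalemxAl mul_adj_mx scale_scalar_mx iT mulmx1.
rewrite -[x]hsubmxK mul_row_col (mulmx_sum_row (rsubmx x)) => <-.
by exists (lsubmx x), (fun j => rsubmx x 0 j).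
Qed.

Lemma linear_comb m (W : opens V) (M N : lmodType (holo W)) (G : {linear M -> N}) (u : M)
    (a : M) (b : 'I_m -> holo W) (v : 'I_m -> M) :
  a = u + \sum_j b j *: v j -> G u = 0 -> G a = \sum_j b j *: G (v j).
Proof.
move=> -> Gu; rewrite linearD Gu add0r linear_sum.
by apply: eq_bigr => j _; rewrite linearZ.
Qed.

Variables (Y : opens V) (D : opens K) (E : sheaf (opens_prod Y D)).

Lemma fiber_class_comb m (p : opens_prod Y D) (W : opens_in (opens_prod Y D)) (A : opens V)
    (k : W `<=` fst @^-1` A) (Wp : W (val p)) (Ap : A (val p).1)
    (c : 'I_m -> holo A) (e : 'I_m -> E W) :
  fiber_class Wp (\sum_j holo_fst k (c j) *: e j) =
  \sum_j fiber_scale Ap (c j) (fiber_class Wp (e j)).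
Proof.
pose G (x : E W) (z : fiber_stalk E p) := fiber_class Wp x = z.
apply: (big_ind2 G); rewrite /G.
- by rewrite -fiber_zeroE.
- by move=> x1 z1 x2 z2 <- <-; exact: fiber_classD.
by move=> j _; rewrite (fiber_scaleE _ _ k).
Qed.

Lemma fiber_class_mod m (p : opens_prod Y D) (W : opens_in (opens_prod Y D)) (Wp : W (val p))
    (c d : 'I_m -> holo W) (e : 'I_m -> E W) :
  fiber_class Wp (\sum_j (c j + holo_snd_sub W (val p).2 * d j) *: e j) =
  fiber_class Wp (\sum_j c j *: e j).
Proof.
apply/fiber_classE; have k : W `<=` W by [].
exists W, k, k, (\sum_j d j *: e j); split=> //; rewrite !sres_id scaler_sumr -big_split.
by apply: eq_bigr => j _; rewrite scalerDl scalerA.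
Qed.

Variable t : D.

Lemma fiber_fun_comb m (Z : opens_in Y) (c : 'I_m -> holo Z) (s : 'I_m -> fiber_sections E t Z)
    (y : Y) (Zy : Z (val y)) :
  fiber_fun (\sum_j c j *: s j) Zy =
  \sum_j fiber_scale (p := slice_point t y) (U := Z) Zy (c j) (fiber_fun (s j) Zy).
Proof.
pose G (x : fiber_sections E t Z) (z : fiber_stalk E (slice_point t y)) := fiber_fun x Zy = z.
apply: (big_ind2 G); rewrite /G //.
by move=> x1 z1 x2 z2 <- <-.
Qed.

End FiberCombination.

Section HolomorphicDivision.
Variable R : realType.
Local Notation C := (Cfield R).
Variables (V : normedModType C) (D : opens C) (t : D) (W : opens (V * C)%type).
Hypothesis t0 : val t = 0.

(** A function on [W] can be compared with its value on the slice only at points whose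
    projection to the slice stays in [W]. *)
Definition slice_tube : opens (V * C)%type := opensI W (opens_fst (slice_open t W)).

Lemma slice_tube_sub : slice_tube `<=` W. Proof. by move=> x []. Qed.

Lemma slice_tube_fst : slice_tube `<=` fst @^-1` slice_open t W.
Proof. by move=> x [_ []]. Qed.

(** A function on the total space is congruent modulo [tau - t] to a function of the
    point of the slice, the isomorphism behind the action of [fiber_scale]. *)
Lemma holo_slice_expansion (b : holo W) :
  exists (c : holo (slice_open t W)) (d : holo slice_tube),
    holo_res slice_tube_sub b =
    holo_fst slice_tube_fst c + holo_snd_sub slice_tube (val t) * d.
Proof.
have db p : W p -> differentiable (valL_ 0 b) p by have /asboolP := holoP b; apply.
have cP : (fun y : slice_open t W => valL_ 0 b (val y, 0)) \in holomorphic (slice_open t W).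
  apply: (@holomorphic_ext _ _ _ _ (fun y => valL_ 0 b (y, 0))) => // y /= Wy.
  apply: (@differentiable_comp _ _ _ _ (fun y : V => (y, 0 : C)) (valL_ 0 b)).
    apply: (@differentiable_pair _ _ _ _ id (cst 0)); last exact: differentiable_cst.
    exact: ex_diff.
  by apply: db; move: Wy; rewrite /= t0.
have dP : (fun q : slice_tube => divided (valL_ 0 b) (val q)) \in holomorphic slice_tube.
  apply: (@holomorphic_ext _ _ _ _ (divided (valL_ 0 b))) => // q [Wq [Wq0 _]].
  apply: (divided_differentiable (opensP W) db Wq).
  by move: Wq0; rewrite /= t0.
exists (Holo cP), (Holo dP); apply: holo_eq => q.
rewrite -[LHS]/(b (subset_incl slice_tube_sub q)) -valL_val.
rewrite -[RHS]/(valL_ 0 b ((val q).1, 0) + ((val q).2 - val t) * divided (valL_ 0 b) (val q)).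
by rewrite t0 subr0; exact: dividedP.
Qed.

End HolomorphicDivision.

Section FiberBasis.
Variable R : realType.
Local Notation C := (Cfield R).
Variables (V : normedModType C) (Y : opens V) (D : opens C).
Variables (E : sheaf (opens_prod Y D)) (U : opens_in (opens_prod Y D)) (r m : nat).
Variables (f : sheaf_hom (free_sheaf U r) (free_sheaf U (r + m))).
Variables (g : sheaf_hom (free_sheaf U (r + m)) (sheaf_restr E U)).
Hypotheses (fg_exact : sheaf_exact f g) (g_surj : sheaf_surj g).
Variables (t : D) (B : 'M[C]_(m, r + m)).
Hypothesis t0 : val t = 0.

Local Notation UT := (opens_inT U).

Definition const_rows : 'M[holo UT]_(m, r + m) := map_mx (holo_cst UT) B.
Definition completed_mx : 'M[holo UT]_(r + m) := col_mx (hom_mx f) const_rows.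
Definition invertible_locus : opens (V * C)%type := nonvanishing (\det completed_mx).

Lemma ev_completed_mx (q : V * C) (Uq : UT q) :
  map_mx (ev (point_of Uq)) completed_mx = col_mx (mx_at f Uq) B.
Proof.
rewrite map_col_mx; congr col_mx.
by apply/matrixP => i j; rewrite !mxE.
Qed.

Lemma invertible_locusP (q : V * C) (Uq : UT q) :
  invertible_locus q <-> col_mx (mx_at f Uq) B \in unitmx.
Proof.
have dE : \det (map_mx (ev (point_of Uq)) completed_mx) = valL_ 0 (\det completed_mx) q.
  by rewrite det_map_mx; exact: esym (valL_val (\det completed_mx) (point_of Uq)).
rewrite -(ev_completed_mx Uq) unitmxE dE unitfE.
by split=> [[]|].
Qed.

Lemma invertible_locus_sub : invertible_locus `<=` U.
Proof. exact: nonvanishing_sub. Qed.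

Definition generator (j : 'I_m) : E (opens_in_incl UT) := g UT (row j const_rows).

(** Where the completed matrix is invertible, Cramer's rule writes any vector of
    functions as a combination of the rows of [f], which [g] kills, and of the
    constant rows. *)
Lemma generators_span (W : opens_in U) (h : W `<=` invertible_locus) (a : 'rV[holo W]_(r + m)) :
  exists b : 'I_m -> holo W,
    g W a = \sum_j b j *: (@sres _ _ _ E (opens_in_incl UT) (opens_in_incl W) (@opens_inP _ _ W) (generator j)).
Proof.
have [i iP] := holo_inverse (\det completed_mx).
pose k : W `<=` UT := @opens_inP _ _ W.
have iT : holo_res h i * \det (map_mx (holo_res k) completed_mx) = 1.
  have -> : \det (map_mx (holo_res k) completed_mx) =
      holo_res h (holo_res (@nonvanishing_sub _ _ _ (\det completed_mx)) (\det completed_mx)).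
    rewrite det_map_mx; apply: holo_eq => u.
    by rewrite !holo_resE; congr (holo_fun _ _); exact: val_inj.
  by rewrite -rmorphM iP rmorph1.
rewrite map_col_mx in iT; have [c [b aE]] := cramer_comb a iT.
exists b.
have gf : g W (c *m map_mx (holo_res k) (hom_mx f)) = 0.
  rewrite -(hom_mxE f c k); apply: (fg_exact _).2 => q Wq.
  by exists W, (fun _ z => z), c; split=> //; rewrite sres_id.
have gE j := g_res g k (row j const_rows).
rewrite (@linear_comb _ _ m W (free_sheaf U (r + m) W) (sheaf_restr E U W) (g W)
  (c *m map_mx (holo_res k) (hom_mx f)) a b
  (fun j => row j (map_mx (holo_res k) const_rows)) aE gf).
apply: eq_bigr => j _; congr (_ *: _).
by rewrite -map_row; exact: gE.
Qed.

Definition slice_locus : opens_in Y :=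
  @OpensIn _ (Y : set _) (slice_open t invertible_locus)
    (fun y Ny => (@opens_inP _ _ U _ (invertible_locus_sub Ny)).1).

Lemma slice_locus_sub : slice_locus `<=` slice_open t U.
Proof. by move=> y; exact: invertible_locus_sub. Qed.

Definition generator_section (j : 'I_m) : fiber_sections E t slice_locus :=
  image_section g slice_locus_sub (row j const_rows).

End FiberBasis.

Section FiberFree.
Variable R : realType.
Local Notation C := (Cfield R).
Variables (V : normedModType C) (Y : opens V) (D : opens C).
Variables (E : sheaf (opens_prod Y D)) (U : opens_in (opens_prod Y D)) (r m : nat).
Variables (f : sheaf_hom (free_sheaf U r) (free_sheaf U (r + m))).
Variables (g : sheaf_hom (free_sheaf U (r + m)) (sheaf_restr E U)).
Hypotheses (fg_exact : sheaf_exact f g) (g_surj : sheaf_surj g).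
Variables (t : D) (B : 'M[C]_(m, r + m)).
Hypothesis t0 : val t = 0.

Local Notation UT := (opens_inT U).
Local Notation Z1 := (slice_locus f t B).
Local Notation sec := (generator_section f g t B).

Lemma unit_comb_eq0 n1 n2 (A : 'M[C]_(n1, n1 + n2)) (B' : 'M[C]_(n2, n1 + n2)) (b : 'rV_n2) c :
  col_mx A B' \in unitmx -> b *m B' = c *m A -> b = 0.
Proof.
move=> AB bc; have : row_mx (- c) b *m col_mx A B' = 0.
  by rewrite mul_row_col mulNmx bc addNr.
rewrite -[0](mul0mx _ (col_mx A B')) => /(can_inj (mulmxK AB)).
by rewrite -row_mx0 => /eq_row_mx[].
Qed.

(** A relation between the generators evaluates at each point to one between the
    constant rows modulo the rows of the matrix of [f], trivial as the completed matrix is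
    invertible. *)
Lemma generator_section_free (W : opens_in Z1) (u : 'rV[holo W]_m)
    (h : opens_in_incl W `<=` Z1) :
  \sum_j u 0 j *: (@sres _ _ _ (fiber E t) Z1 (opens_in_incl W) h (sec j)) = 0 -> u = 0.
Proof.
move=> u0; apply/rowP => j; rewrite mxE; apply: holo_eq => -[x Wx].
have Wx' : opens_in_incl W x := set_mem Wx.
have Yx : Y x := @opens_inP _ _ (opens_in_incl W) _ Wx'.
pose y : Y := point_of Yx.
have Wy : opens_in_incl W (val y) := Wx'.
have Uy : UT (val (slice_point t y)) := slice_locus_sub (h _ Wx').
have Ny : invertible_locus f B (val (slice_point t y)) := h _ Wx'.
have rep j' : represents g (fiber_fun (@sres _ _ _ (fiber E t) Z1 (opens_in_incl W) h (sec j')) Wy)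
    (row j' B).
  have := @represents_image _ _ _ _ _ _ _ g t Z1 (@slice_locus_sub _ _ _ _ _ _ _ f t B)
    (row j' (const_rows U B)) y (h _ Wy) Uy.
  rewrite (_ : map_mx _ _ = row j' B) //.
  by apply/rowP => k; rewrite !mxE.
have Uy' : U (val (slice_point t y)) := Uy.
have := represents_comb (u : 'rV[holo (opens_in_incl W)]_m) Uy' rep; rewrite u0 => r1.
have r2 := @represents0 _ _ _ _ _ _ _ g (slice_point t y) Uy'.
have [c] := represents_unique fg_exact g_surj Uy r1 r2.
rewrite subr0 => uE.
have := unit_comb_eq0 ((invertible_locusP f B Uy).1 Ny) uE.
move=> /rowP/(_ j); rewrite !mxE => uj.
apply: etrans uj; rewrite /ev /=; congr (holo_fun _ _); exact: val_inj.
Qed.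

(** A section of [E_t] comes locally from a section of [E], which is a combination of
    generators with coefficients in all variables; the coefficients may be replaced by
    their values on the slice, because they differ from them by multiples of [tau - t]. *)
Lemma generator_section_span (U' : opens_in Z1) (s : fiber_sections E t (opens_in_incl U'))
    (x : V) : U' x ->
  exists (W : opens_in Z1) (h : opens_in_incl W `<=` opens_in_incl U') (k : opens_in_incl W `<=` Z1)
    (u : 'rV[holo W]_m),
    W x /\ \sum_j u 0 j *: (@sres _ _ _ (fiber E t) Z1 (opens_in_incl W) k (sec j)) =
      @sres _ _ _ (fiber E t) (opens_in_incl U') (opens_in_incl W) h s.
Proof.
move=> U'x; have Z1x : Z1 x := @opens_inP _ _ U' _ U'x.
have Yx : Y x := @opens_inP _ _ Z1 _ Z1x.
have [W0 [e [W0y se]]] := @fiber_funP _ _ _ _ _ _ _ s (point_of Yx) U'x.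
have Ux : U (x, val t) := slice_locus_sub Z1x.
have [W1 [h1 [a [W1x ga]]]] := lift_section g_surj e W0y Ux.
pose W : opens_in U := opens_inI W1 (invertible_locus f B).
have WW1 : W `<=` W1 by move=> q [].
have WN : W `<=` invertible_locus f B by move=> q [].
have [b bE] := generators_span fg_exact WN (map_mx (holo_res WW1) a).
have expand j : exists cd : holo (slice_open t W) * holo (slice_tube t W),
    holo_res (@slice_tube_sub _ _ _ t W) (b j) =
    holo_fst (@slice_tube_fst _ _ _ t W) cd.1 + holo_snd_sub (slice_tube t W) (val t) * cd.2.
  by have [c [d cd]] := holo_slice_expansion t0 (b j); exists (c, d).
have [cd cdE] := choice expand.
pose S : opens_in Z1 := opens_inI U' (slice_open t W).
have SU : opens_in_incl S `<=` opens_in_incl U' by move=> z [].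
have SZ : opens_in_incl S `<=` Z1 by move=> z /SU /(@opens_inP _ _ U').
have SW : S `<=` slice_open t W by move=> z [].
exists S, SU, SZ, (\row_j holo_res SW (cd j).1); split; first by [].
apply: fiber_sections_eq => y Sy.
have Wy : slice_open t W (val y) := Sy.2.
pose T' : opens_in U := opens_inI W (opens_fst (slice_open t W)).
pose T := opens_in_incl T'.
have Ty : T (val (slice_point t y)) by split.
have TU : T `<=` opens_in_incl UT := @opens_inP _ _ T'.
pose TW : T `<=` opens_in_incl W := @slice_tube_sub _ _ _ t W.
have TW1 : T `<=` opens_in_incl W1 by move=> z [[]].
have TW0 : T `<=` W0 by move=> z /TW1 /h1.
pose G j : E T := sres TU (generator g B j).
have eT : sres TW0 e = \sum_j (holo_fst (@slice_tube_fst _ _ _ t W) (cd j).1 +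
    holo_snd_sub T (val t) * (cd j).2) *: G j.
  have c1 := @sres_comp _ _ _ E W0 (opens_in_incl W1) T h1 TW1 TW0 e.
  have c2 := @sres_comp _ _ _ E (opens_in_incl W1) (opens_in_incl W) T WW1 TW TW1 (g W1 a).
  have c3 j := @sres_comp _ _ _ E (opens_in_incl UT) (opens_in_incl W) T
    (@opens_inP _ _ W) TW TU (generator g B j).
  rewrite -c1 -ga -c2 -(g_res g WW1 a) bE (@sres_comb _ _ _ E (opens_in_incl W) T).
  by apply: eq_bigr => j _; rewrite c3 -cdE.
have lhs j : fiber_scale (p := slice_point t y) (U := S) Sy ((\row_j holo_res SW (cd j).1) 0 j)
    (fiber_fun (@sres _ _ _ (fiber E t) Z1 (opens_in_incl S) SZ (sec j)) Sy) =
    fiber_scale (p := slice_point t y) Wy (cd j).1 (fiber_class Ty (G j)).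
  rewrite mxE; apply: (etrans (esym (@fiber_scale_res _ _ _ E (slice_point t y) _ _ SW Wy Sy (cd j).1 _))).
  congr fiber_scale; rewrite /= /image_fun.
  exact: (@fiber_class_res _ _ _ E (slice_point t y) (opens_in_incl UT) T).
apply: (etrans (@fiber_fun_comb _ _ _ _ _ t m (opens_in_incl S) _ _ y Sy)).
apply: (etrans (eq_bigr _ (fun j _ => lhs j))).
apply: (etrans (esym (@fiber_class_comb _ _ _ _ _ m (slice_point t y) T _ (@slice_tube_fst _ _ _ t W) Ty Wy _ _))).
apply: (etrans (esym (@fiber_class_mod _ _ _ _ _ m (slice_point t y) T Ty _ (fun j => (cd j).2) _))).
rewrite -[(val (slice_point t y)).2]/(val t) -eT.
by rewrite [RHS](se y (SU _ Sy) (TW0 _ Ty)) (fiber_class_res TW0 _ Ty).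
Qed.

End FiberFree.

Section FiberLocallyFree.
Variable R : realType.
Local Notation C := (Cfield R).
Variables (V : normedModType C) (Y : opens V) (D : opens C).
Variables (E : sheaf (opens_prod Y D)) (U : opens_in (opens_prod Y D)) (r m : nat).
Variables (f : sheaf_hom (free_sheaf U r) (free_sheaf U (r + m))).
Variables (g : sheaf_hom (free_sheaf U (r + m)) (sheaf_restr E U)).
Hypotheses (fg_exact : sheaf_exact f g) (g_surj : sheaf_surj g).
Variable t : D.
Hypothesis t0 : val t = 0.

Lemma locally_free_of_row_free (y : Y) (Uy : opens_inT U (val (slice_point t y))) :
  row_free (mx_at f Uy) -> locally_free_at m (fiber E t) (val y).
Proof.
move=> /exists_complement [B AB].
have [phi phiE] := hom_of_sections (F := fiber E t) (generator_section f g t B).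
have phi_inj : sheaf_inj phi.
  move=> W u v uv; apply/eqP; rewrite -subr_eq0; apply/eqP.
  pose h : opens_in_incl W `<=` slice_locus f t B := @opens_inP _ _ W.
  apply: (generator_section_free fg_exact g_surj (h := h)).
  apply: (etrans (esym (phiE W h (u - v)))).
  by apply: (etrans (linearB (phi W) u v)); rewrite uv subrr.
have phi_surj : sheaf_surj phi.
  move=> U' s x U'x.
  have [W [h [k [u [Wx us]]]]] := generator_section_span fg_exact g_surj t0 s U'x.
  by exists W, h, u; split=> //; apply: (etrans (phiE W k u)).
exists (slice_locus f t B); split; first exact: (invertible_locusP f B Uy).2.
by exists phi; exact: sheaf_iso_of_inj_surj.
Qed.

End FiberLocallyFree.

(** * The degeneration *)

Theorem corollary2p8 (R : realType)
    (E : sheaf (opens_prod (ball3 R) (disk R))) (hE : family_degenerating E)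
    (r : nat) :
  ~ presented_near r E (0, 0).
Proof.
move=> [U [f [g [U0 [f_inj fg_exact g_surj]]]]].
have [_ free_t _ free_0 not_free] := hE.
pose M (q : 'rV[Cfield R]_3 * Cfield R) := \matrix_(i, j) valL_ 0 (hom_mx f i j) q.
have ME q (Uq : opens_inT U q) : M q = mx_at f Uq.
  by apply/matrixP => i j; rewrite mxE [RHS]mxE; exact: (valL_val (hom_mx f i j) (point_of Uq)).
have M0 : row_free (M (0, 0)).
  apply: (@row_free_at_isolated_point R 2 r (r + 2) M U); [|exact: opensP|exact: U0| |].
  - by rewrite addnC ltn_add2r.
  - move=> q i j Uq; rewrite (_ : (fun q => M q i j) = valL_ 0 (hom_mx f i j)).
      by have /asboolP := holoP (hom_mx f i j); apply.
    by apply/funext => p; rewrite mxE.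
  move=> [x s] Uq q0; have [xB sD] := @opens_inP _ _ U _ Uq.
  rewrite (ME _ Uq) /row_free eqn_leq rank_leq_row -(leq_add2r 2).
  pose y : ball3 R := point_of xB; pose t : disk R := point_of sD.
  apply: (@rank_of_locally_free _ _ _ _ _ _ _ _ f g fg_exact g_surj t 2 y Uq).
  have [tE|t0] := eqVneq t (disk0 R); last exact: free_t.
  rewrite tE; apply: free_0; first exact: xB.
  apply/eqP => x0; move: q0; rewrite (_ : x = 0) // (_ : s = 0) ?eqxx //.
  exact: (congr1 val tE).
apply: not_free; exists 2.
have B0 : (ball3 R) 0 := (@opens_inP _ _ U _ U0).1.
pose y : ball3 R := point_of B0.
have Uy : opens_inT U (val (slice_point (disk0 R) y)) := U0.
apply: (@locally_free_of_row_free _ _ _ _ _ _ _ _ f g fg_exact g_surj (disk0 R) (erefl _) y Uy).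
by rewrite -(ME (0, 0)).
Qed.
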